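(* Let $\Omega\subset\mathbb C^n$ be a bounded domain and let $1\le p\le 2$. Then $$K_p(\cdot,z)=K_{2,p,z}(\cdot,z),\qquad \forall\, z\in\Omega.$$
   Context: All integrals are with respect to Lebesgue measure. $A^p(\Omega)=\{f\in\mathcal O(\Omega):\|f\|_p^p:=\int_\Omega|f|^p<\infty\}$. For $z\in\Omega$ put $m_p(z):=\inf\{\|f\|_p: f\in A^p(\Omega),\ f(z)=1\}$; for $1\le p<\infty$ the infimum is attained by exactly one function $m_p(\cdot,z)$. Set $K_p(z):=m_p(z)^{-p}$ and $K_p(\cdot,z):=m_p(\cdot,z)K_p(z)$. For a measurable real-valued function $\varphi$ on $\Omega$ (defined almost everywhere) such that each point of $\Omega$ has a neighborhood on which $e^{\alpha\varphi}$ is integrable for some $\alpha>0$, set $A^2(\Omega,\varphi):=\{f\in\mathcal O(\Omega):\int_\Omega|f|^2e^{-\varphi}<\infty\}$. It is a Hilbert space with a unique reproducing kernel $K_{\Omega,\varphi}(\cdot,\cdot)$, i.e. $K_{\Omega,\varphi}(\cdot,w)\in A^2(\Omega,\varphi)$ and $f(w)=\int_\Omega f\,\overline{K_{\Omega,\varphi}(\cdot,w)}\,e^{-\varphi}$ for all $f\in A^2(\Omega,\varphi)$, $w\in\Omega$. For $p\ge1$ and $z\in\Omega$, $K_{2,p,z}(\cdot,\cdot):=K_{\Omega,\varphi}(\cdot,\cdot)$ with $\varphi=(2-p)\log|m_p(\cdot,z)|$. *)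

(* Defs.v *)
From HB Require Import structures.
From mathcomp Require Import all_boot all_order all_algebra.
From mathcomp Require Import complex.
From mathcomp Require Import all_classical all_reals all_analysis.

Set Implicit Arguments.
Unset Strict Implicit.
Unset Printing Implicit Defensive.

Import Order.TTheory GRing.Theory Num.Theory.
Import numFieldNormedType.Exports.

Local Open Scope classical_set_scope.
Local Open Scope ring_scope.
Local Open Scope complex_scope.

(* The type [R[i]] has no topology of its own; as a [numClosedFieldType] it
   gets the norm topology of [numFieldNormedType], and so do row vectors
   over it. *)
Definition C (R : realType) : numClosedFieldType := R[i].

(* The canonical sigma-finite structure on [mu \x nu] is not inferred for
   sigma-finite factors, hence the explicit instances below. *)
Lemma sigma_finite_product d d' (T : measurableType d) (U : measurableType d')
    (R : realType) (mu : {sigma_finite_measure set T -> \bar R})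
    (nu : {sigma_finite_measure set U -> \bar R}) :
  sigma_finite setT (mu \x nu)%E.
Proof.
have /sigma_finiteP[F [FT ndF Foo]] := sigma_finiteT mu.
have /sigma_finiteP[G [GT ndG Goo]] := sigma_finiteT nu.
exists (fun k => F k `*` G k).
  apply/esym; rewrite -subTset => -[x y] _.
  have [i _ Fi] : (\bigcup_i F i) x by rewrite -FT.
  have [j _ Gj] : (\bigcup_i G i) y by rewrite -GT.
  exists (maxn i j) => //; split.
  - by move: Fi; exact/subsetPset/ndF/leq_maxl.
  - by move: Gj; exact/subsetPset/ndG/leq_maxr.
move=> k; have [mF oF] := Foo k; have [mG oG] := Goo k.
split; first exact: measurableX.
by rewrite product_measure1E// lte_mul_pinfty// ge0_fin_numE.
Qed.

Section measure_cons.
Context d (T : measurableType d) (R : realType).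
Variables (mu : {sigma_finite_measure set T -> \bar R}) (n : nat)
  (nu : {sigma_finite_measure set (n.-tuple T) -> \bar R}).

Definition consT (x : T * n.-tuple T) : n.+1.-tuple T :=
  [the n.+1.-tuple T of x.1 :: x.2].

Lemma measurable_consT : measurable_fun [set: T * n.-tuple T] consT.
Proof. exact: measurable_cons. Qed.

Definition measure_cons : set (n.+1.-tuple T) -> \bar R :=
  pushforward (mu \x nu)%E consT.

Let pm : {measure set (n.+1.-tuple T) -> \bar R} :=
  measure_function_pushforward__canonical__measure_function_Measure
    ((mu \x nu)%E : {measure set _ -> \bar R}) measurable_consT.

HB.instance Definition _ := isMeasure.Build _ _ _ measure_cons
  (measure0 pm) (measure_ge0 pm) (@measure_semi_sigma_additive _ _ _ pm).

Lemma sigma_finite_measure_cons : sigma_finite setT measure_cons.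
Proof.
have [F FT Ffin] := sigma_finite_product mu nu.
pose g (t : n.+1.-tuple T) : T * n.-tuple T := (thead t, [tuple of behead t]).
have gK : cancel consT g.
  by case=> x t; rewrite /g /consT theadE; congr (_, _); apply: val_inj.
have mg : measurable_fun [set: n.+1.-tuple T] g.
  apply/measurable_fun_pairP; split; last exact: measurable_behead.
  exact: measurable_tnth.
exists (fun k => g @^-1` F k).
  by rewrite -preimage_bigcup -FT preimage_setT.
move=> k; have [mF oF] := Ffin k; split.
  by rewrite -[X in measurable X]setTI; exact: mg.
rewrite /measure_cons /pushforward -comp_preimage.
by rewrite (_ : g \o consT = id) ?preimage_id//; exact/funext.
Qed.

HB.instance Definition _ :=
  Measure_isSigmaFinite.Build _ _ _ measure_cons sigma_finite_measure_cons.

End measure_cons.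

Fixpoint measure_tuple d (T : measurableType d) (R : realType)
    (mu : {sigma_finite_measure set T -> \bar R}) (n : nat) :
    {sigma_finite_measure set (n.-tuple T) -> \bar R} :=
  if n is n'.+1 then measure_cons mu (measure_tuple mu n')
  else dirac [tuple].

Section lebesgue.
Context (R : realType).

Definition plane := (measurableTypeR R * measurableTypeR R)%type.

Definition lebesgue_plane : set plane -> \bar R :=
  (lebesgue_measure \x lebesgue_measure)%E.

HB.instance Definition _ := Measure.on lebesgue_plane.
HB.instance Definition _ := Measure_isSigmaFinite.Build _ _ _ lebesgue_plane
  (sigma_finite_product lebesgue_measure lebesgue_measure).

Context (n : nat).

Definition of_plane (t : n.-tuple plane) : 'rV[C R]_n :=
  \row_i ((tnth t i).1 +i* (tnth t i).2).

(* Integrals over subsets of C^n are taken in the real coordinates given by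
   [of_plane]. *)
Definition integral_Cn (D : set 'rV[C R]_n) (F : 'rV[C R]_n -> R) : \bar R :=
  (\int[measure_tuple lebesgue_plane n]_(t in of_plane @^-1` D)
     (F (of_plane t))%:E)%E.

Definition integral_CnC (D : set 'rV[C R]_n) (F : 'rV[C R]_n -> C R) : C R :=
  fine (integral_Cn D (fun x => complex.Re (F x)))
  +i* fine (integral_Cn D (fun x => complex.Im (F x))).

End lebesgue.

Section bergman.
Context (R : realType) (n : nat) (Omega : set 'rV[C R]_n).
Implicit Types (f k : 'rV[C R]_n -> C R) (z w x : 'rV[C R]_n).

Definition modulus (a : C R) : R := Normc.normc a.

(* Functions on Omega are total functions whose values off Omega are
   irrelevant; differentiability is over the field [C R]. *)
Definition holomorphic f := forall x, Omega x -> differentiable f x.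

Definition A_p (p : R) : set ('rV[C R]_n -> C R) :=
  [set f | holomorphic f /\
    (integral_Cn Omega (fun x => modulus (f x) `^ p)%R < +oo)%E].

Definition p_norm (p : R) f : R :=
  fine (integral_Cn Omega (fun x => modulus (f x) `^ p)) `^ p^-1.

Definition m_p (p : R) z : R :=
  inf [set p_norm p f | f in [set f | A_p p f /\ f z = 1]].

Definition p_minimizer (p : R) z : 'rV[C R]_n -> C R :=
  xget (fun=> 0) [set f | [/\ A_p p f, f z = 1 & p_norm p f = m_p p z]].

Definition p_kernel_diag (p : R) z : R := m_p p z `^ (- p).

Definition p_kernel (p : R) x z : C R :=
  p_minimizer p z x * (p_kernel_diag p z)%:C.

Definition A2_weighted (phi : 'rV[C R]_n -> R) : set ('rV[C R]_n -> C R) :=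
  [set f | holomorphic f /\
    (integral_Cn Omega (fun x => modulus (f x) ^+ 2 * expR (- phi x))%R
       < +oo)%E].

(* The condition on [k] = K(., w) for the single point w; the kernel below is
   then chosen pointwise in its second argument. *)
Definition reproducing_at (phi : 'rV[C R]_n -> R) w k :=
  A2_weighted phi k /\
  forall f, A2_weighted phi f ->
    f w = integral_CnC Omega
            (fun x => f x * (k x)^* * (expR (- phi x))%:C).

Definition weighted_kernel (phi : 'rV[C R]_n -> R) x w : C R :=
  xget (fun=> 0) [set k | reproducing_at phi w k] x.

(* At the zeros of the minimizer, where the weight is undefined, [ln 0 = 0]
   gives it the value 0. *)
Definition weight_2p (p : R) z x : R :=
  (2 - p) * ln (modulus (p_minimizer p z x)).

Definition kernel_2p (p : R) z x w : C R := weighted_kernel (weight_2p p z) x w.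

End bergman.

(* Main.v *)
Require Import Defs.
From HB Require Import structures.
From mathcomp Require Import all_boot all_order all_algebra.
From mathcomp Require Import complex.
From mathcomp Require Import all_classical all_reals all_analysis.
From mathcomp Require Import measurable_realfun.
From mathcomp Require Import ring lra.
Set Implicit Arguments.
Unset Strict Implicit.
Unset Printing Implicit Defensive.
Import Order.TTheory GRing.Theory Num.Theory.
Import numFieldNormedType.Exports.
Local Open Scope classical_set_scope.
Local Open Scope ring_scope.

(** The kernel is identified by the first variation of the [p]-norm.

    Let [m] minimize the [p]-norm among the functions with value 1 at [z], and
    let [K] be the power [- p] of its norm. With the weight [|m| ^ (p - 2)], which
    is [expR (- phi)] off the zeros of [m], the weighted square norm of [m] is
    its [p]-norm to the power [p]. For [1 <= p <= 2] the function [x ^ (p / 2)]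
    is concave, so [|m + s g| ^ p] lies below its first order expansion in
    [|m + s g| ^ 2], and this expansion is [|m| ^ p] plus [p / 2] times the weight
    times [2 s Re (g conj m) + s ^ 2 |g| ^ 2] ([modulus_powR_tangent]). Hence for
    each [g] in the weighted space with [g z = 0] the function [m + s g] is a
    competitor of [m], and the real part of the weighted pairing of [g] with [m]
    must vanish ([minimizer_orthogonal]). Applying this to [f - f z m] and to its
    multiple by ['i] shows that [K m] reproduces the value of [f] at [z]
    ([minimizer_reproducing]). A reproducing kernel is unique, because the
    difference of two of them is orthogonal to itself ([reproducing_unique]).

    The tangent inequality is available only where [m] is nonzero, so the zeros
    of [m] have to be a null set ([zeros_negligible]). The minimizer exists
    ([minimizer_exists]) because a minimizing sequence is locally bounded, by the
    sub-mean value inequality ([submean_holomorphic]), hence has a subsequence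
    that converges pointwise to a holomorphic function ([montel]), whose norm is
    bounded by Fatou's lemma.

    These facts about holomorphic functions of several variables are reduced to
    one complex variable. There, Goursat's theorem on rectangles ([goursat])
    gives Cauchy's formula ([cauchy_formula]) and Taylor's formula with a remainder
    that depends on the supremum only ([taylor]). Integrals and null sets pass to
    several variables by induction and Fubini's theorem ([submean], [zeros_null]);
    estimates of differentials pass by restriction to complex lines
    ([holomorphic_estimates]). Constants are kept explicit but not sharp. *)

Local Notation Cre := complex.Re.
Local Notation Cim := complex.Im.

(** * The modulus and the topology of complex row vectors *)

Section modulus_theory.
Context {R : realType}.
Implicit Types (z w : C R) (r : R).

Lemma normE z : `|z| = ((modulus z)%:C)%C :> C R.
Proof. by case: z. Qed.

Lemma modulus_ge0 z : 0 <= modulus z.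
Proof. by case: z => a b; rewrite /modulus /= sqrtr_ge0. Qed.

Lemma modulus0 : modulus (0 : C R) = 0.
Proof. exact: ComplexField.Normc.normc0. Qed.

Lemma modulus1 : modulus (1 : C R) = 1.
Proof. exact: ComplexField.Normc.normc1. Qed.

Lemma modulus_eq0 z : (modulus z == 0) = (z == 0).
Proof.
apply/eqP/eqP => [|->]; last exact: modulus0.
exact: ComplexField.Normc.eq0_normc.
Qed.

Lemma modulusM z w : modulus (z * w) = modulus z * modulus w.
Proof. exact: ComplexField.Normc.normcM. Qed.

Lemma modulusV z : modulus z^-1 = (modulus z)^-1.
Proof. exact: ComplexField.Normc.normcV. Qed.

Lemma modulusX z n : modulus (z ^+ n) = modulus z ^+ n.
Proof.
by elim: n => [|n IH]; rewrite ?expr0 ?modulus1// !exprS modulusM IH.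
Qed.

Lemma modulusD z w : modulus (z + w) <= modulus z + modulus w.
Proof. exact: le_normcD. Qed.

Lemma modulusN z : modulus (- z) = modulus z.
Proof. exact: normcN. Qed.

Lemma modulusB z w : modulus (z - w) <= modulus z + modulus w.
Proof. by rewrite -(modulusN w) modulusD. Qed.

Lemma modulusBC z w : modulus (z - w) = modulus (w - z).
Proof. by rewrite -modulusN opprB. Qed.

Lemma modulus_real r : modulus (r%:C)%C = `|r|.
Proof. by rewrite /modulus /= expr0n /= addr0 sqrtr_sqr. Qed.

Lemma modulus_i : modulus ('i%C : C R) = 1.
Proof. by rewrite /modulus /= expr0n expr1n /= add0r sqrtr1. Qed.

Lemma modulus_sqr z : modulus z ^+ 2 = Cre z ^+ 2 + Cim z ^+ 2.
Proof. by case: z => a b; rewrite /modulus /= sqr_sqrtr // addr_ge0 ?sqr_ge0. Qed.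

Lemma modulus_conj z : modulus (z^*) = modulus z.
Proof. by case: z => a b; rewrite /modulus /= sqrrN. Qed.

Lemma modulus_gt0 z : (0 < modulus z) = (z != 0).
Proof. by rewrite lt_def modulus_eq0 modulus_ge0 andbT. Qed.

Lemma Re_le_modulus z : `|Cre z| <= modulus z.
Proof.
case: z => a b; rewrite /modulus /= -sqrtr_sqr ler_wsqrtr //.
by rewrite lerDl sqr_ge0.
Qed.

Lemma Im_le_modulus z : `|Cim z| <= modulus z.
Proof.
case: z => a b; rewrite /modulus /= -sqrtr_sqr ler_wsqrtr //.
by rewrite lerDr sqr_ge0.
Qed.

Lemma modulus_le z : modulus z <= `|Cre z| + `|Cim z|.
Proof.
rewrite [in leLHS](complexE z); apply: (le_trans (modulusD _ _)).
by rewrite modulusM modulus_i mul1r !modulus_real.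
Qed.

Lemma ler_dist_modulus z w : `|modulus z - modulus w| <= modulus (z - w).
Proof.
rewrite ler_norml; apply/andP; split.
  rewrite -subr_ge0 opprK addrAC subr_ge0 addrC modulusBC -lerBlDr.
  by have := modulusD (w - z) z; rewrite subrK -lerBlDr.
by have := modulusD (z - w) w; rewrite subrK -lerBlDr.
Qed.

Lemma gt0_real_complex (e : C R) : 0 < e -> 0 < Cre e /\ e = ((Cre e)%:C)%C.
Proof. by case: e => a b; rewrite ltcE /= => /andP[/eqP -> ?]. Qed.

Lemma nbhs_modulusP z (A : set (C R)) : nbhs z A <->
  exists2 e : R, 0 < e & forall y, modulus (y - z) < e -> A y.
Proof.
split => [/nbhs_normP[e /= e0 eA]|[e e0 eA]].
  have [e0' eE] := gt0_real_complex e0; exists (Cre e) => // y ye.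
  by apply: eA => /=; rewrite distrC normE eE ltcR.
apply/nbhs_normP; exists (e%:C)%C => /=; first by rewrite ltcR.
by move=> y /=; rewrite distrC normE ltcR => /eA.
Qed.

Lemma nbhs_rowP n (x : 'rV[C R]_n) (A : set 'rV[C R]_n) : nbhs x A <->
  exists2 e : R, 0 < e &
    forall y : 'rV[C R]_n, (forall i, modulus (y ord0 i - x ord0 i) < e) -> A y.
Proof.
have rcE (r s : R) : (((r%:C)%C : C R) < ((s%:C)%C : C R)) = (r < s) by exact: ltcR.
split => [/nbhs_ballP[e /= e0 eA]|[e e0 eA]].
  have [e0' eE] := gt0_real_complex e0; exists (Cre e) => // y ye.
  apply: eA; split => // i j; rewrite eE /ball /= (ord1 i) distrC normE rcE; exact: ye.
apply/nbhs_ballP; exists (e%:C)%C => /=; first by rewrite rcE.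
move=> y [_ xy]; apply: eA => i.
by have := xy ord0 i; rewrite /ball /= distrC normE rcE.
Qed.

End modulus_theory.

(** * Complex derivatives with real error bounds *)

Section complex_differentiability.
Context {R : realType}.
Implicit Types (z w : C R) (r : R).

Lemma modulus_difference_quotient (V : normedModType (C R)) (f : V -> C R)
    (a v : V) (h l : C R) : h != 0 ->
  modulus (l - h^-1 *: (f (h *: v + a) - f a)) =
    modulus (f (h *: v + a) - f a - h * l) / modulus h.
Proof.
move=> h0; rewrite modulusBC -modulusV -modulusM; congr modulus.
by rewrite mulrBl mulrAC divff// mul1r mulrC.
Qed.

Lemma derive_modulusP (V : normedModType (C R)) (f : V -> C R) (a v : V) :
  derivable f a v -> forall e : R, 0 < e ->
    exists2 d : R, 0 < d & forall h : C R, modulus h < d ->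
      modulus (f (h *: v + a) - f a - h * 'D_v f a) <= e * modulus h.
Proof.
move=> df e e0; pose l : C R := 'D_v f a.
have /cvgrPdist_lt/(_ (e%:C)%C) := df.
have ec : (0 : C R) < (e%:C)%C by rewrite ltcR.
move=> /(_ ec); rewrite near_withinE => /nbhs_modulusP[d d0 dP].
exists d => // h hd; have [->|h0] := eqVneq h 0.
  by rewrite scale0r add0r subrr mul0r subrr modulus0 mulr0.
have := dP h; rewrite subr0 => /(_ hd h0).
rewrite normE /= ltcR modulus_difference_quotient// => /ltW.
by rewrite ler_pdivrMr// modulus_gt0.
Qed.

Lemma derivable_modulusP (V : normedModType (C R)) (f : V -> C R) (a v : V) :
  derivable f a v <-> exists l : C R, forall e : R, 0 < e ->
    exists2 d : R, 0 < d & forall h : C R, modulus h < d ->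
      modulus (f (h *: v + a) - f a - h * l) <= e * modulus h.
Proof.
split=> [df|[l fl]]; first by exists ('D_v f a); exact: derive_modulusP.
apply/cvg_ex; exists l; apply/cvgrPdist_lt => e /gt0_real_complex [e0 ->].
have [d d0 dP] := fl _ (divr_gt0 e0 (ltr0Sn R 1)).
rewrite near_withinE; apply/nbhs_modulusP; exists d => // h.
rewrite subr0 => hd h0; rewrite normE ltcR /= modulus_difference_quotient//.
rewrite ltr_pdivrMr ?modulus_gt0//; apply: (le_lt_trans (dP _ hd)).
rewrite ltr_pM2r ?modulus_gt0//; lra.
Qed.

Lemma derivable_line (V : normedModType (C R)) (f : V -> C R) (a v : V) z :
  derivable f (a + z *: v) v -> derivable (fun t : C R => f (a + t *: v)) z 1.
Proof.
move=> /derivable_modulusP[l fl]; apply/derivable_modulusP; exists l => e e0.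
have [d d0 dP] := fl _ e0; exists d => // h hd.
have -> : a + (h *: (1 : C R) + z) *: v = h *: v + (a + z *: v).
  by rewrite scalerDl addrCA /GRing.scale/= mulr1.
exact: dP.
Qed.

Lemma derivable_cont (f : C R -> C R) z :
  derivable f z 1 -> {for z, continuous f}.
Proof. by move=> /derivable1_diffP/differentiable_continuous. Qed.

Lemma continuous_modulusP (T : topologicalType) (f : T -> C R) (x : T) :
  {for x, continuous f} <->
  forall e : R, 0 < e -> \forall y \near x, modulus (f y - f x) < e.
Proof.
split=> [fx e e0|fx].
  have /fx : nbhs (f x) [set w | modulus (w - f x) < e].
    by apply/nbhs_modulusP; exists e.
  by [].
move=> A /nbhs_modulusP[e e0 eA]; apply: filterS (fx _ e0) => y; exact: eA.
Qed.

Lemma cont_add (f g : C R -> C R) z :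
  {for z, continuous f} -> {for z, continuous g} ->
  {for z, continuous (fun t : C R => f t + g t)}.
Proof. exact: continuousD. Qed.

Lemma cont_mul (f g : C R -> C R) z :
  {for z, continuous f} -> {for z, continuous g} ->
  {for z, continuous (fun t : C R => f t * g t)}.
Proof. exact: continuousM. Qed.

Lemma cont_scale (k : C R) (f : C R -> C R) z :
  {for z, continuous f} -> {for z, continuous (fun t : C R => k * f t)}.
Proof. by move=> fc; apply: cont_mul fc; exact: cst_continuous. Qed.

Lemma cont_addcst (k : C R) (f : C R -> C R) z :
  {for z, continuous f} -> {for z, continuous (fun t : C R => f t + k)}.
Proof. by move=> fc; apply: (cont_add fc); exact: cst_continuous. Qed.

Lemma continuous_comp_modulus (T : topologicalType) (f : T -> C R)
    (g : C R -> R) (x : T) :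
  (forall z w, `|g z - g w| <= modulus (z - w)) ->
  {for x, continuous f} -> {for x, continuous (g \o f)}.
Proof.
move=> gL /continuous_modulusP fx; apply/cvgrPdist_lt => e e0 /=.
apply: filterS (fx _ e0) => y; apply: le_lt_trans.
by rewrite distrC.
Qed.

Lemma Re_lip z w : `|Cre z - Cre w| <= modulus (z - w).
Proof. by case: z w => [a b] [c d]; exact: (Re_le_modulus ((a - c) +i* (b - d))%C). Qed.

Lemma Im_lip z w : `|Cim z - Cim w| <= modulus (z - w).
Proof. by case: z w => [a b] [c d]; exact: (Im_le_modulus ((a - c) +i* (b - d))%C). Qed.

Lemma continuous_hline (f : C R -> C R) (x y : R) :
  {for (x +i* y)%C, continuous f} ->
  {for x, continuous (fun t : R => f (t +i* y)%C)}.
Proof.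
move=> /continuous_modulusP fx; apply/continuous_modulusP => e e0.
have /nbhs_modulusP[d d0 dP] := fx _ e0.
near=> t; apply: dP.
have -> : (t +i* y)%C - (x +i* y)%C = ((t - x)%:C)%C :> C R.
  by simpc; rewrite complexr0.
rewrite modulus_real distrC; near: t.
exact: (@cvgr_dist_lt _ _ _ (nbhs x) _ id x).
Unshelve. all: by end_near. Qed.

Lemma continuous_vline (f : C R -> C R) (x y : R) :
  {for (x +i* y)%C, continuous f} ->
  {for y, continuous (fun t : R => f (x +i* t)%C)}.
Proof.
move=> /continuous_modulusP fx; apply/continuous_modulusP => e e0.
have /nbhs_modulusP[d d0 dP] := fx _ e0.
near=> t; apply: dP.
have -> : (x +i* t)%C - (x +i* y)%C = (0 +i* (t - y))%C :> C R by simpc.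
rewrite /modulus/= expr0n add0r sqrtr_sqr distrC; near: t.
exact: (@cvgr_dist_lt _ _ _ (nbhs y) _ id y).
Unshelve. all: by end_near. Qed.

End complex_differentiability.

(** * Integrals of complex functions over segments *)

Section segment_integral.
Context {R : realType}.
Implicit Types (a b r : R) (g h : R -> C R) (k : C R).
Local Notation mu := (@lebesgue_measure R).

Definition cint a b g : C R :=
  ((\int[mu]_(x in `[a, b]) Cre (g x))%R +i*
   (\int[mu]_(x in `[a, b]) Cim (g x))%R)%C.

Definition cont_on a b g := forall x, a <= x <= b -> {for x, continuous g}.

Lemma cont_integrable a b (u : R -> R) :
  (forall x, a <= x <= b -> {for x, continuous u}) ->
  mu.-integrable `[a, b] (EFin \o u).
Proof.
move=> uc; apply: continuous_compact_integrable; first exact: segment_compact.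
apply: continuous_in_subspaceT => x; rewrite inE /= in_itv /=; exact: uc.
Qed.

Lemma integrable_Re a b g : cont_on a b g ->
  mu.-integrable `[a, b] (EFin \o (fun x => Cre (g x))).
Proof.
move=> gc; apply: cont_integrable => x /gc.
exact: (continuous_comp_modulus Re_lip).
Qed.

Lemma integrable_Im a b g : cont_on a b g ->
  mu.-integrable `[a, b] (EFin \o (fun x => Cim (g x))).
Proof.
move=> gc; apply: cont_integrable => x /gc.
exact: (continuous_comp_modulus Im_lip).
Qed.

Lemma integrable_modulus a b g : cont_on a b g ->
  mu.-integrable `[a, b] (EFin \o (fun x => modulus (g x))).
Proof.
move=> gc; apply: cont_integrable => x /gc.
exact: (continuous_comp_modulus ler_dist_modulus).
Qed.

Lemma measurable_modulus a b g : cont_on a b g ->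
  measurable_fun `[a, b] (fun x => (modulus (g x))%:E).
Proof. by move=> /integrable_modulus/integrableP[]. Qed.

Lemma integrable_scale a b r (u : R -> R) : mu.-integrable `[a, b] (EFin \o u) ->
  mu.-integrable `[a, b] (EFin \o (fun x => r * u x)).
Proof. by move=> iu; apply: (@integrableZl _ _ _ mu _ _ r (EFin \o u)). Qed.

Lemma eq_cint a b g h : (forall x, a <= x <= b -> g x = h x) ->
  cint a b g = cint a b h.
Proof.
move=> gh; rewrite /cint; congr Complex; apply: eq_Rintegral => x;
  by rewrite inE /= in_itv /= => /gh ->.
Qed.

Lemma ReD (z w : C R) : Cre (z + w : C R) = Cre z + Cre w.
Proof. by case: z w => [? ?] [? ?]. Qed.
Lemma ImD (z w : C R) : Cim (z + w : C R) = Cim z + Cim w.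
Proof. by case: z w => [? ?] [? ?]. Qed.
Lemma ReM (z w : C R) : Cre (z * w : C R) = Cre z * Cre w - Cim z * Cim w.
Proof. by case: z w => [? ?] [? ?]. Qed.
Lemma ImM (z w : C R) : Cim (z * w : C R) = Cre z * Cim w + Cim z * Cre w.
Proof. by case: z w => [? ?] [? ?]. Qed.

Lemma cintD a b g h : cont_on a b g -> cont_on a b h ->
  cint a b (fun x => g x + h x) = cint a b g + cint a b h.
Proof.
move=> gc hc; rewrite /cint; simpc; congr Complex.
  rewrite -RintegralD//; [|exact: integrable_Re..].
  by apply: eq_Rintegral => x _; rewrite ReD.
rewrite -RintegralD//; [|exact: integrable_Im..].
by apply: eq_Rintegral => x _; rewrite ImD.
Qed.

Lemma cintZ a b k g : cont_on a b g ->
  cint a b (fun x => k * g x) = k * cint a b g.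
Proof.
move=> gc; rewrite /cint; case: k => k1 k2; simpc; congr Complex.
  rewrite -!RintegralZl//; [|exact: integrable_Im|exact: integrable_Re].
  rewrite -RintegralB//.
  - by apply: eq_Rintegral => x _; rewrite ReM.
  - exact: (integrable_scale _ (integrable_Re gc)).
  - exact: (integrable_scale _ (integrable_Im gc)).
rewrite -!RintegralZl//; [|exact: integrable_Re|exact: integrable_Im].
rewrite -RintegralD//.
- by apply: eq_Rintegral => x _; rewrite ImM.
- exact: (integrable_scale _ (integrable_Im gc)).
- exact: (integrable_scale _ (integrable_Re gc)).
Qed.

Lemma cint_split a m b g : a <= m <= b -> cont_on a b g ->
  cint a b g = cint a m g + cint m b g.
Proof.
move=> /andP[am mb] gc; rewrite /cint; simpc.
have splitR (u : R -> R) : mu.-integrable `[a, b] (EFin \o u) ->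
    (\int[mu]_(x in `[a, b]) u x = \int[mu]_(x in `[a, m]) u x +
     \int[mu]_(x in `[m, b]) u x)%R.
  move=> iu; apply/eqP; rewrite addrC -subr_eq; apply/eqP.
  rewrite Rintegral_itvB//.
  rewrite Rintegral_itv_obnd_cbnd//.
  apply: (integrableS _ _ _ iu) => //.
  by apply: subset_itv; rewrite ?bnd_simp.
congr Complex; apply: splitR; [exact: integrable_Re|exact: integrable_Im].
Qed.

Lemma mu_itv a b : a <= b -> fine (mu `[a, b]) = b - a.
Proof.
move=> ab; rewrite lebesgue_measure_itv /= lte_fin.
by case: ltP => //= ba; lra.
Qed.

Lemma cint_cst a b k : a <= b -> cint a b (fun=> k) = k * ((b - a)%:C)%C.
Proof.
by move=> ab; rewrite /cint !Rintegral_cst// mu_itv//; case: k => *; simpc.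
Qed.

(** The constant 2 comes from bounding real and imaginary parts separately,
    instead of rotating the integral onto the real axis. *)
Lemma modulus_cint_le_int a b g : cont_on a b g ->
  ((modulus (cint a b g))%:E <=
    2%:E * \int[mu]_(x in `[a, b]) (modulus (g x))%:E)%E.
Proof.
move=> gc.
have ig := integrable_modulus gc.
have gfin : (\int[mu]_(x in `[a, b]) (modulus (g x))%:E)%E \is a fin_num.
  exact: integrable_fin_num.
rewrite -[X in (_ <= _ * X)%E]fineK// -EFinM lee_fin.
apply: (le_trans (modulus_le _)); rewrite mulrDl mul1r lerD//=.
  apply: (le_trans (le_normr_Rintegral _ (integrable_Re gc))) => //.
  apply: le_Rintegral => //.
    exact: (integrable_norm (integrable_Re gc)).
  by move=> x _; exact: Re_le_modulus.
apply: (le_trans (le_normr_Rintegral _ (integrable_Im gc))) => //.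
apply: le_Rintegral => //.
  exact: (integrable_norm (integrable_Im gc)).
by move=> x _; exact: Im_le_modulus.
Qed.

Lemma modulus_cint_le a b g (M : R) : a <= b -> cont_on a b g ->
  (forall x, a <= x <= b -> modulus (g x) <= M) ->
  modulus (cint a b g) <= 2 * M * (b - a).
Proof.
move=> ab gc gM; have := modulus_cint_le_int gc.
have : (\int[mu]_(x in `[a, b]) (modulus (g x))%:E <= (M * (b - a))%:E)%E.
  apply: (@le_trans _ _ (\int[mu]_(x in `[a, b]) (cst M%:E x))%E).
    apply: ge0_le_integral => //.
    - by move=> x _; rewrite lee_fin modulus_ge0.
    - exact: measurable_modulus.
  rewrite integral_cst// [X in (_ * X)%E](_ : _ = (b - a)%:E)//.
  rewrite [LHS]lebesgue_measure_itv /= lte_fin; case: ltP => //= ba.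
  by congr EFin; lra.
move=> h /le_trans; rewrite -lee_fin -mulrA EFinM; apply.
by rewrite lee_pmul2l.
Qed.

End segment_integral.

(** * Goursat's theorem on rectangles *)

Section rectangle_integral.
Context {R : realType}.
Implicit Types (a b c d m : R) (f g : C R -> C R) (k : C R).

(** The integral of [f] along the boundary of the rectangle with corners
    [a +i* c] and [b +i* d], counterclockwise, with opposite sides paired. *)
Definition rint f a b c d : C R :=
  cint a b (fun x => f (x +i* c)%C - f (x +i* d)%C) +
  'i%C * cint c d (fun y => f (b +i* y)%C - f (a +i* y)%C).

(** Continuity is required on the boundary only, since Cauchy's formula
    integrates functions that are singular inside. *)
Definition rcont f a b c d := forall x y, a <= x <= b -> c <= y <= d ->
  [\/ x = a, x = b, y = c | y = d] -> {for (x +i* y)%C, continuous f}.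

Lemma cont_onB a b (u v : R -> C R) : cont_on a b u -> cont_on a b v ->
  cont_on a b (fun x => u x - v x).
Proof. by move=> uc vc x xab; apply: continuousB; [exact: uc|exact: vc]. Qed.

Section boundary.
Variables (f : C R -> C R) (a b c d : R).
Hypotheses (ab : a <= b) (cd : c <= d) (fc : rcont f a b c d).

Lemma rcont_bottom : cont_on a b (fun x => f (x +i* c)%C).
Proof.
by move=> x xab; apply: continuous_hline; apply: fc => //; [rewrite lexx|apply: Or43].
Qed.

Lemma rcont_top : cont_on a b (fun x => f (x +i* d)%C).
Proof.
by move=> x xab; apply: continuous_hline; apply: fc => //; [rewrite lexx ?andbT|apply: Or44].
Qed.

Lemma rcont_left : cont_on c d (fun y => f (a +i* y)%C).
Proof.
by move=> x xab; apply: continuous_vline; apply: fc => //; [rewrite lexx|apply: Or41].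
Qed.

Lemma rcont_right : cont_on c d (fun y => f (b +i* y)%C).
Proof.
by move=> x xab; apply: continuous_vline; apply: fc => //; [rewrite lexx ?andbT|apply: Or42].
Qed.

End boundary.

Lemma rintD f g a b c d : a <= b -> c <= d -> rcont f a b c d -> rcont g a b c d ->
  rint (fun z => f z + g z) a b c d = rint f a b c d + rint g a b c d.
Proof.
move=> ab cd fc gc; rewrite /rint.
rewrite [X in X + _](_ : _ = cint a b (fun x => (f (x +i* c)%C - f (x +i* d)%C) +
  (g (x +i* c)%C - g (x +i* d)%C))); last first.
  by apply: eq_cint => x _; ring.
rewrite [X in _ + _ * X](_ : _ = cint c d (fun y => (f (b +i* y)%C - f (a +i* y)%C) +
  (g (b +i* y)%C - g (a +i* y)%C))); last first.
  by apply: eq_cint => x _; ring.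
have hc (u : C R -> C R) : rcont u a b c d ->
  cont_on a b (fun x => u (x +i* c)%C - u (x +i* d)%C).
  by move=> uc; apply: cont_onB; [exact: rcont_bottom uc|exact: rcont_top uc].
have vc (u : C R -> C R) : rcont u a b c d ->
  cont_on c d (fun y => u (b +i* y)%C - u (a +i* y)%C).
  by move=> uc; apply: cont_onB; [exact: rcont_right uc|exact: rcont_left uc].
rewrite (cintD (hc _ fc) (hc _ gc)) (cintD (vc _ fc) (vc _ gc)); ring.
Qed.

Lemma rintZ f k a b c d : a <= b -> c <= d -> rcont f a b c d ->
  rint (fun z => k * f z) a b c d = k * rint f a b c d.
Proof.
move=> ab cd fc; rewrite /rint.
rewrite [X in X + _](_ : _ = cint a b (fun x => k * (f (x +i* c)%C - f (x +i* d)%C)));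
  last by apply: eq_cint => x _; ring.
rewrite [X in _ + _ * X](_ : _ = cint c d (fun y => k * (f (b +i* y)%C - f (a +i* y)%C)));
  last by apply: eq_cint => x _; ring.
rewrite !cintZ; first by ring.
all: apply: cont_onB.
- exact: rcont_right fc.
- exact: rcont_left fc.
- exact: rcont_bottom fc.
- exact: rcont_top fc.
Qed.

Lemma eq_rint f g a b c d : a <= b -> c <= d ->
  (forall x y, a <= x <= b -> c <= y <= d ->
    [\/ x = a, x = b, y = c | y = d] -> f (x +i* y)%C = g (x +i* y)%C) ->
  rint f a b c d = rint g a b c d.
Proof.
move=> ab cd fg; rewrite /rint; congr (_ + _ * _); apply: eq_cint => x xab.
  rewrite !fg ?lexx ?andbT//; [exact: Or44|exact: Or43].
rewrite !fg ?lexx ?andbT//; [exact: Or41|exact: Or42].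
Qed.

Lemma rint_affine (k l : C R) a b c d : a <= b -> c <= d ->
  rint (fun z => k + l * z) a b c d = 0.
Proof.
move=> ab cd; rewrite /rint.
rewrite [X in X + _](_ : _ = cint a b (fun=> l * 'i%C * ((c - d)%:C)%C)); last first.
  apply: eq_cint => x _; rewrite -[RHS]mulrA.
  by rewrite (_ : 'i%C * _ = (x +i* c)%C - (x +i* d)%C :> C R); [ring|simpc].
rewrite [X in _ + _ * X](_ : _ = cint c d (fun=> l * ((b - a)%:C)%C)); last first.
  apply: eq_cint => x _.
  by rewrite (_ : ((b - a)%:C)%C = (b +i* x)%C - (a +i* x)%C :> C R); [ring|simpc].
rewrite !cint_cst//.
have rcB (s t : R) : ((s - t)%:C)%C = (s%:C)%C - (t%:C)%C :> C R by rewrite rmorphB.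
rewrite !rcB; ring.
Qed.

Lemma rint_le f a b c d (M : R) : a <= b -> c <= d -> rcont f a b c d ->
  (forall x y, a <= x <= b -> c <= y <= d ->
    [\/ x = a, x = b, y = c | y = d] -> modulus (f (x +i* y)%C) <= M) ->
  modulus (rint f a b c d) <= 4 * M * ((b - a) + (d - c)).
Proof.
move=> ab cd fc fM; rewrite /rint; apply: (le_trans (modulusD _ _)).
rewrite modulusM modulus_i mul1r mulrDr.
have h2 (z w : C R) : modulus z <= M -> modulus w <= M -> modulus (z - w) <= 2 * M.
  by move=> zM wM; apply: (le_trans (modulusB _ _)); lra.
apply: lerD.
  apply: (le_trans (@modulus_cint_le _ _ _ _ (2 * M) ab _ _)).
  - by apply: cont_onB; [exact: rcont_bottom fc|exact: rcont_top fc].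
  - move=> x xab; apply: h2; apply: fM; rewrite ?lexx ?andbT//;
      [exact: Or43|exact: Or44].
  - by rewrite mulrA; lra.
apply: (le_trans (@modulus_cint_le _ _ _ _ (2 * M) cd _ _)).
- by apply: cont_onB; [exact: rcont_right fc|exact: rcont_left fc].
- move=> x xab; apply: h2; apply: fM; rewrite ?lexx ?andbT//;
    [exact: Or42|exact: Or41].
- by rewrite mulrA; lra.
Qed.

Lemma rint_splitx f a m b c d : a <= m <= b -> c <= d ->
  rcont f a m c d -> rcont f m b c d ->
  rint f a b c d = rint f a m c d + rint f m b c d.
Proof.
move=> /andP[am mb] cd fl fr; rewrite /rint.
have gc : cont_on a b (fun x => f (x +i* c)%C - f (x +i* d)%C).
  move=> x /andP[ax xb]; have [xm|/ltW mx] := leP x m.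
    by apply: (cont_onB (rcont_bottom cd fl) (rcont_top cd fl)); rewrite ax.
  by apply: (cont_onB (rcont_bottom cd fr) (rcont_top cd fr)); rewrite mx.
rewrite (@cint_split _ a m b _ _ gc) ?am//.
rewrite (_ : cint c d (fun y => f (b +i* y)%C - f (a +i* y)%C) =
  cint c d (fun y => (f (m +i* y)%C - f (a +i* y)%C) + (f (b +i* y)%C - f (m +i* y)%C)));
  last by apply: eq_cint => y _; ring.
have cl := cont_onB (rcont_right am fl) (rcont_left am fl).
by rewrite (cintD cl (cont_onB (rcont_right mb fr) (rcont_left mb fr))); ring.
Qed.

Lemma rint_splity f a b c m d : a <= b -> c <= m <= d ->
  rcont f a b c m -> rcont f a b m d ->
  rint f a b c d = rint f a b c m + rint f a b m d.
Proof.
move=> ab /andP[cm md] fl fr; rewrite /rint.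
have gc : cont_on c d (fun y => f (b +i* y)%C - f (a +i* y)%C).
  move=> y /andP[cy yd]; have [ym|/ltW my] := leP y m.
    by apply: (cont_onB (rcont_right ab fl) (rcont_left ab fl)); rewrite cy.
  by apply: (cont_onB (rcont_right ab fr) (rcont_left ab fr)); rewrite my.
rewrite (@cint_split _ c m d _ _ gc) ?cm//.
rewrite (_ : cint a b (fun x => f (x +i* c)%C - f (x +i* d)%C) =
  cint a b (fun x => (f (x +i* c)%C - f (x +i* m)%C) + (f (x +i* m)%C - f (x +i* d)%C)));
  last by apply: eq_cint => y _; ring.
have cl := cont_onB (rcont_bottom cm fl) (rcont_top cm fl).
by rewrite (cintD cl (cont_onB (rcont_bottom md fr) (rcont_top md fr))); ring.
Qed.

(** Compactness in the form of nested rectangles: the coordinates of the lower left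
    corners of the chosen quarters form bounded monotone sequences. The predicate [B n x y]
    is about the rectangle of size [(lx / 2 ^+ n, ly / 2 ^+ n)] at [(x, y)]. *)
Lemma quartering (B : nat -> R -> R -> Prop) (x0 y0 lx ly : R) :
  0 <= lx -> 0 <= ly -> B 0 x0 y0 ->
  (forall n x y, B n x y -> exists x' y', [/\ B n.+1 x' y',
     x <= x' <= x + lx / 2 ^+ n - lx / 2 ^+ n.+1 &
     y <= y' <= y + ly / 2 ^+ n - ly / 2 ^+ n.+1]) ->
  exists p q, forall n, exists x y, [/\ B n x y,
    x <= p <= x + lx / 2 ^+ n & y <= q <= y + ly / 2 ^+ n].
Proof.
move=> lx0 ly0 B0 Bstep.
pose st := {u : nat * (R * R) | B u.1 u.2.1 u.2.2}.
pose good (s t : st) := [/\ (sval t).1 = (sval s).1.+1,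
  (sval s).2.1 <= (sval t).2.1 <= (sval s).2.1 + lx / 2 ^+ (sval s).1 - lx / 2 ^+ (sval s).1.+1 &
  (sval s).2.2 <= (sval t).2.2 <= (sval s).2.2 + ly / 2 ^+ (sval s).1 - ly / 2 ^+ (sval s).1.+1].
have [F FP] : {F : st -> st & forall s, good s (F s)}.
  apply: boolp.choice => -[[n [x y]] /= Bs].
  have [x' [y' [B' xx' yy']]] := Bstep _ _ _ Bs.
  by exists (exist _ (n.+1, (x', y')) B').
pose s n := iter n F (exist _ (0%N, (x0, y0)) B0 : st).
have s1 n : (sval (s n)).1 = n.
  by elim: n => // n IH; have [+ _ _] := FP (s n); rewrite /= -/(s n) => ->; rewrite IH.
have limit (l : R) (pr : R * R -> R) : 0 <= l ->
    (forall n, pr (sval (s n)).2 <= pr (sval (s n.+1)).2 <=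
      pr (sval (s n)).2 + l / 2 ^+ n - l / 2 ^+ n.+1) ->
    exists p, forall n, pr (sval (s n)).2 <= p <= pr (sval (s n)).2 + l / 2 ^+ n.
  move=> l0 H; pose u n := pr (sval (s n)).2.
  have umono (m n : nat) : u n <= u (n + m)%N <= u n + l / 2 ^+ n - l / 2 ^+ (n + m).
    elim: m => [|m IH]; first by rewrite addn0; lra.
    by rewrite addnS; have := H (n + m)%N; rewrite -!/(u _); lra.
  have pow0 n : 0 <= l / 2 ^+ n by rewrite divr_ge0 // exprn_ge0.
  have ub (n m : nat) : u m <= u n + l / 2 ^+ n.
    have [mn|/ltnW nm] := leqP m n.
      by have := umono (n - m)%N m; rewrite subnKC//; have := pow0 n; lra.
    by have := umono (m - n)%N n; rewrite subnKC//; have := pow0 m; lra.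
  exists (sup (range u)) => n; apply/andP; split.
    apply: ub_le_sup; last by exists n.
    by exists (u 0%N + l / 2 ^+ 0) => _ [m _ <-]; exact: ub.
  apply: ge_sup; first by exists (u 0%N); exists 0%N.
  by move=> _ [m _ <-]; exact: ub.
have [p pP] := limit lx fst lx0 (fun n => ltac:(by have [_ + _] := FP (s n); rewrite s1)).
have [q qP] := limit ly snd ly0 (fun n => ltac:(by have [_ _ +] := FP (s n); rewrite s1)).
exists p, q => n; exists (sval (s n)).2.1, (sval (s n)).2.2; split.
- by have := svalP (s n); rewrite /= s1.
- exact: pP.
- exact: qP.
Qed.

Definition rhol f a b c d := forall x y, a <= x <= b -> c <= y <= d ->
  derivable f (x +i* y)%C 1.

Lemma rhol_sub f a b c d a' b' c' d' : a <= a' -> b' <= b -> c <= c' -> d' <= d ->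
  rhol f a b c d -> rhol f a' b' c' d'.
Proof.
by move=> ? ? ? ? fh x y /andP[? ?] /andP[? ?]; apply: fh; apply/andP; split; lra.
Qed.

Lemma rhol_cont f a b c d : rhol f a b c d -> rcont f a b c d.
Proof. by move=> fh x y xab ycd _; apply: derivable_cont; exact: fh. Qed.

Lemma rint_quarter f (x y w h : R) : 0 <= w -> 0 <= h ->
  rhol f x (x + w + w) y (y + h + h) ->
  rint f x (x + w + w) y (y + h + h) =
  (rint f x (x + w) y (y + h) + rint f x (x + w) (y + h) (y + h + h)) +
  (rint f (x + w) (x + w + w) y (y + h) +
   rint f (x + w) (x + w + w) (y + h) (y + h + h)).
Proof.
move=> w0 h0 fh.
have hol x1 x2 y1 y2 : x <= x1 -> x2 <= x + w + w -> y <= y1 -> y2 <= y + h + h ->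
    rcont f x1 x2 y1 y2.
  by move=> ? ? ? ?; apply: rhol_cont; apply: rhol_sub fh.
have xw : x <= x + w by rewrite lerDl.
have xww : x + w <= x + w + w by rewrite lerDl.
have yh : y <= y + h by rewrite lerDl.
have yhh : y + h <= y + h + h by rewrite lerDl.
have xm : x <= x + w <= x + w + w by rewrite xw.
have ym : y <= y + h <= y + h + h by rewrite yh.
have yy : y <= y + h + h by exact: le_trans yhh.
have xx : x <= x + w + w by exact: le_trans xww.
rewrite (rint_splitx xm yy (hol _ _ _ _ _ _ _ _) (hol _ _ _ _ _ _ _ _))//.
by congr (_ + _); rewrite (rint_splity _ ym (hol _ _ _ _ _ _ _ _) (hol _ _ _ _ _ _ _ _)).
Qed.

(** If the integral were not 0, quartering would produce rectangles shrinking to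
    a point along which it exceeds a multiple of the squared size; at that point
    [f] agrees with an affine function, whose integral is 0, up to an error that
    is small compared with the size, so the integral is small compared with the
    squared size. *)
Lemma goursat f a b c d : a <= b -> c <= d -> rhol f a b c d ->
  rint f a b c d = 0.
Proof.
move=> ab cd fh; apply/eqP; rewrite -modulus_eq0 eq_le modulus_ge0 andbT.
set P := (b - a) + (d - c).
have P0 : 0 <= P by rewrite /P; lra.
suff H e : 0 < e -> modulus (rint f a b c d) <= e * P ^+ 2.
  rewrite leNgt; apply/negP => I0.
  have := H (modulus (rint f a b c d) / 2 / (P ^+ 2 + 1)).
  have P20 := sqr_ge0 P.
  rewrite !divr_gt0 ?ltr_wpDl// => /(_ isT).
  rewrite leNgt => /negP; apply.
  by rewrite mulrAC ltr_pdivrMr ?ltr_wpDl//; nra.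
move=> e0; rewrite leNgt; apply/negP => Ibig.
pose w n : R := (b - a) / 2 ^+ n; pose h n : R := (d - c) / 2 ^+ n.
have w0 n : 0 <= w n by rewrite divr_ge0 ?exprn_ge0// subr_ge0.
have h0 n : 0 <= h n by rewrite divr_ge0 ?exprn_ge0// subr_ge0.
have wS n : w n = w n.+1 + w n.+1 by rewrite /w exprS; field; rewrite expf_eq0 /= pnatr_eq0 andbF.
have hS n : h n = h n.+1 + h n.+1 by rewrite /h exprS; field; rewrite expf_eq0 /= pnatr_eq0 andbF.
pose B n x y := [/\ a <= x, x + w n <= b, c <= y, y + h n <= d &
  e * (w n + h n) ^+ 2 < modulus (rint f x (x + w n) y (y + h n))].
(* the lower bound survives quartering: the squared size is divided by 4, and the
   largest of the four integrals is at least a quarter of the whole one *)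
have [|||n x y [ax xb cy yd Bn]|p [q pqP]] := @quartering B a c (b - a) (d - c).
- by rewrite subr_ge0.
- by rewrite subr_ge0.
- have [wa hc] : a + w 0%N = b /\ c + h 0%N = d.
    by rewrite /w /h expr0 !divr1; split; ring.
  rewrite /B wa hc !lexx; split => //.
  by rewrite (_ : w 0%N + h 0%N = P) // /P /w /h expr0 !divr1.
- rewrite -/(w n) -/(h n) -/(w n.+1) -/(h n.+1).
  have w0' := w0 n.+1; have h0' := h0 n.+1.
  have wE := wS n; have hE := hS n.
  have split4 : rint f x (x + w n) y (y + h n) =
     (rint f x (x + w n.+1) y (y + h n.+1) +
      rint f x (x + w n.+1) (y + h n.+1) (y + h n.+1 + h n.+1)) +
     (rint f (x + w n.+1) (x + w n.+1 + w n.+1) y (y + h n.+1) +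
      rint f (x + w n.+1) (x + w n.+1 + w n.+1) (y + h n.+1) (y + h n.+1 + h n.+1)).
    rewrite wE hE (addrA x) (addrA y); apply: rint_quarter => //; apply: rhol_sub fh => //.
      by rewrite -addrA -wE.
    by rewrite -addrA -hE.
  have : exists x' y', [/\ x' = x \/ x' = x + w n.+1, y' = y \/ y' = y + h n.+1 &
     e * (w n.+1 + h n.+1) ^+ 2 < modulus (rint f x' (x' + w n.+1) y' (y' + h n.+1))].
    apply: contrapT => /forallNP Hno; move: Bn; apply/negP; rewrite -leNgt.
    have no x' y' : x' = x \/ x' = x + w n.+1 -> y' = y \/ y' = y + h n.+1 ->
       modulus (rint f x' (x' + w n.+1) y' (y' + h n.+1)) <= e * (w n.+1 + h n.+1) ^+ 2.
      move=> xx yy; rewrite leNgt; apply/negP => big.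
      by have /forallNP/(_ y') := Hno x'; apply.
    rewrite split4; apply: (le_trans (modulusD _ _)).
    apply: (le_trans (lerD (modulusD _ _) (modulusD _ _))).
    have n1 := no x y (or_introl erefl) (or_introl erefl).
    have n2 := no x _ (or_introl erefl) (or_intror erefl).
    have n3 := no _ y (or_intror erefl) (or_introl erefl).
    have n4 := no _ _ (or_intror erefl) (or_intror erefl).
    apply: (le_trans (lerD (lerD n1 n2) (lerD n3 n4))).
    by rewrite wE hE le_eqVlt; apply/orP; left; apply/eqP; ring.
  move=> [x' [y' [xx yy big]]]; exists x', y'; split.
  + have [ax' xb'] : a <= x' /\ x' + w n.+1 <= b.
      by move: wE w0' ax xb xx; clear; move=> ? ? ? ? [] ->; split; lra.
    have [cy' yd'] : c <= y' /\ y' + h n.+1 <= d.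
      by move: hE h0' cy yd yy; clear; move=> ? ? ? ? [] ->; split; lra.
    by split.
  + by move: wE w0' xx; clear; move=> ? ? [] ->; lra.
  + by move: hE h0' yy; clear; move=> ? ? [] ->; lra.
have pab : a <= p <= b.
  by have [x [y [[]]]] := pqP 0%N; rewrite /w /h !expr0 !divr1; lra.
have qcd : c <= q <= d.
  by have [x [y [[]]]] := pqP 0%N; rewrite /w /h !expr0 !divr1; lra.
have /derivable_modulusP[l fl] := fh _ _ pab qcd.
have e40 : 0 < e / 4 by rewrite divr_gt0.
have [dl dl0 dlP] := fl _ e40.
have [n nP] : exists n, w n + h n < dl.
  have [n] : exists n : nat, P / dl < 2 ^+ n.
    have [n] : exists n, P / dl < n%:R.
      exists (Num.bound (P / dl)); apply: le_lt_trans (archi_boundP _).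
        exact: lexx.
      by rewrite divr_ge0// ltW.
    move=> Pn; exists n; apply: (lt_trans Pn).
    by rewrite -natrX ltr_nat ltn_expl.
  move=> Pn; exists n; rewrite /w /h -mulrDl -/P.
  by rewrite ltr_pdivrMr ?exprn_gt0// mulrC -ltr_pdivrMr.
have [x [y [[ax xb cy yd big] px qy]]] := pqP n.
rewrite -!/(w n) -!/(h n) in px qy.
move: big; apply/negP; rewrite -leNgt.
pose z0 : C R := (p +i* q)%C.
have wn := w0 n; have hn := h0 n.
have xw : x <= x + w n by rewrite lerDl.
have yh : y <= y + h n by rewrite lerDl.
have fc : rcont f x (x + w n) y (y + h n).
  by apply: rhol_cont; apply: rhol_sub fh.
have ac (k m : C R) : rcont (fun z : C R => k + m * z) x (x + w n) y (y + h n).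
  move=> ? ? _ _ _; apply: continuousD; first exact: cst_continuous.
  by apply: continuousM; [exact: cst_continuous|exact: cvg_id].
have -> : rint f x (x + w n) y (y + h n) =
   rint (fun z => f z + ((l * z0 - f z0) + (- l) * z)) x (x + w n) y (y + h n).
  by rewrite (rintD xw yh fc (ac _ _)) rint_affine// addr0.
apply: (le_trans (@rint_le _ _ _ _ _ (e / 4 * (w n + h n)) xw yh _ _)).
- by move=> s t sx ty bd; apply: cont_add; [exact: fc|exact: ac bd].
- move=> s t /andP[s1 s2] /andP[t1 t2] _.
  have dz : modulus ((s +i* t)%C - z0) <= w n + h n.
    rewrite /z0; simpc; apply: (le_trans (modulus_le _)) => /=.
    move: s1 s2 t1 t2 px qy; clear; move=> ? ? ? ? ? ?.
    by apply: lerD; rewrite ler_norml; lra.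
  have := dlP ((s +i* t)%C - z0) (le_lt_trans dz nP).
  rewrite [_ *: 1 + _](_ : _ = (s +i* t)%C :> C R); last first.
    by rewrite /GRing.scale /= mulr1 subrK.
  set F := (X in modulus X <= _); set G := (X in _ -> modulus X <= _).
  have -> : F = G by rewrite /F /G; ring.
  by move=> /le_trans; apply; rewrite ler_wpM2l// ltW.
- by rewrite le_eqVlt; apply/orP; left; apply/eqP; field.
Qed.

End rectangle_integral.

(** * Cauchy's formula and Taylor's formula *)

Section cauchy.
Context {R : realType}.
Implicit Types (a b c d : R) (f : C R -> C R) (p h z : C R).

(** Both rectangles enclose the only possible singularity, and the region between
    them is cut into four rectangles on which the integral is 0. *)
Lemma rint_center f (x0 y0 a b c d a' b' c' d' : R) :
  a <= a' < x0 -> x0 < b' <= b -> c <= c' < y0 -> y0 < d' <= d ->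
  (forall x y, a <= x <= b -> c <= y <= d -> x != x0 \/ y != y0 ->
    derivable f (x +i* y)%C 1) ->
  rint f a b c d = rint f a' b' c' d'.
Proof.
move=> /andP[aa' a'x] /andP[xb' b'b] /andP[cc' c'y] /andP[yd' d'd] fh.
have gx A B : a <= A -> A <= B -> B <= b -> B < x0 \/ x0 < A ->
    rint f A B c d = 0 /\ rcont f A B c d.
  move=> aA AB Bb out.
  have hol : rhol f A B c d.
    move=> x y /andP[? ?] /andP[? ?]; apply: fh; [lra..|left].
    by apply/eqP => xx; case: out; lra.
  by split; [apply: goursat => //; lra|exact: rhol_cont].
have gy A B D E : a <= A -> A <= B -> B <= b -> c <= D -> D <= E -> E <= d ->
    E < y0 \/ y0 < D -> rint f A B D E = 0 /\ rcont f A B D E.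
  move=> aA AB Bb cD DE Ed out.
  have hol : rhol f A B D E.
    move=> x y /andP[? ?] /andP[? ?]; apply: fh; [lra..|right].
    by apply/eqP => xx; case: out; lra.
  by split; [apply: goursat => //; lra|exact: rhol_cont].
have gi A B D E : a <= A -> A < x0 -> x0 < B -> B <= b -> c <= D -> D < y0 ->
    y0 < E -> E <= d -> rcont f A B D E.
  move=> ? ? ? ? ? ? ? ? x y /andP[? ?] /andP[? ?] bd.
  apply: derivable_cont; apply: fh; [lra|lra|].
  by case: bd => ->; [left|left|right|right]; apply/eqP => ?; lra.
have [l0 lc] : rint f a a' c d = 0 /\ rcont f a a' c d.
  by apply: gx; [lra..|left; lra].
have [r0 rc] : rint f b' b c d = 0 /\ rcont f b' b c d.
  by apply: gx; [lra..|right; lra].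
have [d0 dc] : rint f a' b' c c' = 0 /\ rcont f a' b' c c'.
  by apply: gy; [lra..|left; lra].
have [u0 uc] : rint f a' b' d' d = 0 /\ rcont f a' b' d' d.
  by apply: gy; [lra..|right; lra].
rewrite (@rint_splitx _ _ _ a')//; [|lra..|apply: gi; lra].
rewrite l0 add0r (@rint_splitx _ _ _ b')//; [|lra..|apply: gi; lra].
rewrite r0 addr0 (@rint_splity _ _ _ _ _ c')//; [|lra..|apply: gi; lra].
rewrite d0 add0r (@rint_splity _ _ _ _ _ d')//; [|lra..|apply: gi; lra].
by rewrite u0 addr0.
Qed.

Lemma derivable_inv_sub p z : z != p -> derivable (fun z : C R => (z - p)^-1) z 1.
Proof.
move=> zp; apply: derivableV; first by rewrite subr_eq0.
by apply: derivableB; [exact: derivable_id|exact: derivable_cst].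
Qed.

Lemma cont_exp k z : {for z, continuous (fun t : C R => t ^+ k)}.
Proof.
elim: k => [|k IH]; first exact: (@cst_continuous _ _ (1 : C R)).
have -> : (fun t : C R => t ^+ k.+1) = (fun t => t * t ^+ k).
  by apply/funext => t; rewrite exprS.
by apply: cont_mul IH; exact: cvg_id.
Qed.

Lemma neq_complex (x y : R) p : x != Cre p \/ y != Cim p -> (x +i* y)%C != p.
Proof.
by case: p => u v /= xy; rewrite eq_complex /= negb_and; apply/orP.
Qed.

(** The integral of [dz / z] around a square, in the role of [2 * pi * 'i] in
    Cauchy's formula; the estimates below rest on a lower bound of its modulus. *)
Definition kappa : C R := rint (fun z : C R => z^-1) (-1) 1 (-1) 1.

Lemma complex_inv (x y : R) : ((x +i* y)%C)^-1 =
  ((x / (x ^+ 2 + y ^+ 2)) +i* (- (y / (x ^+ 2 + y ^+ 2))))%C :> C R.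
Proof. by []. Qed.

Lemma modulus_kappa : 4 <= modulus kappa.
Proof.
have pos (x : R) : 0 < x ^+ 2 + 1 by rewrite ltr_wpDl ?sqr_ge0.
have h0 (x : R) : x ^+ 2 + 1 != 0 by rewrite gt_eqF.
have kE : kappa = cint (-1) 1 (fun x : R => (0 +i* (2 / (x ^+ 2 + 1)))%C) +
  'i%C * cint (-1) 1 (fun x : R => ((2 / (x ^+ 2 + 1))%:C)%C).
  rewrite /kappa /rint; congr (_ + _ * _); apply: eq_cint => x _.
    rewrite !complex_inv; simpc; congr Complex; rewrite sqrrN expr1n ?subrr//.
    by field.
  rewrite !complex_inv; simpc; congr Complex; rewrite sqrrN expr1n ?subrr// (addrC 1).
    by field.
  by ring.
have ci : (lebesgue_measure.-integrable `[(-1 : R), 1] (EFin \o (fun x : R => 2 / (x ^+ 2 + 1)))).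
  apply: cont_integrable => x _; apply: continuousM; first exact: cst_continuous.
  apply: continuousV => //=; apply: continuousD; last exact: cst_continuous.
  exact: exprn_continuous.
have bd : 2 <= \int[lebesgue_measure]_(x in `[(-1 : R), 1]) (2 / (x ^+ 2 + 1)).
  rewrite [leLHS](_ : _ = \int[lebesgue_measure]_(x in `[(-1 : R), 1]) (cst 1 x)); last first.
    by rewrite Rintegral_cst// mu_itv; lra.
  apply: le_Rintegral => //.
    by apply: cont_integrable => x _; exact: cst_continuous.
  move=> x /=; rewrite in_itv /= => /andP[x1 x2].
  rewrite ler_pdivlMr ?pos// mul1r.
  by nra.
apply: le_trans (Im_le_modulus _); apply: le_trans (ler_norm _).
move: bd; rewrite kE /cint; simpc; rewrite /=; clear => bd.
by apply: le_trans (lerD bd bd); lra.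
Qed.

Lemma kappa_neq0 : kappa != 0.
Proof. by rewrite -modulus_gt0 (lt_le_trans _ modulus_kappa). Qed.

Lemma rcont_inv_sub p a b c d : a < Cre p < b -> c < Cim p < d ->
  rcont (fun z => (z - p)^-1) a b c d.
Proof.
move=> pab pcd x y xab ycd bd; apply: derivable_cont; apply: derivable_inv_sub.
apply: neq_complex.
by case: bd => ->; [left|left|right|right]; apply/eqP => ?; lra.
Qed.

Lemma modulus_boundary (s x y : R) : 0 <= s ->
  [\/ x = - s, x = s, y = - s | y = s] -> s <= modulus ((x +i* y)%C : C R).
Proof.
move=> s0; have ns : `|- s| = s by rewrite normrN ger0_norm.
have ps : `|s| = s by rewrite ger0_norm.
case=> E.
- by apply: le_trans (Re_le_modulus _); rewrite /= E ns.
- by apply: le_trans (Re_le_modulus _); rewrite /= E ps.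
- by apply: le_trans (Im_le_modulus _); rewrite /= E ns.
- by apply: le_trans (Im_le_modulus _); rewrite /= E ps.
Qed.

Lemma in_square p (S : R) : modulus p < S -> - S < Cre p < S /\ - S < Cim p < S.
Proof.
move=> pS; rewrite -!ltr_norml; split.
  exact: le_lt_trans (Re_le_modulus _) pS.
exact: le_lt_trans (Im_le_modulus _) pS.
Qed.

(** [1 / (z - p)] and [1 / z] differ by [O(1 / S ^+ 2)] on a boundary of length
    [O(S)], so moving the pole changes the integral by [O(1 / S)]. *)
Lemma rint_inv_sub_large p (S : R) : modulus p < S ->
  modulus (rint (fun z => (z - p)^-1) (- S) S (- S) S -
           rint (fun z => (z - 0)^-1) (- S) S (- S) S)
    <= 16 * modulus p / (S - modulus p).
Proof.
move=> pS; have m0 := modulus_ge0 p; have S0 : 0 < S by exact: le_lt_trans pS.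
have Sp : 0 < S - modulus p by rewrite subr_gt0.
have SS : - S <= S by rewrite ge0_cp// ltW.
have [pr pi] := in_square pS.
have c1 := rcont_inv_sub pr pi.
have [zr zi] : - S < Cre (0 : C R) < S /\ - S < Cim (0 : C R) < S.
  by apply: in_square; rewrite modulus0.
have c0 := rcont_inv_sub zr zi.
have c0' : rcont (fun z : C R => -1 * (z - 0)^-1) (- S) S (- S) S.
  by move=> *; apply: cont_scale; exact: c0.
rewrite -[X in _ - X]mul1r -mulNr -(rintZ _ SS SS c0) -(rintD SS SS c1 c0').
have bound x y : - S <= x <= S -> - S <= y <= S ->
    [\/ x = - S, x = S, y = - S | y = S] ->
    modulus (((x +i* y)%C - p)^-1 + -1 * ((x +i* y)%C - 0)^-1) <=
      modulus p / ((S - modulus p) * S).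
  move=> _ _ /(modulus_boundary (ltW S0)) z1.
  set z : C R := (x +i* y)%C in z1 *.
  have z2 : S - modulus p <= modulus (z - p).
    have := ler_dist_modulus z p; rewrite ler_norml => /andP[_]; apply: le_trans.
    by rewrite lerB.
  have zn0 : z != 0 by rewrite -modulus_gt0; exact: lt_le_trans z1.
  have zp0 : z - p != 0 by rewrite -modulus_gt0; exact: lt_le_trans z2.
  have -> : (z - p)^-1 + -1 * (z - 0)^-1 = p / ((z - p) * z).
    by field; rewrite zn0 zp0.
  rewrite modulusM modulusV modulusM ler_wpM2l//.
  rewrite lef_pV2 ?posrE ?mulr_gt0 ?modulus_gt0//.
  by rewrite ler_pM// ltW.
apply: (le_trans (rint_le SS SS _ bound)).
  by move=> x y xS yS bd; apply: cont_add; [exact: c1|exact: c0'].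
rewrite le_eqVlt; apply/orP; left; apply/eqP.
by field; rewrite !gt_eqF.
Qed.

(** The integral is the same over all large squares, where it is arbitrarily
    close to that of [dz / z]. *)
Lemma rint_inv_sub p a b c d : a < Cre p < b -> c < Cim p < d ->
  rint (fun z => (z - p)^-1) a b c d = kappa.
Proof.
move=> /andP[ap pb] /andP[cp pd].
have large (S : R) : `|a| + `|b| + `|c| + `|d| + modulus p + 1 < S ->
    modulus (rint (fun z => (z - p)^-1) a b c d - kappa) <=
    16 * modulus p / (S - modulus p).
  move=> SB.
  have [aS [bS [cS [dS [pS S1]]]]] :
      - S <= a /\ b <= S /\ - S <= c /\ d <= S /\ modulus p < S /\ 1 < S.
    move: (ler_norm (- a)) (ler_norm b) (ler_norm (- c)) (ler_norm d).
    move: (normr_ge0 a) (normr_ge0 b) (normr_ge0 c) (normr_ge0 d) (modulus_ge0 p).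
    move: SB; rewrite !normrN; clear => *.
    by do 5 (split; first lra); lra.
  have [/andP[pr1 pr2] /andP[pi1 pi2]] := in_square pS.
  have pE : rint (fun z => (z - p)^-1) (- S) S (- S) S =
      rint (fun z => (z - p)^-1) a b c d.
    apply: (@rint_center _ (Cre p) (Cim p)); rewrite ?aS ?bS ?cS ?dS ?andbT//.
    by move=> x y _ _ xy; apply: derivable_inv_sub; exact: neq_complex.
  have zE : rint (fun z => (z - 0)^-1) (- S) S (- S) S = kappa.
    rewrite (@rint_center _ 0 0 (- S) S (- S) S (-1) 1 (-1) 1).
    - by apply: eq_rint => *; rewrite ?subr0//; lra.
    - by rewrite lerN2 ltrN10 (ltW S1).
    - by rewrite ltr01 (ltW S1).
    - by rewrite lerN2 ltrN10 (ltW S1).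
    - by rewrite ltr01 (ltW S1).
    - by move=> x y _ _ xy; apply: derivable_inv_sub; exact: (@neq_complex _ _ 0).
  by rewrite -pE -zE; exact: rint_inv_sub_large.
have arith (T q m g : R) : 0 <= T -> 0 <= q -> g * q = 64 * m -> 0 < g ->
    0 <= m -> 16 * m / (T + 2 + q) < g.
  move=> T0 q0 E g0 m0; rewrite ltr_pdivrMr; last lra.
  have gT : 0 <= g * T by rewrite mulr_ge0 // ltW.
  by rewrite !mulrDr E; lra.
apply/eqP; rewrite -subr_eq0 -modulus_eq0 eq_le modulus_ge0 andbT leNgt.
apply/negP; move: large; set g := modulus (_ - kappa) => large gap.
pose S := `|a| + `|b| + `|c| + `|d| + modulus p + 2 + 64 * modulus p / g.
have /large : `|a| + `|b| + `|c| + `|d| + modulus p + 1 < S.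
  rewrite /S; apply: ltr_wpDr; first by rewrite divr_ge0 ?mulr_ge0 ?modulus_ge0// ltW.
  by rewrite ltrD2l ltr1n.
have E : g * (64 * modulus p / g) = 64 * modulus p.
  by rewrite mulrC divfK ?gt_eqF.
have SE : S - modulus p = `|a| + `|b| + `|c| + `|d| + 2 + 64 * modulus p / g.
  by rewrite /S; ring.
have q0 : 0 <= 64 * modulus p / g by rewrite divr_ge0 ?mulr_ge0 ?modulus_ge0// ltW.
have T0 : 0 <= `|a| + `|b| + `|c| + `|d| by rewrite !addr_ge0.
by rewrite SE; apply/negP; rewrite -ltNge; apply: arith; rewrite // modulus_ge0.
Qed.

(** The rectangle may be shrunk to a square of half-side [r] about [p], where
    replacing [f z] by [f p] costs at most the oscillation of [f]: the boundary
    has length [O(r)] and the kernel [1 / (z - p)] is at most [1 / r]. *)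
Lemma cauchy_formula f p a b c d : a < Cre p < b -> c < Cim p < d ->
  rhol f a b c d ->
  rint (fun z => f z * (z - p)^-1) a b c d = kappa * f p.
Proof.
move=> /andP[ap pb] /andP[cp pd] fh.
apply/eqP; rewrite -subr_eq0 -modulus_eq0 eq_le modulus_ge0 andbT.
have hol x y : a <= x <= b -> c <= y <= d -> x != Cre p \/ y != Cim p ->
    derivable (fun z => f z * (z - p)^-1) (x +i* y)%C 1.
  move=> xab ycd xy; apply: derivableM; first exact: fh.
  by apply: derivable_inv_sub; exact: neq_complex.
have pE : p = (Cre p +i* Cim p)%C by case: p {ap pb cp pd hol}.
suff small (e : R) : 0 < e ->
    modulus (rint (fun z => f z * (z - p)^-1) a b c d - kappa * f p) <= e.
  rewrite leNgt; apply/negP => gap.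
  have := small _ (divr_gt0 gap (ltr0Sn R 1)); set g := modulus _ in gap *; lra.
move=> e0.
have fc : {for p, continuous f}.
  by rewrite pE; apply: derivable_cont; apply: fh; lra.
have e160 : 0 < e / 16 by lra.
have /nbhs_modulusP[d0 d0p d0P] := (continuous_modulusP _ _).1 fc _ e160.
pose r := Num.min (d0 / 3) (Num.min (Num.min (Cre p - a) (b - Cre p))
  (Num.min (Cim p - c) (d - Cim p))).
have [r0 [rd [ra [rb [rc rdd]]]]] : 0 < r /\ r <= d0 / 3 /\ r <= Cre p - a /\
   r <= b - Cre p /\ r <= Cim p - c /\ r <= d - Cim p.
  rewrite /r !lt_min !ge_min !lexx /= !orbT; repeat split => //.
  apply/andP; split; first lra.
  by apply/andP; split; apply/andP; split; lra.
have in1 : Cre p - r < Cre p < Cre p + r by lra.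
have in2 : Cim p - r < Cim p < Cim p + r by lra.
rewrite (@rint_center _ (Cre p) (Cim p) a b c d (Cre p - r) (Cre p + r)
  (Cim p - r) (Cim p + r)) //; try lra.
have ic := rcont_inv_sub in1 in2.
have fcs : rcont f (Cre p - r) (Cre p + r) (Cim p - r) (Cim p + r).
  by apply: rhol_cont; apply: rhol_sub fh; lra.
have gc : rcont (fun z => (f z - f p) * (z - p)^-1) (Cre p - r) (Cre p + r) (Cim p - r) (Cim p + r).
  move=> x y xr yr bd; apply: cont_mul; last exact: ic.
  by apply: cont_addcst; exact: fcs.
have le1 : Cre p - r <= Cre p + r by lra.
have le2 : Cim p - r <= Cim p + r by lra.
have ic' : rcont (fun z => f p * (z - p)^-1) (Cre p - r) (Cre p + r) (Cim p - r) (Cim p + r).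
  by move=> *; apply: cont_scale; exact: ic.
have -> : rint (fun z => f z * (z - p)^-1) (Cre p - r) (Cre p + r) (Cim p - r) (Cim p + r) =
   rint (fun z => (f z - f p) * (z - p)^-1 + f p * (z - p)^-1)
      (Cre p - r) (Cre p + r) (Cim p - r) (Cim p + r).
  by apply: eq_rint => // *; ring.
rewrite (rintD le1 le2 gc ic') (rintZ _ le1 le2 ic) rint_inv_sub// (mulrC (f p)) addrK.
apply: (le_trans (@rint_le _ _ _ _ _ _ (e / 16 / r) le1 le2 gc _)).
  move=> x y xr yr bd; rewrite modulusM modulusV.
  have zE : (x +i* y)%C - p = ((x - Cre p) +i* (y - Cim p))%C by rewrite [in LHS]pE; simpc.
  have bd' : [\/ x - Cre p = - r, x - Cre p = r, y - Cim p = - r | y - Cim p = r].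
    case: bd => ->; [apply: Or41|apply: Or42|apply: Or43|apply: Or44]; ring.
  have zr : r <= modulus ((x +i* y)%C - p).
    by rewrite zE; apply: modulus_boundary bd'; exact: ltW.
  apply: ler_pM; rewrite ?invr_ge0 ?modulus_ge0//; last first.
    by rewrite lef_pV2 ?posrE//; exact: lt_le_trans zr.
  apply: ltW; apply: d0P; rewrite zE.
  apply: (le_lt_trans (modulus_le _)) => /=; apply: (@le_lt_trans _ _ (r + r)).
    by apply: lerD; rewrite ler_norml; move: xr yr; clear => /andP[? ?] /andP[? ?]; lra.
  by move: rd r0; clear => *; lra.
rewrite le_eqVlt; apply/orP; left; apply/eqP; field; exact: lt0r_neq0.
Qed.

(** Expanding the kernel of Cauchy's formula as the geometric sum
    [1 / (z - h) = \sum_(k < N) h ^+ k / z ^+ k.+1 + (h / z) ^+ N / (z - h)]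
    leaves a remainder that is controlled by the supremum [M] of [f] alone. *)
Lemma taylor f (s M : R) : 0 < s -> rhol f (- s) s (- s) s ->
  (forall x y, - s <= x <= s -> - s <= y <= s -> modulus (f (x +i* y)%C) <= M) ->
  exists t : nat -> C R, forall N h, modulus h <= s / 2 ->
    modulus (f h - \sum_(k < N) t k * h ^+ k) <= 8 * M * (modulus h / s) ^+ N.
Proof.
move=> s0 fh fM.
pose I g := rint g (- s) s (- s) s.
exists (fun k => kappa^-1 * I (fun z => f z * (z ^- k.+1))) => N h hs.
have ss : - s <= s by lra.
have [hr hi] : `|Cre h| <= s / 2 /\ `|Cim h| <= s / 2.
  by split; [exact: le_trans (Re_le_modulus _) hs|exact: le_trans (Im_le_modulus _) hs].
move: hr hi; rewrite !ler_norml => /andP[hr1 hr2] /andP[hi1 hi2].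
have fc := rhol_cont fh.
have big x y (bd : [\/ x = - s, x = s, y = - s | y = s]) :=
  modulus_boundary (ltW s0) bd.
have zn0 x y : [\/ x = - s, x = s, y = - s | y = s] -> (x +i* y)%C != 0 :> C R.
  by move=> /big zs; rewrite -modulus_gt0; lra.
have bigh x y : [\/ x = - s, x = s, y = - s | y = s] -> s / 2 <= modulus ((x +i* y)%C - h).
  by move=> /big zs; have := ler_dist_modulus ((x +i* y)%C) h; rewrite ler_norml; lra.
have zh0 x y : [\/ x = - s, x = s, y = - s | y = s] -> (x +i* y)%C - h != 0 :> C R.
  by move=> /bigh zs; rewrite -modulus_gt0; lra.
have hR : - s < Cre h < s by move: hr1 hr2 s0; clear => *; lra.
have hI : - s < Cim h < s by move: hi1 hi2 s0; clear => *; lra.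
have ic : rcont (fun z => (z - h)^-1) (- s) s (- s) s.
  exact: rcont_inv_sub.
have pc k : rcont (fun z : C R => z ^- k) (- s) s (- s) s.
  move=> x y xs ys bd.
  apply: (@continuousV _ _ (fun z : C R => z ^+ k)); last exact: cont_exp.
  by rewrite expf_neq0// zn0.
have tc k : rcont (fun z => f z * z ^- k) (- s) s (- s) s.
  by move=> x y xs ys bd; apply: cont_mul; [exact: fc|exact: pc].
have rc k : rcont (fun z => f z * z ^- k * (z - h)^-1) (- s) s (- s) s.
  by move=> x y xs ys bd; apply: cont_mul; [exact: tc|exact: ic].
have step n : kappa * f h = \sum_(k < n) I (fun z => f z * z ^- k.+1) * h ^+ k +
    h ^+ n * I (fun z => f z * z ^- n * (z - h)^-1).
  elim: n => [|n ->].
    rewrite big_ord0 add0r expr0 mul1r -(cauchy_formula hR hI fh).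
    by apply: eq_rint => // x y _ _ _; rewrite expr0 invr1 mulr1.
  rewrite big_ord_recr /= -addrA; congr (_ + _).
  have -> : I (fun z => f z * z ^- n * (z - h)^-1) =
     I (fun z => f z * z ^- n.+1 + h * (f z * z ^- n.+1 * (z - h)^-1)).
    apply: eq_rint => // x y _ _ bd.
    have n0 := zn0 _ _ bd; have nh := zh0 _ _ bd.
    rewrite !exprS; field.
    by rewrite nh n0 expf_neq0.
  have rc' : rcont (fun z => h * (f z * z ^- n.+1 * (z - h)^-1)) (- s) s (- s) s.
    by move=> *; apply: cont_scale; exact: rc.
  by rewrite /I (rintD ss ss (tc n.+1) rc') (rintZ _ ss ss (rc n.+1)) exprSr; ring.
have kn := kappa_neq0.
have -> : f h - \sum_(k < N) kappa^-1 * I (fun z => f z * z ^- k.+1) * h ^+ k =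
    kappa^-1 * (h ^+ N * I (fun z => f z * z ^- N * (z - h)^-1)).
  have E : kappa * (\sum_(k < N) kappa^-1 * I (fun z => f z * z ^- k.+1) * h ^+ k) =
      \sum_(k < N) I (fun z => f z * z ^- k.+1) * h ^+ k.
    by rewrite mulr_sumr; apply: eq_bigr => k _; rewrite -mulrA mulVKf.
  by apply: (mulfI kn); rewrite mulrBr (step N) E mulVKf// addrC addKr.
have M0 : 0 <= M.
  by apply: le_trans (modulus_ge0 _) (fM 0 0 _ _); lra.
have sn0 : s != 0 by exact: lt0r_neq0.
have sN : s ^+ N != 0 by rewrite expf_neq0.
have IN : modulus (I (fun z => f z * z ^- N * (z - h)^-1)) <= 32 * M / s ^+ N.
  apply: (le_trans (@rint_le _ _ _ _ _ _ (M / s ^+ N * (s / 2)^-1) _ _ (rc N) _)) => //.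
    move=> x y xs ys bd; rewrite !modulusM !modulusV modulusX.
    have s20 : 0 < s / 2 by lra.
    apply: ler_pM; rewrite ?mulr_ge0 ?invr_ge0 ?exprn_ge0 ?modulus_ge0//.
      apply: ler_pM; rewrite ?invr_ge0 ?exprn_ge0 ?modulus_ge0//; first exact: fM.
      rewrite lef_pV2 ?posrE ?exprn_gt0//; last exact: lt_le_trans (big _ _ bd).
      by apply: lerXn2r; rewrite ?nnegrE ?modulus_ge0//; [lra|exact: big].
    by rewrite lef_pV2 ?posrE//; [exact: bigh|exact: lt_le_trans (bigh _ _ bd)].
  rewrite [leLHS](_ : _ = 32 * M / s ^+ N)//; field.
  by rewrite ?sN ?sn0.
rewrite modulusM modulusV modulusM modulusX.
have k4 := modulus_kappa.
rewrite [leRHS](_ : _ = 4^-1 * (modulus h ^+ N * (32 * M / s ^+ N))); last first.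
  by rewrite expr_div_n; field; rewrite ?sN ?sn0.
apply: ler_pM; rewrite ?invr_ge0 ?mulr_ge0 ?exprn_ge0 ?modulus_ge0//.
  by rewrite lef_pV2 ?posrE//; lra.
by apply: ler_wpM2l => //; rewrite exprn_ge0 ?modulus_ge0.
Qed.

End cauchy.

(** * Zeros of functions of one variable *)

Section one_variable.
Context {R : realType}.
Implicit Types (f : C R -> C R) (p h z : C R) (s r e : R).

(** The form in which connectedness is applied twice below: to a segment, and to
    the domain. *)
Lemma connected_cover (T : topologicalType) (A O V : set T) :
  connected A -> open O -> open V -> A `<=` O `|` V -> A `&` O `&` V = set0 ->
  A `&` O !=set0 -> A `<=` O.
Proof.
move=> cA oO oV AOV dis ne.
have AO : A `&` O = A.
  apply: cA => //; first by exists O.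
  exists (~` V); first by rewrite closedC.
  apply/seteqP; split => x [Ax Ox]; split => //.
    move=> Vx; have : (A `&` O `&` V) x by [].
    by rewrite dis.
  by case: (AOV _ Ax).
by rewrite -AO => x [].
Qed.

Lemma rhol_shift f p s :
  (forall h, `|Cre h| <= s -> `|Cim h| <= s -> derivable f (p + h) 1) ->
  rhol (fun z => f (p + z)) (- s) s (- s) s.
Proof.
move=> fh x y xs ys.
have fE : (fun z => f (p + z)) = (fun z => f (p + z *: (1 : C R))).
  by apply/funext => z; rewrite /GRing.scale /= mulr1.
rewrite fE; apply: derivable_line; rewrite /GRing.scale /= mulr1.
by apply: fh; rewrite /= ler_norml.
Qed.

(** Either all Taylor coefficients vanish, and the remainder bound forces [f] to
    vanish, or the first nonzero one dominates the remainder near [0]. *)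
Lemma zero_dichotomy0 f s : 0 < s -> rhol f (- s) s (- s) s ->
  (exists2 d : R, 0 < d & forall h, modulus h < d -> f h = 0) \/
  (exists2 d : R, 0 < d & forall h, h != 0 -> modulus h < d -> f h != 0).
Proof.
move=> s0 fh.
have zs : - s <= 0 <= s by rewrite oppr_le0 (ltW s0).
have fc : {for 0, continuous f}.
  by apply: derivable_cont; exact: (fh 0 0 zs zs).
have /nbhs_modulusP[d d0 dP] := (continuous_modulusP f 0).1 fc _ ltr01.
pose M := modulus (f 0) + 1.
have M0 : 0 < M by rewrite ltr_wpDl ?modulus_ge0.
have fM h : modulus h < d -> modulus (f h) <= M.
  move=> hd; have := dP h; rewrite subr0 => /(_ hd) /ltW fh1.
  rewrite /M addrC -[f h](subrK (f 0)); apply: (le_trans (modulusD _ _)).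
  by rewrite lerD2r.
pose u := Num.min s (d / 3).
have [u0 [us ud]] : 0 < u /\ u <= s /\ u <= d / 3.
  by rewrite /u lt_min !ge_min !lexx s0 orbT divr_gt0.
have fu : rhol f (- u) u (- u) u by apply: rhol_sub fh; rewrite ?lerN2.
have fuM x y : - u <= x <= u -> - u <= y <= u -> modulus (f (x +i* y)%C) <= M.
  move=> xu yu; apply: fM; apply: (le_lt_trans (modulus_le _)) => /=.
  apply: (@le_lt_trans _ _ (u + u)); first by rewrite lerD// ler_norml.
  by move: ud d0; clear => *; lra.
have [t tP] := taylor u0 fu fuM.
have [t0|] := pselect (forall k, t k = 0).
  left; exists (u / 2); first by rewrite divr_gt0.
  move=> h hu; apply/eqP; rewrite -modulus_eq0 eq_le modulus_ge0 andbT leNgt.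
  apply/negP => fh0.
  have hu2 : modulus h / u <= 2^-1.
    by rewrite ler_pdivrMr// mulrC ltW.
  have bd N : modulus (f h) <= 8 * M / 2 ^+ N.
    have := tP N h (ltW hu); rewrite big1 ?subr0; last by move=> k _; rewrite t0 mul0r.
    move=> /le_trans; apply; rewrite ler_wpM2l//; first by rewrite mulr_ge0 // ltW.
    by rewrite -exprVn lerXn2r ?nnegrE ?divr_ge0 ?modulus_ge0// ?(ltW u0)// invr_ge0.
  have [n] : exists n, 8 * M / modulus (f h) < n%:R.
    exists (Num.bound (8 * M / modulus (f h))); apply: le_lt_trans (archi_boundP _) => //.
    by rewrite divr_ge0 ?modulus_ge0// mulr_ge0 // ltW.
  rewrite ltr_pdivrMr// => nP; have := bd n; rewrite leNgt => /negP; apply.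
  rewrite ltr_pdivrMr ?exprn_gt0//; apply: (lt_trans nP).
  by rewrite mulrC ltr_pM2l// -natrX ltr_nat ltn_expl.
move=> /existsNP [k0 /eqP tk0].
have [k tk kmin] := ex_minnP (ex_intro (fun k => t k != 0) k0 tk0).
right; pose B := 8 * M / u ^+ k.+1.
have B0 : 0 < B by rewrite /B divr_gt0 ?exprn_gt0// mulr_gt0.
exists (Num.min (u / 2) (modulus (t k) / B)).
  by rewrite lt_min divr_gt0//= divr_gt0// modulus_gt0.
move=> h h0; rewrite lt_min => /andP[hu]; rewrite ltr_pdivlMr// => hB.
have := tP k.+1 h (ltW hu).
rewrite big_ord_recr /= big1; last first.
  move=> i _; have [->|ti] := eqVneq (t i) 0; first by rewrite mul0r.
  by have := kmin _ ti; rewrite leqNgt ltn_ord.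
rewrite add0r => bd; apply/eqP => fh0; move: bd; apply/negP; rewrite -ltNge.
rewrite fh0 sub0r modulusN modulusM modulusX expr_div_n mulrA mulrAC -/B exprS mulrA.
by rewrite ltr_pM2r ?exprn_gt0 ?modulus_gt0// mulrC.
Qed.

Definition locally_zero f p := exists2 d : R, 0 < d &
  forall z, modulus (z - p) < d -> f z = 0.

Definition zero_isolated f p := exists2 d : R, 0 < d &
  forall z, z != p -> modulus (z - p) < d -> f z != 0.

Lemma zero_dichotomy f p s : 0 < s ->
  (forall h, `|Cre h| <= s -> `|Cim h| <= s -> derivable f (p + h) 1) ->
  locally_zero f p \/ zero_isolated f p.
Proof.
move=> s0 /rhol_shift fh; have [[d d0 dP]|[d d0 dP]] := zero_dichotomy0 s0 fh.
  by left; exists d => // z zp; have := dP _ zp; rewrite /= (addrC p) subrK.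
right; exists d => // z zp zd; have := dP (z - p); rewrite /= (addrC p) subrK.
by apply=> //; rewrite subr_eq0.
Qed.

Definition csquare p r := [set z : C R | `|Cre z - Cre p| < r /\ `|Cim z - Cim p| < r].

Lemma ReB (z w : C R) : Cre (z - w : C R) = Cre z - Cre w.
Proof. by case: z w => [? ?] [? ?]. Qed.
Lemma ImB (z w : C R) : Cim (z - w : C R) = Cim z - Cim w.
Proof. by case: z w => [? ?] [? ?]. Qed.

(** Along the segment from a point near which [f] vanishes to any other point of
    the square, the points near which [f] vanishes and those near which it has no
    other zero form two disjoint open sets. *)
Lemma square_alternative f p0 r :
  (forall z, csquare p0 r z -> derivable f z 1) ->
  (forall z, csquare p0 r z -> f z = 0) \/
  (forall z, csquare p0 r z -> zero_isolated f z).
Proof.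
move=> fh.
have dich z : csquare p0 r z -> locally_zero f z \/ zero_isolated f z.
  move=> [zr zi].
  pose s := Num.min (r - `|Cre z - Cre p0|) (r - `|Cim z - Cim p0|) / 2.
  have [s0 [s1 s2]] : 0 < s /\ s < r - `|Cre z - Cre p0| /\ s < r - `|Cim z - Cim p0|.
    have m0 : 0 < Num.min (r - `|Cre z - Cre p0|) (r - `|Cim z - Cim p0|).
      by rewrite lt_min !subr_gt0 zr zi.
    have sm : s < Num.min (r - `|Cre z - Cre p0|) (r - `|Cim z - Cim p0|).
      by rewrite /s ltr_pdivrMr// ltr_pMr// ltr1n.
    by split; [rewrite divr_gt0|move: sm; rewrite lt_min => /andP].
  apply: (zero_dichotomy s0) => h hr hi; apply: fh; split.
    rewrite ReD addrAC; apply: (le_lt_trans (ler_normD _ _)).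
    by rewrite -ltrBrDl; exact: le_lt_trans hr s1.
  rewrite ImD addrAC; apply: (le_lt_trans (ler_normD _ _)).
  by rewrite -ltrBrDl; exact: le_lt_trans hi s2.
have [|/existsNP[q /not_implyP[qs qn]]] := pselect (forall z, csquare p0 r z -> zero_isolated f z).
  by right.
have [lz|//] := dich _ qs.
left=> w ws.
pose g (t : R) : C R := q + ((t%:C)%C : C R) * (w - q).
have gs t : 0 <= t <= 1 -> csquare p0 r (g t).
  move=> /andP[t0 t1].
  have conv (a b c : R) : `|a - c| < r -> `|b - c| < r -> `|a + t * (b - a) - c| < r.
    move=> ac bc.
    have -> : a + t * (b - a) - c = (1 - t) * (a - c) + t * (b - c) by ring.
    apply: (le_lt_trans (ler_normD _ _)); rewrite !normrM.
    rewrite (ger0_norm t0) (@ger0_norm _ (1 - t)) ?subr_ge0//.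
    move: ac bc; move: `|a - c| `|b - c| => u v ur vr.
    have [t00|tp] := eqVneq t 0; first by rewrite t00 subr0 mul1r mul0r addr0.
    have h1 : 0 < t * (r - v) by rewrite mulr_gt0 ?subr_gt0// lt_def tp.
    have h2 : 0 <= (1 - t) * (r - u) by rewrite mulr_ge0// subr_ge0// ltW.
    by move: h1 h2; rewrite !mulrBr; clear => *; lra.
  split.
    have -> : Cre (g t) = Cre q + t * (Cre w - Cre q).
      by rewrite /g; case: (q) (w) => [? ?] [? ?]; simpc.
    by apply: conv; [exact: qs.1|exact: ws.1].
  have -> : Cim (g t) = Cim q + t * (Cim w - Cim q).
    by rewrite /g; case: (q) (w) => [? ?] [? ?]; simpc.
  by apply: conv; [exact: qs.2|exact: ws.2].
have gcont : continuous (g : R -> C R).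
  move=> t; apply/continuous_modulusP => e e0.
  pose m := modulus (w - q) + 1.
  have m0 : 0 < m by rewrite ltr_wpDl ?modulus_ge0.
  near=> t'.
  have -> : g t' - g t = (((t' - t)%:C)%C : C R) * (w - q).
    by rewrite /g rmorphB; ring.
  rewrite modulusM modulus_real; apply: (@le_lt_trans _ _ (`|t' - t| * m)).
    by rewrite ler_wpM2l// lerDl.
  rewrite -ltr_pdivlMr// distrC; near: t'.
  apply: (@cvgr_dist_lt _ _ _ (nbhs t) _ id t) => //.
  by rewrite divr_gt0.
have lzopen : open [set z | locally_zero f z].
  rewrite openE => z [d d0 dP]; apply/nbhs_modulusP; exists (d / 2); first by rewrite divr_gt0.
  move=> y yz; exists (d / 2); first by rewrite divr_gt0.
  move=> x xy; apply: dP; rewrite -(subrK y x) -addrA.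
  by apply: (le_lt_trans (modulusD _ _)); rewrite [ltRHS]splitr ltrD.
have ziopen : open [set z | zero_isolated f z].
  rewrite openE => z [d d0 dP]; apply/nbhs_modulusP; exists d => // y yd.
  have [->|yz] := eqVneq y z; first by exists d.
  have yz0 : 0 < modulus (y - z) by rewrite modulus_gt0 subr_eq0.
  exists (Num.min (modulus (y - z)) (d - modulus (y - z))).
    by rewrite lt_min yz0 subr_gt0.
  move=> x xy; rewrite lt_min => /andP[x1 x2]; apply: dP.
    apply/eqP => xz; move: x1; rewrite xz modulusBC ltxx//.
  rewrite -(subrK y x) -addrA; apply: (le_lt_trans (modulusD _ _)).
  by rewrite -ltrBrDr.
have : `[0, 1]%classic `<=` g @^-1` [set z | locally_zero f z].
  apply: (@connected_cover _ _ _ (g @^-1` [set z | zero_isolated f z])).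
  - exact: segment_connected.
  - by move/continuousP : gcont; apply.
  - by move/continuousP : gcont; apply.
  - by move=> t /=; rewrite in_itv /= => /gs /dich.
  - apply/seteqP; split => // t [[_ [d d0 dP]] [d' d'0 d'P]].
    pose m := Num.min d d' / 2.
    have m0 : 0 < m by rewrite divr_gt0// lt_min d0.
    have md : m < Num.min d d' by rewrite /m ltr_pdivrMr ?ltr_pMr ?ltr1n// lt_min d0.
    move: md; rewrite lt_min => /andP[md md'].
    have E : modulus (g t + (m%:C)%C - g t) = m.
      by rewrite addrAC subrr add0r modulus_real ger0_norm// ltW.
    have := d'P (g t + (m%:C)%C); rewrite E md' => /(_ _ isT).
    rewrite dP ?E// eqxx => /(_ _)/negP; apply => //.
    by rewrite -subr_eq0 -modulus_gt0 E.
  - exists 0; split; first by rewrite /= in_itv /= lexx ler01.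
    by rewrite /g /= mul0r addr0.
move=> /(_ 1); rewrite /= in_itv /= ler01 lexx => /(_ isT)[d d0]; apply.
have E : ((1 : R)%:C)%C = 1 :> C R by [].
have -> : w - g 1 = 0 by rewrite /g E; ring.
by rewrite modulus0.
Unshelve. all: by end_near. Qed.

End one_variable.

(** * Sub-mean values and zeros in the plane *)

Section plane.
Context {R : realType}.
Implicit Types (f : C R -> C R) (p : C R).
Local Notation mu := (@lebesgue_measure R).

Definition cpt (u : plane R) : C R := (u.1 +i* u.2)%C.

Lemma exists_small_slice (h : measurableTypeR R -> \bar R) (a r c : R) :
  0 < r -> 0 <= c -> measurable_fun [set: measurableTypeR R] h ->
  (forall y, 0 <= h y)%E -> (\int[mu]_y h y < (r * c)%:E)%E ->
  exists2 y, a <= y <= a + r & (h y < c%:E)%E.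
Proof.
move=> r0 c0 mh h0 hA; pose b := a + r; apply: contrapT => /forall2NP no.
have big y : `[a, b]%classic y -> (c%:E <= h y)%E.
  move=> /= yJ; rewrite leNgt; apply/negP => hy.
  by case: (no y) => // /negP; apply; move: yJ; rewrite in_itv.
move: hA; apply/negP; rewrite -leNgt.
have mJ : measurable (`[a, b]%classic : set (measurableTypeR R)) by [].
have s1 : (\int[mu]_(y in `[a, b]) h y <= \int[mu]_y h y)%E.
  exact: ge0_subset_integral.
have s2 : (\int[mu]_(y in `[a, b]) (cst c%:E y) <= \int[mu]_(y in `[a, b]) h y)%E.
  by apply: ge0_le_integral => //; exact: measurable_funTS.
apply: le_trans (le_trans s2 s1).
rewrite integral_cst// [X in (_ * X)%E](_ : _ = r%:E)//.
  by rewrite -EFinM mulrC.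
rewrite [LHS]lebesgue_measure_itv /= lte_fin /b ltrDl r0.
by congr EFin; rewrite /= addrAC subrr add0r.
Qed.

(** The bound on [w] is the one satisfied by a difference [u' - v'] of the values
    on two opposite sides of the integrand [f / (z - p)], at distance at least
    [r] from [p]. *)
Lemma modulus_cint_cauchy (a b r : R) (u v : R -> C R) :
  0 < r -> cont_on a b u -> cont_on a b v ->
  forall (w : R -> C R), cont_on a b w ->
  (forall x, a <= x <= b -> modulus (w x) <= r^-1 * (modulus (u x) + modulus (v x))) ->
  ((modulus (cint a b w))%:E <= (2 / r)%:E *
    (\int[mu]_(x in `[a, b]) (modulus (u x))%:E +
     \int[mu]_(x in `[a, b]) (modulus (v x))%:E))%E.
Proof.
move=> r0 uc vc w wc wuv.
apply: (le_trans (modulus_cint_le_int wc)).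
rewrite EFinM -muleA lee_pmul2l//.
have ge (g : R -> C R) x : `[a, b]%classic x -> (0 <= (modulus (g x))%:E)%E.
  by move=> _; rewrite lee_fin modulus_ge0.
rewrite -ge0_integralD//; [|exact: ge|exact: measurable_modulus|exact: ge|exact: measurable_modulus].
rewrite -ge0_integralZl//; last 3 first.
- by apply: emeasurable_funD; exact: measurable_modulus.
- by move=> *; rewrite -EFinD lee_fin addr_ge0 ?modulus_ge0.
- by rewrite lee_fin invr_ge0 ltW.
apply: ge0_le_integral => //.
- by move=> *; rewrite lee_fin modulus_ge0.
- exact: measurable_modulus.
- by apply: measurable_funeM; apply: emeasurable_funD; exact: measurable_modulus.
Qed.

Lemma rint_cauchy_le f p (a b c d r : R) : 0 < r ->
  a <= Cre p - r -> Cre p + r <= b -> c <= Cim p - r -> Cim p + r <= d ->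
  rcont f a b c d ->
  ((modulus (rint (fun z => f z * (z - p)^-1) a b c d))%:E <= (2 / r)%:E *
    ((\int[mu]_(x in `[a, b]) (modulus (f (x +i* c)%C))%:E +
      \int[mu]_(x in `[a, b]) (modulus (f (x +i* d)%C))%:E) +
     (\int[mu]_(y in `[c, d]) (modulus (f (b +i* y)%C))%:E +
      \int[mu]_(y in `[c, d]) (modulus (f (a +i* y)%C))%:E)))%E.
Proof.
move=> r0 ap pb cp pd fc.
have [ap' pb' cp' pd'] : [/\ a < Cre p, Cre p < b, c < Cim p & Cim p < d].
  by move: r0 ap pb cp pd; clear => *; split; lra.
have ab : a <= b by rewrite ltW// (lt_trans ap').
have cd : c <= d by rewrite ltW// (lt_trans cp').
have ic : rcont (fun z => (z - p)^-1) a b c d.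
  by apply: rcont_inv_sub; rewrite ?ap' ?cp'.
have gc : rcont (fun z => f z * (z - p)^-1) a b c d.
  by move=> x y xab ycd bd; apply: cont_mul; [exact: fc|exact: ic].
have far x y : r <= `|x - Cre p| \/ r <= `|y - Cim p| ->
    modulus (f (x +i* y)%C * ((x +i* y)%C - p)^-1) <= r^-1 * modulus (f (x +i* y)%C).
  move=> far; rewrite modulusM modulusV mulrC ler_wpM2r ?modulus_ge0//.
  have rz : r <= modulus ((x +i* y)%C - p).
    case: far => /le_trans; apply.
      by apply: le_trans (Re_le_modulus _); rewrite ReB.
    by apply: le_trans (Im_le_modulus _); rewrite ImB.
  by rewrite lef_pV2 ?posrE//; exact: lt_le_trans rz.
have [fa fb fcc fd] : [/\ r <= `|a - Cre p|, r <= `|b - Cre p|, r <= `|c - Cim p| & r <= `|d - Cim p|].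
  by split; rewrite ler_normr; apply/orP; [right|left|right|left];
    move: r0 ap pb cp pd; clear => *; lra.
rewrite /rint; set u := cint a b _; set v := cint c d _.
have ul := modulus_cint_cauchy r0 (rcont_bottom cd fc) (rcont_top cd fc)
  (cont_onB (rcont_bottom cd gc) (rcont_top cd gc)).
have vl := modulus_cint_cauchy r0 (rcont_right ab fc) (rcont_left ab fc)
  (cont_onB (rcont_right ab gc) (rcont_left ab gc)).
have uu : ((modulus (u + 'i%C * v))%:E <= (modulus u)%:E + (modulus v)%:E)%E.
  rewrite -EFinD lee_fin; apply: (le_trans (modulusD _ _)).
  by rewrite modulusM modulus_i mul1r.
apply: (le_trans uu); rewrite ge0_muleDr; last 2 first.
- by apply: adde_ge0; apply: integral_ge0 => *; rewrite lee_fin modulus_ge0.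
- by apply: adde_ge0; apply: integral_ge0 => *; rewrite lee_fin modulus_ge0.
apply: leeD.
  apply: ul => x _; apply: (le_trans (modulusB _ _)); rewrite mulrDr; apply: lerD;
    by apply: far; right.
apply: vl => y _; apply: (le_trans (modulusB _ _)); rewrite mulrDr; apply: lerD;
  by apply: far; left.
Qed.

(** If the integral of [G >= |f|] over the square of half-side [2 * r] were too small,
    then, by Fubini's theorem, each of the four strips of width [r] along its
    sides would contain a line on which the integral of [|f|] is small, and
    Cauchy's formula over the rectangle bounded by these four lines, all at
    distance at least [r] from [p], would make [|f p|] too small.
    A majorant [G] of [|f|] appears because in several variables an iterated
    integral takes its place. *)
Lemma submean_plane f p (r : R) (G : plane R -> \bar R) : 0 < r ->
  (forall z, `|Cre z - Cre p| <= 2 * r -> `|Cim z - Cim p| <= 2 * r ->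
    derivable f z 1) ->
  measurable_fun [set: plane R] G -> (forall u, 0 <= G u)%E ->
  (forall u, `|u.1 - Cre p| <= 2 * r -> `|u.2 - Cim p| <= 2 * r ->
    ((modulus (f (cpt u)))%:E <= G u)%E) ->
  ((r ^+ 2 / 4 * modulus (f p))%:E <= \int[@lebesgue_plane R]_u G u)%E.
Proof.
move=> r0 fh mG G0 fG; rewrite leNgt; apply/negP => small.
pose c := r / 4 * modulus (f p).
have fp0 : 0 < modulus (f p).
  rewrite lt_def modulus_ge0 andbT; apply/eqP => f0; move: small.
  by rewrite f0 mulr0 ltNge => /negP; apply; apply: integral_ge0.
have c0 : 0 <= c by rewrite mulr_ge0 ?modulus_ge0// ltW// divr_gt0.
have cE : r ^+ 2 / 4 * modulus (f p) = r * c by rewrite /c; field.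
pose H1 := fubini_F mu (G : measurableTypeR R * measurableTypeR R -> \bar R).
pose H2 := fubini_G mu (G : measurableTypeR R * measurableTypeR R -> \bar R).
have mH1 : measurable_fun [set: measurableTypeR R] H1.
  exact: measurable_fun_fubini_tonelli_F.
have mH2 : measurable_fun [set: measurableTypeR R] H2.
  exact: measurable_fun_fubini_tonelli_G.
have i1 : (\int[mu]_x H1 x < (r * c)%:E)%E.
  by rewrite -cE; apply: le_lt_trans small; rewrite -fubini_tonelli1.
have i2 : (\int[mu]_y H2 y < (r * c)%:E)%E.
  by rewrite -cE; apply: le_lt_trans small; rewrite -fubini_tonelli2.
have H10 x : (0 <= H1 x)%E by apply: integral_ge0.
have H20 x : (0 <= H2 x)%E by apply: integral_ge0.
have [x1 /andP[x1l x1u] h1] := exists_small_slice (Cre p - 2 * r) r0 c0 mH1 H10 i1.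
have [x2 /andP[x2l x2u] h2] := exists_small_slice (Cre p + r) r0 c0 mH1 H10 i1.
have [y1 /andP[y1l y1u] k1] := exists_small_slice (Cim p - 2 * r) r0 c0 mH2 H20 i2.
have [y2 /andP[y2l y2u] k2] := exists_small_slice (Cim p + r) r0 c0 mH2 H20 i2.
have [e1 e2 e3 e4] : [/\ x1 <= Cre p - r, Cre p + r <= x2, y1 <= Cim p - r & Cim p + r <= y2].
  by split => //; move: x1u y1u; clear => *; lra.
have [x12 y12] : x1 <= x2 /\ y1 <= y2.
  by move: e1 e2 e3 e4 r0; clear => *; split; lra.
have fhr : rhol f x1 x2 y1 y2.
  move=> x y /andP[xl xu] /andP[yl yu]; apply: fh => /=; rewrite ler_norml;
    move: x1l x2u y1l y2u xl xu yl yu; clear => *; lra.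
have [a1 [a2 [a3 a4]]] : x1 < Cre p /\ Cre p < x2 /\ y1 < Cim p /\ Cim p < y2.
  by move: e1 e2 e3 e4 r0; clear => *; do 3 (split; first lra); lra.
have inx x : x1 <= x <= x2 -> `|x - Cre p| <= 2 * r.
  by move=> /andP[xl xu]; rewrite ler_norml; move: x1l x2u xl xu; clear => *; lra.
have iny y : y1 <= y <= y2 -> `|y - Cim p| <= 2 * r.
  by move=> /andP[xl xu]; rewrite ler_norml; move: y1l y2u xl xu; clear => *; lra.
have mG1 x : measurable_fun [set: measurableTypeR R] (fun y => G (x, y)).
  exact: measurableT_comp.
have mG2 y : measurable_fun [set: measurableTypeR R] (fun x => G (x, y)).
  exact: measurableT_comp.
have side1 x : x1 <= x <= x2 -> (H1 x < c%:E)%E ->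
    (\int[mu]_(y in `[y1, y2]) (modulus (f (x +i* y)%C))%:E <= c%:E)%E.
  move=> xx hx; apply: le_trans (ltW hx).
  have s1 : (\int[mu]_(y in `[y1, y2]) G (x, y) <= H1 x)%E.
    exact: ge0_subset_integral.
  apply: le_trans s1; apply: ge0_le_integral => //.
  - by move=> *; rewrite lee_fin modulus_ge0.
  - apply: measurable_modulus => y yy; apply: continuous_vline; apply: derivable_cont.
    by apply: fhr.
  - exact: measurable_funTS.
  - move=> y /=; rewrite in_itv /= => yy.
    by apply: fG => /=; [exact: inx|exact: iny].
have side2 y : y1 <= y <= y2 -> (H2 y < c%:E)%E ->
    (\int[mu]_(x in `[x1, x2]) (modulus (f (x +i* y)%C))%:E <= c%:E)%E.
  move=> yy hy; apply: le_trans (ltW hy).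
  have s1 : (\int[mu]_(x in `[x1, x2]) G (x, y) <= H2 y)%E.
    exact: ge0_subset_integral.
  apply: le_trans s1; apply: ge0_le_integral => //.
  - by move=> *; rewrite lee_fin modulus_ge0.
  - apply: measurable_modulus => x xx; apply: continuous_hline; apply: derivable_cont.
    by apply: fhr.
  - exact: measurable_funTS.
  - move=> x /=; rewrite in_itv /= => xx.
    by apply: fG => /=; [exact: inx|exact: iny].
have := rint_cauchy_le r0 e1 e2 e3 e4 (rhol_cont fhr).
rewrite cauchy_formula ?a1 ?a3// modulusM.
apply/negP; rewrite -ltNge.
apply: (@le_lt_trans _ _ ((2 / r)%:E * ((c%:E + c%:E) + (c%:E + c%:E)))%E).
  rewrite lee_pmul2l ?lte_fin ?divr_gt0//.
  by apply: leeD; apply: leeD; [apply: side2|apply: side2|apply: side1|apply: side1];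
    rewrite ?lexx ?x12 ?y12.
rewrite -!EFinD -EFinM lte_fin.
have -> : 2 / r * (c + c + (c + c)) = 2 * modulus (f p) by rewrite /c; field; exact: lt0r_neq0.
rewrite ltr_pM2r//; apply: lt_le_trans modulus_kappa.
by rewrite ltr_nat.
Qed.

Lemma lebesgue_plane_set1 (u : plane R) : lebesgue_plane [set u] = 0%E.
Proof.
have -> : [set u] = [set u.1] `*` [set u.2].
  by apply/seteqP; split => [? ->//|[? ?] [/= -> ->]]; case: u.
have m1 x : measurable ([set x] : set (measurableTypeR R)) by [].
have := product_measure1E mu mu (m1 u.1) (m1 u.2).
rewrite /lebesgue_plane => ->.
by rewrite [X in (X * _)%E](_ : _ = 0%E) ?mul0e//; exact: lebesgue_measure_set1.
Qed.

Lemma rat_approx (x e : R) : 0 < e -> exists q : rat, `|x - ratr q| < e.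
Proof.
move=> e0; have xx : x - e < x + e by rewrite ltrBlDr -addrA ltrDl addr_gt0.
have [q] := rat_in_itvoo xx; rewrite in_itv /= => /andP[q1 q2].
by exists q; rewrite ltr_norml; move: q1 q2; clear => *; lra.
Qed.

Lemma inv_nat_lt (e : R) : 0 < e -> exists n : nat, n.+1%:R^-1 < e.
Proof.
move=> e0; exists (Num.bound e^-1).
rewrite -[ltRHS]invrK ltf_pV2 ?posrE ?invr_gt0//.
apply: (lt_trans (archi_boundP _)); first by rewrite invr_ge0 ltW.
by rewrite ltr_nat.
Qed.

(** An isolated zero is the only one in some box with rational data, hence there
    are countably many zeros. *)
Lemma isolated_zeros_negligible f p0 (r : R) :
  (forall z, csquare p0 r z -> zero_isolated f z) ->
  (@lebesgue_plane R).-negligible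
    [set u | csquare p0 r (cpt u) /\ f (cpt u) = 0].
Proof.
move=> iso; set Z := [set u | _].
pose box (k : rat * rat * nat) : set (plane R) :=
  [set u | `|u.1 - ratr k.1.1| < k.2.+1%:R^-1 /\ `|u.2 - ratr k.1.2| < k.2.+1%:R^-1].
pose S (m : nat) : set (plane R) := [set u | if unpickle m is Some k then
  box k u /\ (forall v, Z v -> box k v -> v = u) /\ Z u else False].
have SZ : Z `<=` \bigcup_m S m.
  move=> u Zu; have [us fu] := Zu; have [d d0 dP] := iso _ us.
  have d4 : 0 < d / 4 by rewrite divr_gt0.
  have [n nd] := inv_nat_lt d4.
  have n0 : (0 : R) < n.+1%:R^-1 by rewrite invr_gt0.
  have [a ua] := rat_approx u.1 n0; have [b ub] := rat_approx u.2 n0.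
  exists (pickle (a, b, n)); first exact: I.
  rewrite /S /mkset pickleK; split; first by split.
  split=> // v [_ fv] [/= va vb]; apply/eqP; apply/negPn/negP => vu.
  have := dP (cpt v); rewrite fv eqxx => /(_ _ _)/negP; apply=> //.
    apply/eqP => vuE; move/eqP: vu; apply; move: vuE.
    by rewrite /cpt; case: (u) (v) => [? ?] [? ?] /= [-> ->].
  have -> : cpt v - cpt u = ((v.1 - u.1) +i* (v.2 - u.2))%C by rewrite /cpt; simpc.
  apply: (le_lt_trans (modulus_le _)) => /=.
  apply: (@lt_trans _ _ ((n.+1%:R^-1 + n.+1%:R^-1) + (n.+1%:R^-1 + n.+1%:R^-1))).
    apply: ltrD.
      rewrite -(subrK (ratr a) v.1) -addrA; apply: (le_lt_trans (ler_normD _ _)).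
      by rewrite ltrD// distrC.
    rewrite -(subrK (ratr b) v.2) -addrA; apply: (le_lt_trans (ler_normD _ _)).
    by rewrite ltrD// distrC.
  move: nd; move: (n.+1%:R^-1 : R) => e; clear => ed. lra.
apply: (negligibleS SZ); apply: negligible_bigcup => m; rewrite /S.
case: (unpickle m) => [k|]; last exact: negligible_set0.
have [[u0 [bu0 [un0 Zu0]]]|none] := pselect (exists u, box k u /\
    (forall v, Z v -> box k v -> v = u) /\ Z u); last first.
  rewrite (_ : [set _ | _] = set0); first exact: negligible_set0.
  by apply/seteqP; split => // u Su; apply: none; exists u.
exists [set u0]; split.
- rewrite (_ : [set u0] = [set u0.1] `*` [set u0.2]); last first.
    by apply/seteqP; split => [? ->//|[? ?] [/= -> ->]]; case: u0 {bu0 un0 Zu0}.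
  by apply: measurableX.
- exact: lebesgue_plane_set1.
- by move=> u [bu [_ Zu]]; rewrite /=; apply: un0.
Qed.

End plane.

(** * From one variable to several *)

Section polysquares.
Context {R : realType}.
Local Notation plane := (plane R).
Local Notation lebn n := (measure_tuple (@lebesgue_plane R) n).

Definition polysquare n (a : n.-tuple plane) (r : R) : set (n.-tuple plane) :=
  [set t | forall i, `|(tnth t i).1 - (tnth a i).1| < r /\
                     `|(tnth t i).2 - (tnth a i).2| < r].

Lemma tnth_consT0 n (x : plane) (t : n.-tuple plane) :
  tnth (consT (x, t)) ord0 = x.
Proof. by []. Qed.

Lemma tnth_consTS n (x : plane) (t : n.-tuple plane) i :
  tnth (consT (x, t)) (lift ord0 i) = tnth t i.
Proof. by rewrite !(tnth_nth x). Qed.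

Lemma consT_surj n (t : n.+1.-tuple plane) : exists x t', t = consT (x, t').
Proof.
by case/tupleP: t => x t; exists x, t; apply: val_inj.
Qed.

Lemma polysquare_cons n (a0 x : plane) (a t : n.-tuple plane) (r : R) :
  polysquare (consT (a0, a)) r (consT (x, t)) <->
  [/\ `|x.1 - a0.1| < r, `|x.2 - a0.2| < r & polysquare a r t].
Proof.
split=> [H|[h1 h2 H] i].
  split; [exact: (H ord0).1|exact: (H ord0).2|move=> i].
  by have := H (lift ord0 i); rewrite !tnth_consTS.
have [j ->|->] := unliftP ord0 i; first by rewrite !tnth_consTS; exact: H.
by rewrite !tnth_consT0.
Qed.

(** Holomorphy in each variable separately, stated recursively so that it
    passes to the slices that Fubini's theorem produces. *)
Fixpoint separately_holomorphic n :
    (n.-tuple plane -> C R) -> n.-tuple plane -> R -> Prop :=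
  if n is n'.+1 then fun F a r =>
    let a' : n'.-tuple plane := [tuple of behead a] in
    (forall t, polysquare a' r t -> forall z, csquare (cpt (thead a)) r z ->
      derivable (fun w : C R => F (consT ((Cre w, Cim w), t))) z 1) /\
    (forall x, csquare (cpt (thead a)) r (cpt x) ->
      separately_holomorphic (fun t => F (consT (x, t))) a' r)
  else fun _ _ _ => True.

Lemma separately_holomorphic_cons n (F : n.+1.-tuple plane -> C R) a0 a r :
  separately_holomorphic F (consT (a0, a)) r <->
    (forall t, polysquare a r t -> forall z, csquare (cpt a0) r z ->
      derivable (fun w : C R => F (consT ((Cre w, Cim w), t))) z 1) /\
    (forall x, csquare (cpt a0) r (cpt x) ->
      separately_holomorphic (fun t => F (consT (x, t))) a r).
Proof.
have aE : [tuple of behead (consT (a0, a))] = a by apply: val_inj.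
by change (separately_holomorphic F (consT (a0, a)) r) with
  ((forall t, polysquare [tuple of behead (consT (a0, a))] r t ->
      forall z, csquare (cpt a0) r z ->
      derivable (fun w : C R => F (consT ((Cre w, Cim w), t))) z 1) /\
    (forall x, csquare (cpt a0) r (cpt x) ->
      separately_holomorphic (fun t => F (consT (x, t)))
        [tuple of behead (consT (a0, a))] r)); rewrite aE.
Qed.

Lemma cpt_ReIm (z : C R) : cpt (Cre z, Cim z) = z.
Proof. by case: z. Qed.

Lemma separately_holomorphic_affine n (V : normedModType (C R)) (f : V -> C R)
    (c : V) (v : 'I_n -> V) a r :
  (forall t, polysquare a r t -> forall w,
    derivable f (c + \sum_i cpt (tnth t i) *: v i) w) ->
  separately_holomorphic (fun t => f (c + \sum_i cpt (tnth t i) *: v i)) a r.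
Proof.
elim: n c v a => [//|n IH] c v a fd.
have [a0 [a' aE]] := consT_surj a; rewrite aE in fd *.
have sumE x (t : n.-tuple plane) :
    c + \sum_i cpt (tnth (consT (x, t)) i) *: v i =
    (c + cpt x *: v ord0) + \sum_i cpt (tnth t i) *: v (lift ord0 i).
  rewrite big_ord_recl tnth_consT0 addrA; congr (_ + _).
  by apply: eq_bigr => i _; rewrite tnth_consTS.
apply/separately_holomorphic_cons; split=> [t ta z za|x xa].
  have -> : (fun w : C R => f (c + \sum_i cpt (tnth (consT ((Cre w, Cim w), t)) i) *: v i)) =
      (fun w => f ((c + \sum_i cpt (tnth t i) *: v (lift ord0 i)) + w *: v ord0)).
    by apply/funext => w; rewrite sumE cpt_ReIm addrAC.
  apply: derivable_line; rewrite addrAC -[z in X in derivable _ X _]cpt_ReIm -sumE.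
  by apply: fd; apply/polysquare_cons; split => //; [exact: za.1|exact: za.2].
have -> : (fun t => f (c + \sum_i cpt (tnth (consT (x, t)) i) *: v i)) =
    (fun t => f ((c + cpt x *: v ord0) + \sum_i cpt (tnth t i) *: v (lift ord0 i))).
  by apply/funext => t; rewrite sumE.
apply: IH => t ta w; rewrite -sumE; apply: fd; apply/polysquare_cons.
by split => //; [exact: xa.1|exact: xa.2].
Qed.

Lemma ge0_integral_cons n (G : n.+1.-tuple plane -> \bar R) :
  measurable_fun [set: n.+1.-tuple plane] G -> (forall t, 0 <= G t)%E ->
  (\int[lebn n.+1]_t G t =
   \int[@lebesgue_plane R]_x \int[lebn n]_t G (consT (x, t)))%E.
Proof.
move=> mG G0.
have mGc : measurable_fun [set: plane * n.-tuple plane] (G \o @consT _ plane n).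
  by apply: measurableT_comp => //; exact: measurable_consT.
transitivity (\int[(@lebesgue_plane R \x lebn n)%E]_u (G \o @consT _ plane n) u)%E.
  have mc : measurable_fun [set: plane * n.-tuple plane] (@consT _ plane n).
    exact: measurable_consT.
  have := @ge0_integral_pushforward _ _ _ _ R (@consT _ plane n) mc
    (@lebesgue_plane R \x lebn n)%E setT G measurableT mG (fun t _ => G0 t).
  by rewrite preimage_setT.
by rewrite fubini_tonelli1//= => x; exact: G0.
Qed.

Lemma measurable_slice n (G : n.+1.-tuple plane -> \bar R) :
  measurable_fun [set: n.+1.-tuple plane] G -> (forall t, 0 <= G t)%E ->
  measurable_fun [set: plane] (fun x => \int[lebn n]_t G (consT (x, t)))%E /\
  forall x, measurable_fun [set: n.-tuple plane] (fun t => G (consT (x, t))).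
Proof.
move=> mG G0.
have mGc : measurable_fun [set: plane * n.-tuple plane] (G \o @consT _ plane n).
  by apply: measurableT_comp => //; exact: measurable_consT.
split; last first.
  move=> x; have -> : (fun t => G (consT (x, t))) =
      (G \o @consT _ plane n) \o (fun t => (x, t)) by [].
  by apply: measurableT_comp => //; exact: pair1_measurable.
by apply: (@measurable_fun_fubini_tonelli_F _ _ _ _ _ (lebn n)
  (G \o @consT _ plane n)) => // u; exact: G0.
Qed.

(** Up to a constant, the integral of [G] over the slice at [x] bounds the value of
    [|F|] at the centre of that slice, by the inequality in the remaining
    variables; it is the majorant to which the inequality in the first variable
    applies. *)
Lemma submean n (F : n.-tuple plane -> C R) a (r : R) G : 0 < r ->
  separately_holomorphic F a (3 * r) ->
  measurable_fun [set: n.-tuple plane] G -> (forall t, 0 <= G t)%E ->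
  (forall t, polysquare a (3 * r) t -> ((modulus (F t))%:E <= G t)%E) ->
  (((r ^+ 2 / 4) ^+ n * modulus (F a))%:E <= \int[lebn n]_t G t)%E.
Proof.
move=> r0; have r30 : 0 < 3 * r by rewrite mulr_gt0.
elim: n F a G => [|n IH] F a G Fh mG G0 FG.
  rewrite expr0 mul1r /= integral_dirac// diracT mul1e.
  have -> : [tuple] = a by exact/esym/tuple0.
  by apply: FG => -[].
have [a0 [a' aE]] := consT_surj a; rewrite aE in Fh FG *.
have [Fh0 Fh1] := (separately_holomorphic_cons _ _ _ _).1 Fh.
rewrite ge0_integral_cons//; have [mH mS] := measurable_slice mG G0.
set k : R := (r ^+ 2 / 4) ^+ n.
have k0 : 0 < k by rewrite exprn_gt0// divr_gt0// exprn_gt0.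
pose f (w : C R) := F (consT ((Cre w, Cim w), a')).
have fx (x : plane) : f (cpt x) = F (consT (x, a')).
  by rewrite /f; congr (F (consT (_, _))); case: x.
have cen : polysquare a' (3 * r) a'.
  by move=> i; rewrite !subrr normr0.
pose H (x : plane) := (\int[lebn n]_t G (consT (x, t)))%E.
have := @submean_plane R f (cpt a0) r (fun x => (k^-1)%:E * H x)%E r0.
rewrite ge0_integralZl//; last first.
- by rewrite lee_fin invr_ge0 ltW.
- by move=> x _; exact: integral_ge0.
rewrite lee_pdivlMl// -EFinM fx.
have -> : (r ^+ 2 / 4) ^+ n.+1 * modulus (F (consT (a0, a'))) =
    k * (r ^+ 2 / 4 * modulus (F (consT (a0, a')))).
  by rewrite [(_ / 4) ^+ n.+1]exprSr /k; ring.
apply.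
- move=> z zr zi; apply: Fh0 => //; split.
    by apply: (le_lt_trans zr); rewrite ltr_pM2r// ltr_nat.
  by apply: (le_lt_trans zi); rewrite ltr_pM2r// ltr_nat.
- exact: measurable_funeM.
- by move=> x; apply: mule_ge0; [rewrite lee_fin invr_ge0 ltW|exact: integral_ge0].
move=> x xr xi; rewrite lee_pdivlMl// -EFinM fx.
have xs : csquare (cpt a0) (3 * r) (cpt x).
  split.
    by apply: (le_lt_trans xr); rewrite ltr_pM2r// ltr_nat.
  by apply: (le_lt_trans xi); rewrite ltr_pM2r// ltr_nat.
apply: (IH _ a' (fun t => G (consT (x, t))) (Fh1 _ xs) (mS x)) => // t ta.
by apply: FG; apply/polysquare_cons; split => //; [exact: xs.1|exact: xs.2].
Qed.

(** The slice through [b] in the first variable does not vanish identically, so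
    it is nonzero outside a null set of values [x]; for these, the induction
    hypothesis applies to the slice at [x]. The integrand [G] stands for the
    indicator function of the set of zeros. *)
Lemma zeros_null n (F : n.-tuple plane -> C R) a (r : R) b G :
  separately_holomorphic F a r -> polysquare a r b -> F b != 0 ->
  measurable_fun [set: n.-tuple plane] G -> (forall t, 0 <= G t)%E ->
  (forall t, G t != 0%E -> polysquare a r t /\ F t = 0) ->
  (\int[lebn n]_t G t = 0)%E.
Proof.
elim: n F a b G => [|n IH] F a b G Fh ab Fb mG G0 GF.
  rewrite /= integral_dirac// diracT mul1e; apply/eqP/negPn/negP => /GF[_ Ft].
  have bE : [tuple] = b by exact/esym/tuple0.
  by move: Fb; rewrite -bE Ft eqxx.
have [a0 [a' aE]] := consT_surj a; have [b0 [b' bE]] := consT_surj b.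
rewrite aE bE in Fh GF ab Fb *.
have [Fh0 Fh1] := (separately_holomorphic_cons _ _ _ _).1 Fh.
have [b1 b2 ab'] := (polysquare_cons _ _ _ _ _).1 ab.
rewrite ge0_integral_cons//; have [mH mS] := measurable_slice mG G0.
pose f (w : C R) := F (consT ((Cre w, Cim w), b')).
have fx (x : plane) : f (cpt x) = F (consT (x, b')).
  by rewrite /f; congr (F (consT (_, _))); case: x.
have [fz|fiso] := square_alternative (Fh0 _ ab').
  have := fz (cpt b0) (conj b1 b2).
  by rewrite -/(f (cpt b0)) fx => /eqP; rewrite (negbTE Fb).
have nul := isolated_zeros_negligible fiso.
rewrite (@ge0_ae_eq_integral _ _ _ _ setT _ (cst 0%E))//; first exact: integral0.
  by move=> x _; exact: integral_ge0.
apply: negligibleS nul => x /= /not_implyP[_ /eqP Hx].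
have xa : csquare (cpt a0) r (cpt x).
  apply: contrapT => xa; move/eqP : Hx; apply.
  rewrite (eq_integral (cst 0%E)) ?integral0// => t _.
  apply/eqP/negPn/negP => /GF[/polysquare_cons[? ? _] _].
  by apply: xa; split.
split=> //; rewrite -/(f (cpt x)) fx; apply/eqP/negPn/negP => Fx.
move/eqP : Hx; apply.
apply: (IH _ a' b' (fun t => G (consT (x, t))) (Fh1 _ xa) ab' Fx (mS x)) => // t /GF.
by move=> [/polysquare_cons[_ _ ta] Ft]; split.
Qed.

End polysquares.

(** * Open subsets of complex space in real coordinates *)

Section open_sets.
Context {R : realType} {n : nat}.
Local Notation plane := (plane R).
Local Notation lebn := (measure_tuple (@lebesgue_plane R) n).
Implicit Types (x y : 'rV[C R]_n) (s t : n.-tuple plane) (U : set 'rV[C R]_n).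

Definition to_plane x : n.-tuple plane :=
  [tuple (Cre (x ord0 i), Cim (x ord0 i)) | i < n].

Lemma to_planeK : cancel to_plane (@of_plane R n).
Proof.
move=> x; apply/rowP => i; rewrite !mxE tnth_mktuple /=.
by case: (x ord0 i).
Qed.

Lemma of_planeK : cancel (@of_plane R n) to_plane.
Proof.
move=> t; apply: eq_from_tnth => i; rewrite tnth_mktuple !mxE /=.
by case: (tnth t i).
Qed.

Lemma of_planeE t : of_plane t = 0 + \sum_i cpt (tnth t i) *: delta_mx ord0 i.
Proof.
rewrite add0r [LHS]row_sum_delta; apply: eq_bigr => i _.
by rewrite mxE.
Qed.

Lemma modulus_of_plane s t i : modulus (of_plane s ord0 i - of_plane t ord0 i) <=
  `|(tnth s i).1 - (tnth t i).1| + `|(tnth s i).2 - (tnth t i).2|.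
Proof. by rewrite !mxE; simpc; exact: modulus_le. Qed.

Lemma open_polysquare U t : open U -> U (of_plane t) ->
  exists2 r : R, 0 < r & polysquare t r `<=` (@of_plane R n) @^-1` U.
Proof.
rewrite openE => oU /oU /nbhs_rowP[e e0 eU].
exists (e / 2); first by rewrite divr_gt0.
move=> s ts; apply: eU => i; apply: (le_lt_trans (modulus_of_plane _ _ _)).
by rewrite [ltRHS]splitr ltrD//; [exact: (ts i).1|exact: (ts i).2].
Qed.

Lemma polysquare_nbhs t (r : R) : 0 < r ->
  nbhs (of_plane t) [set y | polysquare t r (to_plane y)].
Proof.
move=> r0; apply/nbhs_rowP; exists r => // y ty i.
rewrite tnth_mktuple /=; have := ty i; rewrite !mxE => yi.
split; apply: le_lt_trans yi.
  by apply: le_trans (Re_le_modulus _); rewrite ReB.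
by apply: le_trans (Im_le_modulus _); rewrite ImB.
Qed.

Lemma polysquare_sub s t (r r' : R) : r' <= r -> polysquare s (r - r') t ->
  polysquare t r' `<=` polysquare s r.
Proof.
move=> rr st u tu i; have [s1 s2] := st i; have [u1 u2] := tu i.
split.
  rewrite -(subrK (tnth t i).1 (tnth u i).1) -addrA.
  by apply: (le_lt_trans (ler_normD _ _)); have := ltrD u1 s1; rewrite (addrC r') subrK.
rewrite -(subrK (tnth t i).2 (tnth u i).2) -addrA.
by apply: (le_lt_trans (ler_normD _ _)); have := ltrD u2 s2; rewrite (addrC r') subrK.
Qed.

Definition rat_center (q : n.-tuple (rat * rat)) : n.-tuple plane :=
  [tuple (ratr (tnth q i).1, ratr (tnth q i).2) | i < n].

(** These sets form a countable base, which reduces open sets and local null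
    sets to countable unions. *)
Definition box (k : n.-tuple (rat * rat) * nat) : set (n.-tuple plane) :=
  polysquare (rat_center k.1) k.2.+1%:R^-1.

Lemma box_basis t (e : R) : 0 < e ->
  exists k, box k t /\ box k `<=` polysquare t e.
Proof.
move=> e0; have e20 : 0 < e / 2 by rewrite divr_gt0.
have [m me] := inv_nat_lt e20.
have m0 : (0 : R) < m.+1%:R^-1 by rewrite invr_gt0.
have [a aP] := boolp.choice (fun i : 'I_n => rat_approx (tnth t i).1 m0).
have [b bP] := boolp.choice (fun i : 'I_n => rat_approx (tnth t i).2 m0).
exists ([tuple (a i, b i) | i < n], m); rewrite /box /=; split.
  by move=> i; rewrite !tnth_mktuple /=.
move=> s sk i; have [s1 s2] := sk i; move: s1 s2; rewrite !tnth_mktuple /= => s1 s2.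
have tri (u v q : R) : `|u - q| < m.+1%:R^-1 -> `|v - q| < m.+1%:R^-1 -> `|u - v| < e.
  move=> uq vq; rewrite -(subrK q u) -addrA; apply: (le_lt_trans (ler_normD _ _)).
  rewrite (distrC q) [ltRHS]splitr ltrD//; exact: lt_trans me.
by split; [exact: tri s1 (aP i)|exact: tri s2 (bP i)].
Qed.

Lemma measurable_polysquare t (r : R) : measurable (polysquare t r).
Proof.
have mI (c : R) : measurable ([set x : measurableTypeR R | `|x - c| < r]).
  rewrite (_ : [set _ | _] = `]c - r, c + r[%classic)//.
  by apply/seteqP; split => x /=; rewrite in_itv /= ltr_distl.
rewrite (_ : polysquare t r = \bigcap_(i in [set: 'I_n])
    ((fun s : n.-tuple plane => tnth s i) @^-1`
      ([set x | `|x - (tnth t i).1| < r] `*` [set x | `|x - (tnth t i).2| < r]))).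
  apply: fin_bigcap_measurable => // i _.
  rewrite -[X in measurable X]setTI; apply: measurable_tnth => //.
  exact: measurableX.
apply/seteqP; split => [s st i _|s st i]; first by have [] := st i.
by have [] := st i I.
Qed.

Lemma measurable_preimage_open U : open U ->
  measurable ((@of_plane R n) @^-1` U).
Proof.
move=> oU; pose S (m : nat) : set (n.-tuple plane) := if unpickle m is Some k then
  if pselect (box k `<=` (@of_plane R n) @^-1` U) then box k else set0 else set0.
have -> : (@of_plane R n) @^-1` U = \bigcup_m S m.
  apply/seteqP; split => [t Ut|t [m _]].
    have [r r0 rU] := open_polysquare oU Ut.
    have [k [kt kr]] := box_basis t r0.
    exists (pickle k); first exact: I.
    by rewrite /S pickleK; case: pselect => [//|]; case; exact: subset_trans rU.
  by rewrite /S; case: unpickle => [k|//]; case: pselect => // kU /kU.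
apply: bigcup_measurable => m _; rewrite /S.
by case: unpickle => [k|//]; case: pselect => /= ? //; exact: measurable_polysquare.
Qed.

Lemma measurable_continuous U (u : 'rV[C R]_n -> R) : open U ->
  (forall x, U x -> {for x, continuous u}) ->
  measurable_fun ((@of_plane R n) @^-1` U) (u \o @of_plane R n).
Proof.
move=> oU uc mU; apply: (measurability _ (RGenOpens.measurableE R)) => //.
move=> _ [_ [a [b ->] <-]].
rewrite [X in measurable X](_ : _ = (@of_plane R n) @^-1` (U `&` u @^-1` `]a, b[%classic))//.
apply: measurable_preimage_open.
rewrite openE => x [Ux ux]; apply: filterI; first by rewrite openE in oU; exact: oU.
have oab : open (`]a, b[%classic : set R) by exact: interval_open.
by apply: (uc _ Ux); move: oab; rewrite openE; apply.
Qed.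

Lemma negligible_local (Z : set (n.-tuple plane)) :
  (forall t, Z t -> exists2 r : R, 0 < r & lebn.-negligible (Z `&` polysquare t r)) ->
  lebn.-negligible Z.
Proof.
move=> Zloc; pose S (m : nat) : set (n.-tuple plane) := if unpickle m is Some k then
  if pselect (lebn.-negligible (Z `&` box k)) then Z `&` box k else set0 else set0.
have ZS : Z `<=` \bigcup_m S m.
  move=> t Zt; have [r r0 Zr] := Zloc _ Zt; have [k [kt kr]] := box_basis t r0.
  exists (pickle k); first exact: I.
  rewrite /S pickleK; case: pselect => /= [?|]; first by split.
  by case; apply: negligibleS Zr; exact: setIS.
apply: (negligibleS ZS); apply: negligible_bigcup => m; rewrite /S.
case: unpickle => [k|]; last exact: negligible_set0.
by case: pselect => /= h; [exact: h|exact: negligible_set0].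
Qed.

End open_sets.

(** * Holomorphic functions of several variables *)

Section holomorphic_functions.
Context {R : realType} {n : nat}.
Variable Omega : set 'rV[C R]_n.
Hypothesis Omega_open : open Omega.
Local Notation plane := (plane R).
Local Notation lebn := (measure_tuple (@lebesgue_plane R) n).
Implicit Types (f : 'rV[C R]_n -> C R) (x y z : 'rV[C R]_n) (t : n.-tuple plane).
Local Notation D := ((@of_plane R n) @^-1` Omega).

Lemma measurable_D : measurable D.
Proof. exact: measurable_preimage_open. Qed.

Lemma holomorphic_continuous f : holomorphic Omega f ->
  forall x, Omega x -> {for x, continuous f}.
Proof. by move=> fh x /fh/differentiable_continuous. Qed.

Lemma holomorphic_measurable f (g : C R -> R) : holomorphic Omega f ->
  (forall v w : C R, `|g v - g w| <= modulus (v - w)) ->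
  measurable_fun D (fun t => g (f (of_plane t))).
Proof.
move=> fh gL; apply: (@measurable_continuous _ _ _ (g \o f)) => // x Ox.
apply: (continuous_comp_modulus gL); exact: holomorphic_continuous.
Qed.

Lemma holomorphic_separately f t (r : R) : holomorphic Omega f ->
  polysquare t r `<=` D ->
  separately_holomorphic (fun t => f (of_plane t)) t r.
Proof.
move=> fh tD.
have -> : (fun t => f (of_plane t)) =
    (fun t => f (0 + \sum_i cpt (tnth t i) *: delta_mx ord0 i)).
  by apply/funext => s; rewrite of_planeE.
apply: separately_holomorphic_affine => s st w.
by rewrite -of_planeE; apply: diff_derivable; apply: fh; exact: tD.
Qed.

Lemma submean_holomorphic f t (r : R) : 0 < r -> holomorphic Omega f ->
  polysquare t (3 * r) `<=` D ->
  (((r ^+ 2 / 4) ^+ n * modulus (f (of_plane t)))%:E <=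
    \int[lebn]_(s in D) (modulus (f (of_plane s)))%:E)%E.
Proof.
move=> r0 fh tD; rewrite integral_mkcond.
apply: (submean r0 (holomorphic_separately fh tD)).
- apply/(measurable_restrictT _ measurable_D)/measurable_EFinP.
  exact: holomorphic_measurable ler_dist_modulus.
- by move=> s; rewrite patchE; case: ifP => // _; rewrite lee_fin modulus_ge0.
- by move=> s /tD Ds; rewrite patchE mem_set.
Qed.

(** This is the sub-mean value inequality for the constant function 1. *)
Lemma polysquare_measure_gt0 t (r : R) : 0 < r -> (0 < lebn (polysquare t r))%E.
Proof.
move=> r0; pose r' := r / 3.
have r'0 : 0 < r' by rewrite divr_gt0.
have rE : 3 * r' = r by rewrite mulrC divfK.
have sep : separately_holomorphic (fun=> 1 : C R) t (3 * r').
  apply: (@separately_holomorphic_affine R n _ (fun _ : C R => 1 : C R) 0 (fun=> 0)).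
  by move=> s _ w; exact: derivable_cst.
have := @submean R n _ t r' (fun s => (\1_(polysquare t r) s)%:E) r'0 sep.
rewrite integral_indic ?setIT//; last exact: measurable_polysquare.
rewrite modulus1 mulr1 => H; apply: lt_le_trans (H _ _ _).
- by rewrite lte_fin exprn_gt0// divr_gt0// exprn_gt0.
- by apply/measurable_EFinP; apply: measurable_indic; exact: measurable_polysquare.
- by move=> s; rewrite lee_fin.
- by move=> s; rewrite rE => ts; rewrite lee_fin indicE mem_set.
Qed.

Definition zeros f : set (n.-tuple plane) := [set t | D t /\ f (of_plane t) = 0].

Lemma measurable_zeros f : holomorphic Omega f -> measurable (zeros f).
Proof.
move=> fh.
have -> : zeros f = D `&` (fun t => modulus (f (of_plane t))) @^-1` [set 0].
  apply/seteqP; split => t [Dt ft]; split => //=; first by rewrite ft modulus0.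
  by apply/eqP; rewrite -modulus_eq0; apply/eqP.
exact: (holomorphic_measurable fh ler_dist_modulus measurable_D).
Qed.

(** The identity theorem in measure-theoretic form: the points near which [f]
    vanishes identically and those near which its zeros are null form two
    disjoint open sets that cover [Omega]. *)
Lemma zeros_negligible f z : connected Omega -> holomorphic Omega f ->
  Omega z -> f z != 0 -> lebn.-negligible (zeros f).
Proof.
move=> Oc fh Oz fz.
pose L : set 'rV[C R]_n := [set x : 'rV[C R]_n | nbhs x [set y | f y = 0]].
pose N := [set x | exists2 r : R, 0 < r &
  lebn.-negligible (zeros f `&` polysquare (to_plane x) r)].
have alt x : Omega x -> N x \/ L x.
  move=> Ox; have Dx : D (to_plane x) by rewrite /= to_planeK.
  have [r r0 rD] := open_polysquare Omega_open Dx.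
  have [f0|/existsNP[s /not_implyP[xs /eqP fs]]] :=
      pselect (forall s, polysquare (to_plane x) r s -> f (of_plane s) = 0).
    right; have := polysquare_nbhs (to_plane x) r0; rewrite to_planeK.
    by apply: filterS => y /f0; rewrite to_planeK.
  left; exists r => //.
  have mZ : measurable (zeros f `&` polysquare (to_plane x) r).
    by apply: measurableI; [exact: measurable_zeros|exact: measurable_polysquare].
  apply/negligibleP => //.
  have := @zeros_null R n _ (to_plane x) r s
    (fun t => (\1_(zeros f `&` polysquare (to_plane x) r) t)%:E)
    (holomorphic_separately fh rD) xs fs.
  rewrite integral_indic ?setIT//; apply.
  - by apply/measurable_EFinP; exact: measurable_indic.
  - by move=> t; rewrite lee_fin.
  - by move=> t; rewrite indicE; case: (boolP (t \in _)) => [/set_mem[[]]//|]; rewrite eqxx.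
have ON : Omega `<=` N.
  apply: (@connected_cover _ _ _ L) => //.
  - rewrite openE => x [r r0 Nr].
    have r20 : 0 < r / 2 by rewrite divr_gt0.
    have := polysquare_nbhs (to_plane x) r20; rewrite to_planeK.
    apply: filterS => y xy; exists (r / 2) => //.
    apply: negligibleS Nr; apply: setIS; apply: polysquare_sub.
      by rewrite ler_pdivrMr// ler_pMr// ler1n.
    by have -> : r - r / 2 = r / 2 by rewrite [X in X - _]splitr addrK.
  - by rewrite openE => x /nbhs_interior.
  - apply/seteqP; split => // x [[Ox [r r0 Nr]] Lx].
    have : nbhs x (Omega `&` [set y | f y = 0]).
      by apply: filterI => //; exact: open_nbhs_nbhs.
    rewrite -{1}(to_planeK x) => /nbhs_interior xi.
    have [r' r'0 r'Z] := open_polysquare (open_interior _) (nbhs_singleton xi).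
    pose m := Num.min r r'.
    have m0 : 0 < m by rewrite lt_min r0.
    have : lebn.-negligible (polysquare (to_plane x) m).
      apply: negligibleS Nr => t xt.
      have tr' : polysquare (to_plane x) r' t.
        by move=> i; have [] := xt i; rewrite !lt_min => /andP[_ ->] /andP[_ ->].
      split.
        by have [Ot ft] := interior_subset (r'Z _ tr').
      by move=> i; have [] := xt i; rewrite !lt_min => /andP[-> _] /andP[-> _].
    move/(measure_negligible (measurable_polysquare _ _)) => m00.
    by have := polysquare_measure_gt0 (to_plane x) m0; rewrite m00 ltxx.
  - exists z; split => //; have [//|Lz] := alt _ Oz.
    by have := nbhs_singleton Lz => /eqP; rewrite (negbTE fz).
apply: negligible_local => t [Dt _].
have Nt : N (of_plane t) by exact: ON.
by case: Nt => r r0; rewrite of_planeK => Nr; exists r.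
Qed.

End holomorphic_functions.

(** * Cauchy estimates *)

Section local_estimates.
Context {R : realType}.
Implicit Types (phi : C R -> C R) (s M e : R).

(** The derivative of [phi] at [0] is the first Taylor coefficient, so
    Taylor's formula gives bounds that depend on [sup |phi|] only. *)
Lemma taylor_bounds phi s M (l : C R) : 2 <= s -> rhol phi (- s) s (- s) s ->
  (forall x y, - s <= x <= s -> - s <= y <= s -> modulus (phi (x +i* y)%C) <= M) ->
  (forall e, 0 < e -> exists2 d : R, 0 < d & forall h : C R, modulus h < d ->
     modulus (phi h - phi 0 - h * l) <= e * modulus h) ->
  [/\ modulus (phi 1 - phi 0 - l) <= 8 * M * s^-1 ^+ 2,
      modulus (phi 1 - phi 0) <= 8 * M * s^-1 & modulus l <= 12 * M * s^-1].
Proof.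
move=> s2 ph pM dl; have s0 : 0 < s by exact: lt_le_trans s2.
have [t tP] := taylor s0 ph pM.
have M0 : 0 <= M.
  have ss : - s <= 0 <= s by rewrite oppr_le0 (ltW s0).
  by apply: le_trans (modulus_ge0 _) (pM 0 0 ss ss).
have s20 : 0 <= s / 2 by rewrite divr_ge0// ltW.
have m1 : modulus (1 : C R) <= s / 2 by rewrite modulus1 ler_pdivlMr// mul1r.
have t0 : t 0%N = phi 0.
  have := tP 1%N 0; rewrite modulus0 mul0r expr1 mulr0 big_ord1 expr0 mulr1 => /(_ s20) H.
  by apply/eqP; rewrite eq_sym -subr_eq0 -modulus_eq0 eq_le H modulus_ge0.
have first h : modulus h <= s / 2 -> modulus (phi h - phi 0) <= 8 * M * (modulus h / s).
  by move=> /(tP 1%N); rewrite big_ord1 expr0 mulr1 t0 expr1.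
have second h : modulus h <= s / 2 ->
    modulus (phi h - phi 0 - h * t 1%N) <= 8 * M * (modulus h / s) ^+ 2.
  move=> /(tP 2%N); rewrite big_ord_recl big_ord1 /= expr0 mulr1 t0 expr1.
  by rewrite opprD addrA (mulrC (t _)).
have lt1 : l = t 1%N.
  apply/eqP; rewrite -subr_eq0 -modulus_eq0 eq_le modulus_ge0 andbT leNgt.
  apply/negP => g0; set g := modulus _ in g0.
  have g40 : 0 < g / 4 by rewrite divr_gt0.
  have [d d0 dP] := dl _ g40.
  pose B := 8 * M * s^-1 ^+ 2 + 1.
  have B0 : 0 < B by rewrite ltr_wpDl// mulr_ge0 ?sqr_ge0 ?mulr_ge0.
  pose r := Num.min (s / 2) (Num.min (d / 2) (g / 4 / B)).
  have r0 : 0 < r by rewrite !lt_min !divr_gt0.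
  have [rs [rd rg]] : r <= s / 2 /\ r < d /\ r <= g / 4 / B.
    have rd : r <= d / 2 by rewrite !ge_min lexx !orbT.
    split; first by rewrite ge_min lexx.
    split; last by rewrite !ge_min lexx !orbT.
    by apply: (le_lt_trans rd); rewrite ltr_pdivrMr// ltr_pMr// ltr1n.
  pose h : C R := (r%:C)%C.
  have hr : modulus h = r by rewrite modulus_real ger0_norm// ltW.
  have := second h; rewrite hr => /(_ rs) E2.
  have := dP h; rewrite hr => /(_ rd) E1.
  have : g * r <= g / 4 * r + 8 * M * (r / s) ^+ 2.
    rewrite /g -hr -modulusM (_ : (l - t 1%N) * h =
      (phi h - phi 0 - h * t 1%N) - (phi h - phi 0 - h * l)); last by ring.
    by apply: (le_trans (modulusB _ _)); rewrite addrC hr lerD.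
  apply/negP; rewrite -ltNge.
  have -> : 8 * M * (r / s) ^+ 2 = (8 * M * s^-1 ^+ 2 * r) * r by ring.
  rewrite -mulrDl ltr_pM2r//.
  have rB : r * B <= g / 4 by rewrite -ler_pdivlMr.
  have : 8 * M * s^-1 ^+ 2 * r <= g / 4.
    by apply: le_trans rB; rewrite [leRHS]mulrC ler_wpM2r ?(ltW r0)// lerDl.
  by move: g0; clear => *; lra.
have E1 := first 1 m1; have E2 := second 1 m1.
rewrite modulus1 !mul1r -?lt1 in E1 E2; split=> //.
pose h : C R := ((s / 2)%:C)%C.
have hs : modulus h = s / 2 by rewrite modulus_real ger0_norm.
have := first h; have := second h; rewrite hs lexx => /(_ isT) F2 /(_ isT) F1.
have hE : s / 2 / s = 2^-1 by rewrite mulrAC divff ?mul1r// gt_eqF.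
rewrite hE in F1 F2.
have : s / 2 * modulus l <= 6 * M.
  rewrite -hs -modulusM lt1 (_ : h * t 1%N = (phi h - phi 0) - (phi h - phi 0 - h * t 1%N)); last by ring.
  apply: (le_trans (modulusB _ _)); apply: (le_trans (lerD F1 F2)).
  by rewrite le_eqVlt; apply/orP; left; apply/eqP; field.
have -> : s / 2 * modulus l = modulus l * s / 2 by rewrite mulrC mulrA.
by rewrite ler_pdivlMr// => H; move: H; rewrite ler_pdivrMr// => /le_trans; apply;
  rewrite le_eqVlt; apply/orP; left; apply/eqP; ring.
Qed.

(** In each direction [h] the one-variable bounds apply to [z |-> f (x + z *: h)];
    since they are uniform in [h], they hold for the full increment. *)
Lemma holomorphic_estimates n (f : 'rV[C R]_n -> C R) (x : 'rV[C R]_n) (r M : R) :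
  0 < r ->
  (forall y : 'rV[C R]_n, (forall i, modulus (y ord0 i - x ord0 i) <= r) ->
    differentiable f y /\ modulus (f y) <= M) ->
  forall (h : 'rV[C R]_n) (q : R), 0 < q <= r / 4 ->
  (forall i, modulus (h ord0 i) <= q) ->
  [/\ modulus (f (x + h) - f x - 'd f x h) <= 32 * M * (q / r) ^+ 2,
      modulus (f (x + h) - f x) <= 16 * M * (q / r) &
      modulus ('d f x h) <= 24 * M * (q / r)].
Proof.
move=> r0 fx h q /andP[q0 qr] hq.
pose s := r / (2 * q).
have q20 : 0 < 2 * q by rewrite mulr_gt0.
have s2 : 2 <= s.
  by rewrite /s ler_pdivlMr// mulrA -natrM -ler_pdivlMl// mulrC.
have near_x (z : C R) : `|Cre z| <= s -> `|Cim z| <= s ->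
    forall i, modulus ((x + z *: h) ord0 i - x ord0 i) <= r.
  move=> zr zi i; rewrite !mxE addrAC subrr add0r modulusM.
  have zs : modulus z <= s + s by apply: (le_trans (modulus_le _)); exact: lerD.
  have -> : r = (s + s) * q by rewrite /s; field; exact: lt0r_neq0.
  by rewrite ler_pM ?modulus_ge0.
pose phi (z : C R) := f (x + z *: h).
have ph : rhol phi (- s) s (- s) s.
  move=> a b ab bb; apply: derivable_line; apply: diff_derivable.
  by have [] := fx _ (near_x (a +i* b)%C _ _); rewrite /= ?ler_norml.
have pM a b : - s <= a <= s -> - s <= b <= s -> modulus (phi (a +i* b)%C) <= M.
  by move=> ab bb; have [] := fx _ (near_x (a +i* b)%C _ _); rewrite /= ?ler_norml.
have dfx : differentiable f x.
  by have [] := fx x _ => // i; rewrite subrr modulus0 ltW.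
have dl e : 0 < e -> exists2 d : R, 0 < d & forall z : C R, modulus z < d ->
     modulus (phi z - phi 0 - z * 'd f x h) <= e * modulus z.
  move=> e0; have [d d0 dP] := derive_modulusP (@diff_derivable _ _ _ f x h dfx) e0.
  exists d => // z /dP; rewrite deriveE// /phi scale0r addr0 (addrC x).
  exact.
have [] := taylor_bounds s2 ph pM dl.
rewrite /phi scale1r scale0r addr0.
have -> : s^-1 = 2 * (q / r) by rewrite /s invf_div mulrA.
move=> b1 b2 b3; split.
- by apply: (le_trans b1); rewrite le_eqVlt; apply/orP; left; apply/eqP; ring.
- by apply: (le_trans b2); rewrite le_eqVlt; apply/orP; left; apply/eqP; ring.
- by apply: (le_trans b3); rewrite le_eqVlt; apply/orP; left; apply/eqP; ring.
Qed.

End local_estimates.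

(** * Limits along an ultrafilter *)

Section ultralimits.
Context {R : realType} (U : set_system nat) {FU : UltraFilter U}.
Implicit Types (v w : nat -> C R) (l m a : C R) (e : R).

Definition ulim v l := forall e, 0 < e -> U [set n | modulus (v n - l) < e].

(** The limit is the supremum of the numbers that stay below [u] on a set of the
    ultrafilter. *)
Lemma real_ulim_ex (u : nat -> R) (B : R) : (forall n, `|u n| <= B) ->
  exists L : R, forall e, 0 < e -> U [set n | `|u n - L| < e].
Proof.
move=> uB; pose S := [set a : R | U [set n | a <= u n]].
have SB : S (- B).
  by apply: filterS filterT => n _; have := uB n; rewrite ler_norml => /andP[].
have Sub : ubound S B.
  move=> a Sa; have [n an] := filter_ex Sa.
  by apply: (le_trans an); have := uB n; rewrite ler_norml => /andP[].
exists (sup S) => e e0; have e20 : 0 < e / 2 by rewrite divr_gt0.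
have hS : has_sup S by split; [exists (- B)|exists B].
have [a Sa ale] := sup_adherent e20 hS.
have no : ~ U [set n | sup S + e / 2 <= u n].
  move=> /(ub_le_sup (ex_intro _ B Sub)); apply/negP.
  by rewrite -ltNge ltrDl.
have [//|Uc] := in_ultra_setVsetC [set n | sup S + e / 2 <= u n] FU.
apply: filterS (filterI Sa Uc) => n [/= an /negP].
rewrite -ltNge => nu; rewrite ltr_norml; move: an nu ale e0; clear => *; lra.
Qed.

Lemma ulim_ex v (B : R) : (forall n, modulus (v n) <= B) -> exists l, ulim v l.
Proof.
move=> vB.
have [a aP] := @real_ulim_ex (fun n => Cre (v n)) B
  (fun n => le_trans (Re_le_modulus _) (vB n)).
have [b bP] := @real_ulim_ex (fun n => Cim (v n)) B
  (fun n => le_trans (Im_le_modulus _) (vB n)).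
exists (a +i* b)%C => e e0; have e20 : 0 < e / 2 by rewrite divr_gt0.
apply: filterS (filterI (aP _ e20) (bP _ e20)) => n [/= na nb].
apply: (le_lt_trans (modulus_le _)); rewrite ReB ImB [ltRHS]splitr.
exact: ltrD.
Qed.

Lemma ulim_unique v l m : ulim v l -> ulim v m -> l = m.
Proof.
move=> vl vm; apply/eqP; rewrite -subr_eq0 -modulus_eq0 eq_le modulus_ge0 andbT leNgt.
apply/negP => g0; have g20 : 0 < modulus (l - m) / 2 by rewrite divr_gt0.
have [n [/= nl nm]] := filter_ex (filterI (vl _ g20) (vm _ g20)).
have : modulus (l - m) < modulus (l - m).
  have -> : l - m = (v n - m) - (v n - l) by ring.
  rewrite [ltRHS](_ : _ = modulus (l - m) / 2 + modulus (l - m) / 2).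
    by apply: (le_lt_trans (modulusB _ _)); exact: ltrD.
  by rewrite -splitr; congr modulus; ring.
by rewrite ltxx.
Qed.

Lemma ulim_linear v w l m a : ulim v l -> ulim w m ->
  ulim (fun n => a * v n + w n) (a * l + m).
Proof.
move=> vl wm e e0; pose K := modulus a + 1.
have K0 : 0 < K by rewrite ltr_wpDl ?modulus_ge0.
have e1 : 0 < e / 2 / K by rewrite !divr_gt0.
have e2 : 0 < e / 2 by rewrite divr_gt0.
apply: filterS (filterI (vl _ e1) (wm _ e2)) => n [/= nl nm].
have -> : a * v n + w n - (a * l + m) = a * (v n - l) + (w n - m) by ring.
apply: (le_lt_trans (modulusD _ _)); rewrite modulusM [ltRHS]splitr.
apply: ler_ltD => //; apply: (@le_trans _ _ (K * (e / 2 / K))).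
  by apply: ler_pM; rewrite ?modulus_ge0//; [rewrite lerDl|exact: ltW].
by rewrite mulrC divfK// gt_eqF.
Qed.

Lemma ulim_le v l (c : R) : (forall n, modulus (v n) <= c) -> ulim v l ->
  modulus l <= c.
Proof.
move=> vc vl; rewrite leNgt; apply/negP; rewrite -subr_gt0 => g0.
have [n /= nl] := filter_ex (vl _ g0).
have := modulusD (l - v n) (v n); rewrite subrK modulusBC => H.
by move: nl H (vc n); clear => *; lra.
Qed.

Lemma ulim_sub v w l m : ulim v l -> ulim w m -> ulim (fun n => v n - w n) (l - m).
Proof.
move=> vl wm; have := ulim_linear (-1) wm vl.
have -> : (fun n => -1 * w n + v n) = (fun n => v n - w n).
  by apply/funext => n; rewrite mulN1r addrC.
by rewrite mulN1r addrC.
Qed.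

End ultralimits.

(** * Montel's theorem *)

Section montel.
Context {R : realType} {n : nat}.
Local Notation row := 'rV[C R]_n.
Variable Omega : set row.

Lemma row_norm_real (h : row) : `|h| = ((Cre `|h|)%:C)%C.
Proof.
have : 0 <= `|h| by exact: normr_ge0.
by case: `|h| => a b; rewrite lecE /= => /andP[/eqP -> _].
Qed.

Lemma row_norm_coord (h : row) i : modulus (h ord0 i) <= Cre `|h|.
Proof.
rewrite leNgt; apply/negP => hi.
have : ball (0 : row) ((modulus (h ord0 i))%:C)%C h.
  by rewrite -ball_normE /= sub0r normrN row_norm_real ltcR.
move=> [_ /(_ ord0 i)]; rewrite /ball /= mxE sub0r normrN normE.
by rewrite ltxx.
Qed.

(** The bounds are in terms of the size of the coordinates, which is what the
    local estimates of holomorphic functions provide and what survives limits;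
    the bound on [D] gives the continuity required of a differential. *)
Lemma differentiable_quadratic (f : row -> C R) (x : row) (D : row -> C R)
    (q0 K K' : R) : 0 < q0 ->
  (forall a h k, D (a *: h + k) = a * D h + D k) ->
  (forall (h : row) q, 0 < q <= q0 -> (forall i, modulus (h ord0 i) <= q) ->
    modulus (f (x + h) - f x - D h) <= K * q ^+ 2 /\ modulus (D h) <= K' * q) ->
  differentiable f x.
Proof.
move=> q00 Dlin Dq.
have Dlin' : linear D by move=> a h k; rewrite Dlin.
pose Dl : {linear row -> C R} := HB.pack D (GRing.isLinear.Build _ _ _ _ D Dlin').
have DE : (Dl : row -> C R) = D by [].
have D0 : D 0 = 0.
  have /eqP := Dlin 1 0 0; rewrite scale1r addr0 mul1r -subr_eq0 opprD addrA subrr.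
  by rewrite sub0r oppr_eq0 => /eqP.
pose B := `|K'| + 1.
have B0 : 0 < B by rewrite ltr_wpDl.
have Dc : continuous D.
  move=> y; apply/continuous_modulusP => e e0.
  pose q := Num.min q0 (e / 2 / B).
  have qp : 0 < q by rewrite lt_min q00 !divr_gt0.
  apply/nbhs_rowP; exists q => // z zy.
  have -> : D z - D y = D (z - y).
    have -> : z - y = (-1) *: y + z by rewrite scaleN1r addrC.
    by rewrite Dlin mulN1r addrC.
  have qq : 0 < q <= q0 by rewrite qp ge_min lexx.
  have [] := Dq (z - y) q qq; first by move=> i; rewrite !mxE ltW.
  move=> _ /le_lt_trans; apply; apply: (@le_lt_trans _ _ (B * q)).
    by rewrite ler_wpM2r// ?(ltW qp)// (le_trans (ler_norm _))// lerDl.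
  apply: (@le_lt_trans _ _ (B * (e / 2 / B))).
    by rewrite ler_wpM2l// ?(ltW B0)// ge_min lexx orbT.
  by rewrite mulrC divfK ?gt_eqF// ltr_pdivrMr// ltr_pMr// ltr1n.
have Do : f \o shift x = cst (f x) + D +o_ (0 : row) id.
  apply/eqaddoP => _/posnumP[e]; have [e0 eE] := gt0_real_complex (gt0 e).
  pose A := `|K| + 1; have A0 : 0 < A by rewrite ltr_wpDl.
  pose d := Num.min q0 (Cre e%:num / A).
  have d0 : 0 < d by rewrite lt_min q00 divr_gt0.
  apply/nbhs_ballP; exists (d%:C)%C => /=; first by rewrite ltcR.
  move=> h; rewrite -ball_normE /= sub0r normrN row_norm_real ltcR => hd.
  have hq := row_norm_coord h; set q := Cre `|h| in hd hq *.
  have q_ge0 : 0 <= q.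
    by have : 0 <= `|h| by []; rewrite row_norm_real ler0c.
  have -> : (f \o shift x - (cst (f x) + D)) h = f (x + h) - f x - D h.
    transitivity (f ((h : row) + x) - (f x + D h)); first by [].
    by rewrite [(h : row) + x]addrC opprD addrA.
  rewrite eE normE -rmorphM lecR; set E := Cre e%:num.
  have [q00' | qp] := eqVneq q 0.
    have h0 : h = 0 by apply/normr0_eq0; rewrite row_norm_real -/q q00'.
    by rewrite h0 addr0 D0 subr0 subrr modulus0 q00' mulr0.
  have qgt0 : 0 < q by rewrite lt_def qp.
  have qq0 : 0 < q <= q0 by rewrite qgt0 /= ltW// (lt_le_trans hd)// ge_min lexx.
  have [+ _] := Dq h q qq0 hq; move=> /le_trans; apply.
  rewrite expr2 mulrA ler_pM2r//; apply: (@le_trans _ _ (A * q)).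
    by rewrite ler_pM2r// (le_trans (ler_norm _))// lerDl.
  rewrite mulrC -ler_pdivlMr// ltW//; apply: (lt_le_trans hd).
  by rewrite ge_min lexx orbT.
have := @diff_unique _ _ _ f Dl x Dc Do => dE.
by apply/diff_locallyP; rewrite dE.
Qed.

(** The limit is taken along an ultrafilter, for which the
    values and the differentials converge at once; equicontinuity then turns
    convergence along the ultrafilter at countably many points into pointwise
    convergence of a subsequence. *)
Lemma montel (fs : nat -> row -> C R) :
  (forall j, holomorphic Omega (fs j)) ->
  (forall x, Omega x -> exists r M : R, 0 < r /\ forall j (y : row),
    (forall i, modulus (y ord0 i - x ord0 i) <= r) ->
    Omega y /\ modulus (fs j y) <= M) ->
  exists (f : row -> C R) (k : nat -> nat), [/\ holomorphic Omega f,
    forall j, (j <= k j)%N &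
    forall x, Omega x -> forall e, 0 < e ->
      exists J, forall j, (J <= j)%N -> modulus (fs (k j) x - f x) < e].
Proof.
move=> fsh bd.
have [U [FU oU]] := @ultraFilterLemma nat \oo _.
have est x : Omega x -> exists r K : R, [/\ 0 < r, 0 < K & forall j (h : row) q,
    0 < q <= r -> (forall i, modulus (h ord0 i) <= q) ->
    [/\ Omega (x + h), modulus (fs j (x + h) - fs j x - 'd (fs j) x h) <= K * q ^+ 2,
      modulus (fs j (x + h) - fs j x) <= K * q &
      modulus ('d (fs j) x h) <= K * q]].
  move=> Ox; have [r [M [r0 rM]]] := bd _ Ox.
  have M0 : 0 <= M.
    have [] := rM 0%N x; first by move=> i; rewrite subrr modulus0 ltW.
    by move=> _; apply: le_trans; exact: modulus_ge0.
  pose K := 32 * M / r ^+ 2 + 24 * M / r + 1.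
  have t1 : 0 <= 32 * M / r ^+ 2 by apply: divr_ge0; [exact: mulr_ge0|exact: sqr_ge0].
  have t2 : 0 <= 24 * M / r by apply: divr_ge0; [exact: mulr_ge0|exact: ltW].
  have K0 : 0 < K by rewrite ltr_wpDl// addr_ge0.
  exists (r / 4), K; split => // [|j h q /andP[q0 qr] hq]; first by rewrite divr_gt0.
  have qr' : q <= r by apply: (le_trans qr); rewrite ler_pdivrMr// ler_pMr// ler1n.
  have [Oxh _] : Omega (x + h) /\ modulus (fs j (x + h)) <= M.
    by apply: rM => i; rewrite !mxE addrAC subrr add0r; exact: le_trans qr'.
  have fx (y : row) : (forall i, modulus (y ord0 i - x ord0 i) <= r) ->
      differentiable (fs j) y /\ modulus (fs j y) <= M.
    by move=> /(rM j)[Oy ?]; split => //; exact: fsh.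
  have qq : 0 < q <= r / 4 by rewrite q0.
  have [e1 e2 e3] := holomorphic_estimates r0 fx qq hq.
  split=> //.
  - apply: (le_trans e1); rewrite expr_div_n mulrCA mulrC ler_wpM2r ?sqr_ge0//.
    by rewrite /K -addrA lerDl addr_ge0.
  - apply: (le_trans e2); rewrite mulrCA mulrC ler_wpM2r ?(ltW q0)//.
    rewrite /K -addrA addrCA (le_trans _ (_ : 24 * M / r <= _)) ?lerDl ?addr_ge0//.
    by rewrite ler_wpM2r ?invr_ge0 ?(ltW r0)// ler_wpM2r// ler_nat.
  - apply: (le_trans e3); rewrite mulrCA mulrC ler_wpM2r ?(ltW q0)//.
    by rewrite /K -addrA addrCA lerDl addr_ge0.
have lim x : Omega x -> exists l, ulim U (fun j => fs j x) l.
  move=> Ox; have [r [M [r0 rM]]] := bd _ Ox.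
  apply: (@ulim_ex _ U FU _ M) => j.
  by have [] := rM j x => // i; rewrite subrr modulus0 ltW.
have [f fP] := boolp.choice (fun x => (ltac:(
  have [Ox|nOx] := pselect (Omega x);
  [by have [l lP] := lim _ Ox; exists l => _; exact: lP | by exists 0 => /nOx]) :
    exists l, Omega x -> ulim U (fun j => fs j x) l)).
have fh : holomorphic Omega f.
  move=> x Ox; have [r [K [r0 K0 rK]]] := est _ Ox.
  (* the estimates bound the differentials on small vectors; scaling gives all
     vectors *)
  have limD h : exists l, ulim U (fun j => 'd (fs j) x h) l.
    pose q := Num.min r 1; have q0 : 0 < q by rewrite lt_min r0 ltr01.
    pose c := q / (Cre `|h| + 1).
    have hn0 : 0 <= Cre `|h| by rewrite -ler0c -row_norm_real.
    have hn1 : 0 < Cre `|h| + 1 by rewrite ltr_wpDl.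
    have c0 : 0 < c by rewrite divr_gt0.
    pose cc : C R := (c%:C)%C.
    have cc0 : cc != 0 by rewrite -modulus_gt0 modulus_real gtr0_norm.
    have [l lP] : exists l, ulim U (fun j => 'd (fs j) x (cc *: h)) l.
      apply: (@ulim_ex _ U FU _ (K * q)) => j.
      have [] := rK j (cc *: h) q; first by rewrite q0 ge_min lexx.
        move=> i; rewrite mxE modulusM modulus_real gtr0_norm// /c mulrAC.
        rewrite ler_pdivrMr// ler_pM2l// (le_trans (row_norm_coord _ _))//.
        by rewrite lerDl.
      by [].
    exists (cc^-1 * l + 0).
    have z0 : ulim U (fun _ : nat => 0 : C R) 0.
      by move=> e e0; apply: filterS filterT => j _; rewrite /mkset subrr modulus0.
    have := ulim_linear cc^-1 lP z0.
    have -> : (fun j => cc^-1 * 'd (fs j) x (cc *: h) + 0) = (fun j => 'd (fs j) x h).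
    by apply: funext => j; rewrite addr0 linearZ /= mulKf.
    exact.
  have [D DP] := boolp.choice limD.
  apply: (@differentiable_quadratic f x D r K K r0).
  - move=> a h k; apply: (ulim_unique (DP _)).
    have := ulim_linear a (DP h) (DP k).
    have -> : (fun j => a * 'd (fs j) x h + 'd (fs j) x k) =
      (fun j => 'd (fs j) x (a *: h + k)).
    by apply: funext => j; rewrite linearP.
    exact.
  - move=> h q qr hq; have [Oxh _ _ _] := rK 0%N h q qr hq.
    split.
      apply: (ulim_le _ (ulim_sub (ulim_sub (fP _ Oxh) (fP _ Ox)) (DP h))) => j.
      by have [] := rK j h q qr hq.
    apply: (ulim_le _ (DP h)) => j.
    by have [] := rK j h q qr hq.
pose pt m : row := if unpickle m is Some c then of_plane (rat_center c) else 0.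
(* the index [k j] is close to the limit at the first [j] rational points *)
pose good (j i : nat) := (j <= i)%N /\ forall m, (m <= j)%N ->
  Omega (pt m) -> modulus (fs i (pt m) - f (pt m)) < j.+1%:R^-1.
have [k kP] : {k : nat -> nat & forall j, good j (k j)}.
  apply: boolp.choice => j.
  have j0 : (0 : R) < j.+1%:R^-1 by rewrite invr_gt0.
  have UA m : U [set i | Omega (pt m) -> modulus (fs i (pt m) - f (pt m)) < j.+1%:R^-1].
    have [Om|nOm] := pselect (Omega (pt m)).
      by apply: filterS (fP _ Om _ j0) => i /= H _.
    by apply: filterS filterT => i _ /nOm.
  have UB m : U [set i | forall m', (m' <= m)%N -> Omega (pt m') ->
      modulus (fs i (pt m') - f (pt m')) < j.+1%:R^-1].
    elim: m => [|m IH].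
      by apply: filterS (UA 0%N) => i H m'; rewrite leqn0 => /eqP ->.
    apply: filterS (filterI IH (UA m.+1)) => i [H1 H2] m'.
    by rewrite leq_eqVlt => /predU1P[->//|]; rewrite ltnS; exact: H1.
  have Uj : U [set i | (j <= i)%N] by apply: oU; exists j.
  by have [i [i1 i2]] := filter_ex (filterI Uj (UB j)); exists i.
exists f, k; split => //; first by move=> j; have [] := kP j.
move=> x Ox e e0; have [r [K [r0 K0 rK]]] := est _ Ox.
pose q := Num.min r (e / 4 / K).
have q0 : 0 < q by rewrite lt_min r0 !divr_gt0.
have Kq : K * q <= e / 4.
  rewrite mulrC -ler_pdivlMr//; by rewrite ge_min lexx orbT.
have q20 : 0 < q / 2 by rewrite divr_gt0.
have [c [cx cq]] := box_basis (to_plane x) q20.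
pose m := pickle c.1.
have ptm : pt m = of_plane (rat_center c.1) by rewrite /pt pickleK.
have near i : modulus ((pt m - x) ord0 i) <= q.
  have cc : @box R n c (rat_center c.1) by move=> i'; split; rewrite subrr normr0 invr_gt0.
  have := cq _ cc i => -[h1 h2].
  rewrite ptm -(to_planeK x) !mxE; simpc; apply: (le_trans (modulus_le _)) => /=.
  by rewrite [leRHS]splitr ltW// ltrD.
have qq : 0 < q <= r by rewrite q0 ge_min lexx.
have xp : x + (pt m - x) = pt m by rewrite addrC subrK.
have [Op _ _ _] := rK 0%N _ q qq near; rewrite xp in Op.
have lip j : modulus (fs j (pt m) - fs j x) <= e / 4.
  have [_ _ + _] := rK j _ q qq near; rewrite xp => /le_trans; exact.
have lipf : modulus (f (pt m) - f x) <= e / 4.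
  by apply: (ulim_le lip); exact: (ulim_sub (fP _ Op) (fP _ Ox)).
have e40 : 0 < e / 4 by rewrite divr_gt0.
have [N Ne] := inv_nat_lt e40.
exists (maxn m N) => j; rewrite geq_max => /andP[mj Nj].
have [_ /(_ m mj Op) km] := kP j.
have jN : j.+1%:R^-1 <= N.+1%:R^-1 :> R by rewrite lef_pV2 ?posrE// ler_nat.
have -> : fs (k j) x - f x = (fs (k j) (pt m) - f (pt m)) -
   (fs (k j) (pt m) - fs (k j) x) + (f (pt m) - f x) by ring.
apply: (le_lt_trans (modulusD _ _)).
have := modulusB (fs (k j) (pt m) - f (pt m)) (fs (k j) (pt m) - fs (k j) x).
have km' := lt_trans (lt_le_trans km jN) Ne.
by move: (lip (k j)) lipf km' e0; clear => *; lra.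
Qed.

End montel.

(** * Existence of the minimizer *)

Section integrals.
Context {R : realType} {n : nat}.
Local Notation row := 'rV[C R]_n.
Local Notation plane := (plane R).
Local Notation lebn n := (measure_tuple (@lebesgue_plane R) n).

(** By Fubini's theorem each further variable multiplies the measure by that of a
    square. *)
Lemma polysquare_finite m (a : m.-tuple plane) (r : R) :
  (lebn m (polysquare a r) < +oo)%E.
Proof.
elim: m a => [|m IH] a.
  by rewrite /= diracE; case: (_ \in _); rewrite ltry.
have [a0 [a' aE]] := consT_surj a; rewrite aE.
set P := polysquare _ r.
have mP : measurable P := measurable_polysquare _ _.
pose J c : set (measurableTypeR R) := [set x | `|x - c| < r].
have JE c : J c = `]c - r, c + r[%classic.
  by apply/seteqP; split => x; rewrite /J /= in_itv /= ltr_distl.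
have mJ c : measurable (J c) by rewrite JE.
have mS : measurable (J a0.1 `*` J a0.2 : set plane) by apply: measurableX.
have -> : lebn m.+1 P = (\int[lebn m.+1]_t (\1_P t)%:E)%E.
  by rewrite integral_indic// setIT.
rewrite ge0_integral_cons; last 2 first.
- by apply/measurable_EFinP; exact: measurable_indic.
- by move=> t; rewrite lee_fin.
have -> : (fun x => \int[lebn m]_t (\1_P (consT (x, t)))%:E)%E =
    (fun x => lebn m (polysquare a' r) * (\1_(J a0.1 `*` J a0.2) x)%:E)%E.
  apply/funext => x.
  have -> : (fun t => (\1_P (consT (x, t)))%:E : \bar R) =
     (fun t => (\1_(J a0.1 `*` J a0.2) x)%:E * (\1_(polysquare a' r) t)%:E)%E.
    apply/funext => t; rewrite -EFinM; congr EFin; rewrite !indicE.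
    have [xJ|xJ] := pselect ((J a0.1 `*` J a0.2) x).
      rewrite (mem_set xJ) mul1r; congr (_ %:R); congr nat_of_bool.
      apply/idP/idP => /set_mem H; apply/mem_set.
        by have [] := (polysquare_cons _ _ _ _ _).1 H.
      by apply/polysquare_cons; case: xJ.
    rewrite (memNset xJ) mul0r (_ : _ \in _ = false)//.
    apply/memNset => /polysquare_cons[x1 x2 _]; exact: xJ.
  rewrite ge0_integralZl//.
  - rewrite integral_indic ?setIT 1?muleC//; exact: measurable_polysquare.
  - by apply/measurable_EFinP; apply: measurable_indic; exact: measurable_polysquare.
rewrite ge0_integralZl//; last first.
  by apply/measurable_EFinP; exact: measurable_indic.
rewrite integral_indic// setIT lte_mul_pinfty//.
- by rewrite ge0_fin_numE//; exact: IH.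
- rewrite [X in (X < _)%E](_ : _ = lebesgue_measure (J a0.1) * lebesgue_measure (J a0.2))%E.
    by rewrite !JE !lebesgue_measure_itv /=; do 2 case: ifP => _; rewrite -?EFinM ?mule0 ?mul0e ltry.
  exact: product_measure1E.
Qed.

Lemma bounded_coordinates (Omega : set row) : bounded_set Omega ->
  exists B : R, forall x, Omega x -> forall i, modulus (x ord0 i) < B.
Proof.
move=> [M [Mreal MO]]; exists (Cre M + 2) => x Ox i.
have M1 : M < M + 1 by rewrite ltrDl.
have /= := MO _ M1 x Ox; rewrite row_norm_real lecE /= => /andP[_ xM].
apply: (le_lt_trans (row_norm_coord _ _)); apply: (le_lt_trans xM).
by rewrite ReD /= ltrD2l ltr1n.
Qed.

End integrals.

Section minimizer.
Context {R : realType} {n : nat}.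
Local Notation row := 'rV[C R]_n.
Local Notation lebn n := (measure_tuple (@lebesgue_plane R) n).
Variables (Omega : set row) (p : R).
Hypothesis Omega_open : open Omega.
Hypothesis Omega_bounded : bounded_set Omega.
Hypothesis p1 : 1 <= p.
Local Notation D := ((@of_plane R n) @^-1` Omega).
Let p0 : 0 < p. Proof. exact: lt_le_trans p1. Qed.
Let pn0 : p != 0. Proof. by rewrite gt_eqF. Qed.

Lemma Omega_finite : (lebn n D < +oo)%E.
Proof.
have [B BP] := bounded_coordinates Omega_bounded.
apply: le_lt_trans (polysquare_finite (to_plane (0 : row)) B).
apply: le_measure; rewrite ?inE; [exact: measurable_D|exact: measurable_polysquare|].
move=> t Dt i; rewrite !tnth_mktuple !mxE /= !subr0; have := BP _ Dt i.
rewrite mxE => tB; split; apply: le_lt_trans tB.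
  exact: (Re_le_modulus ((tnth t i).1 +i* (tnth t i).2)%C).
exact: (Im_le_modulus ((tnth t i).1 +i* (tnth t i).2)%C).
Qed.

Definition p_integral (f : row -> C R) : \bar R :=
  integral_Cn Omega (fun x => modulus (f x) `^ p).

Lemma p_integral_ge0 f : (0 <= p_integral f)%E.
Proof. by apply: integral_ge0 => t _; rewrite lee_fin powR_ge0. Qed.

Lemma p_normX f : A_p Omega p f -> p_integral f = (p_norm Omega p f `^ p)%:E.
Proof.
move=> [_ If]; rewrite /p_norm -/(p_integral f) -powRrM mulVf// powRr1.
  by rewrite fineK// ge0_fin_numE// p_integral_ge0.
exact/fine_ge0/p_integral_ge0.
Qed.

Lemma measurable_modulus_powR (f : row -> C R) : holomorphic Omega f ->
  measurable_fun D (fun t => modulus (f (of_plane t)) `^ p).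
Proof.
move=> fh; have mp : measurable_fun [set: measurableTypeR R] (@powR R ^~ p).
  exact: measurable_powR.
have mf := holomorphic_measurable Omega_open fh ler_dist_modulus.
exact: (measurableT_comp mp mf).
Qed.

(** On a set of finite measure this makes [p]-integrable functions integrable, so
    that the sub-mean value inequality for the exponent 1 suffices. *)
Lemma modulus_le_powR (a : R) : 0 <= a -> a <= 1 + a `^ p.
Proof.
move=> a0; have [a1|/ltW a1] := leP a 1; first by rewrite (le_trans a1)// lerDl powR_ge0.
by apply: (le_trans (le1r_powR a1 p1)); rewrite lerDr.
Qed.

Lemma integral_modulus_le (f : row -> C R) : holomorphic Omega f ->
  (\int[lebn n]_(t in D) (modulus (f (of_plane t)))%:E <= lebn n D + p_integral f)%E.
Proof.
move=> fh; have mD := measurable_D Omega_open.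
apply: (@le_trans _ _ (\int[lebn n]_(t in D)
  (1%:E + (modulus (f (of_plane t)) `^ p)%:E))%E).
  apply: ge0_le_integral => //.
  - by move=> t _; rewrite lee_fin modulus_ge0.
  - apply/measurable_EFinP; exact: (holomorphic_measurable Omega_open fh ler_dist_modulus).
  - apply/emeasurable_funD => //; apply/measurable_EFinP; exact: measurable_modulus_powR.
  - by move=> t _; rewrite -EFinD lee_fin modulus_le_powR// modulus_ge0.
rewrite ge0_integralD//; last 2 first.
- by move=> t _; rewrite lee_fin powR_ge0.
- by apply/measurable_EFinP; exact: measurable_modulus_powR.
by rewrite integral_cst// mul1e.
Qed.

Lemma powR_cvg (u : nat -> R) (a : R) : (forall j, 0 <= u j) -> 0 <= a ->
  (forall e, 0 < e -> exists J, forall j, (J <= j)%N -> `|u j - a| < e) ->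
  (fun j => (u j `^ p)%:E) @ \oo --> (a `^ p)%:E.
Proof.
move=> u0 a0 ua; apply: cvg_EFin; first by apply: nearW.
rewrite (_ : fine \o _ = (fun j => u j `^ p)); last by apply/funext.
move: a0; rewrite le_eqVlt => /predU1P[aE|a0].
  rewrite -aE powR0//; apply/cvgrPdist_lt => e e0.
  have e10 : 0 < Num.min e 1 by rewrite lt_min e0 ltr01.
  have [J JP] := ua _ e10; exists J => // j /= Jj.
  have := JP _ Jj; rewrite -aE subr0 lt_min (ger0_norm (u0 j)) => /andP[ue u1].
  rewrite sub0r normrN ger0_norm ?powR_ge0//.
  have [uj0|uj0] := eqVneq (u j) 0; first by rewrite uj0 powR0.
  by apply: le_lt_trans ue; apply: ge1r_powR => //; rewrite lt_def uj0 u0 ltW.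
have ucv : u @ \oo --> a.
  apply/cvgrPdist_lt => e e0; have [J JP] := ua _ e0.
  by exists J => // j /= /JP; rewrite distrC.
have pc : {for a, continuous (@powR R ^~ p)}.
  by apply/differentiable_continuous/derivable1_diffP; apply: derivable_powR; rewrite in_itv /= a0.
exact: (cvg_comp u (@powR R ^~ p) ucv pc).
Qed.

(** A minimizing sequence is locally
    bounded by the sub-mean value inequality, hence has a holomorphic limit by
    Montel's theorem, whose norm is controlled by Fatou's lemma. *)
Lemma minimizer_exists z : Omega z ->
  exists f, [/\ A_p Omega p f, f z = 1 & p_norm Omega p f = m_p Omega p z].
Proof.
move=> Oz; have mD := measurable_D Omega_open.
pose S := [set p_norm Omega p f | f in [set f | A_p Omega p f /\ f z = 1]].
have one : A_p Omega p (fun _ => 1).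
  split; first by move=> x _; exact: differentiable_cst.
  rewrite /integral_Cn (eq_integral (cst 1%E)).
    by rewrite integral_cst// mul1e; exact: Omega_finite.
  by move=> t _; rewrite modulus1 powR1.
have Sinf : has_inf S.
  split; first by exists (p_norm Omega p (fun _ => 1)), (fun _ => 1).
  by exists 0 => _ [f _ <-]; exact: powR_ge0.
pose m := m_p Omega p z.
have near_min j : exists f, [/\ A_p Omega p f, f z = 1 &
    p_norm Omega p f < m + j.+1%:R^-1].
  have j0 : (0 : R) < j.+1%:R^-1 by rewrite invr_gt0.
  by have [_ [f [fA fz] <-] fm] := inf_adherent j0 Sinf; exists f.
have [fs fsP] := boolp.choice near_min.
have m0 : 0 <= m.
  by apply: lb_le_inf; [have [] := Sinf|move=> _ [f _ <-]; exact: powR_ge0].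
have fsh j : holomorphic Omega (fs j) by have [[]] := fsP j.
have fsI (J j : nat) : (J <= j)%N -> (p_integral (fs j) <= ((m + J.+1%:R^-1) `^ p)%:E)%E.
  move=> Jj; have [fA _ fm] := fsP j; rewrite (p_normX fA) lee_fin.
  apply: ge0_ler_powR; rewrite ?nnegrE ?powR_ge0 ?(ltW p0)// ?addr_ge0 ?invr_ge0//.
  by apply: (le_trans (ltW fm)); rewrite lerD2l lef_pV2 ?posrE// ler_nat.
have bd x : Omega x -> exists r M : R, 0 < r /\ forall j (y : row),
    (forall i, modulus (y ord0 i - x ord0 i) <= r) -> Omega y /\ modulus (fs j y) <= M.
  move=> Ox; have Dx : D (to_plane x) by rewrite /= to_planeK.
  have [s s0 sD] := open_polysquare Omega_open Dx.
  have s60 : 0 < s / 6 by rewrite divr_gt0.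
  pose k := ((s / 6) ^+ 2 / 4) ^+ n.
  have k0 : 0 < k by rewrite exprn_gt0// divr_gt0// exprn_gt0.
  exists (s / 4), (k^-1 * (fine (lebn n D) + (m + 1) `^ p)); split; first by rewrite divr_gt0.
  move=> j y xy.
  have sE : 3 * (s / 6) = s / 2 by field.
  have s4 : s / 4 < s / 2 by rewrite ltr_pM2l// ltf_pV2 ?posrE// ltr_nat.
  have yx : polysquare (to_plane x) (s / 2) (to_plane y).
    move=> i; rewrite !tnth_mktuple /=; split; apply: le_lt_trans s4; apply: le_trans (xy i).
      by apply: le_trans (Re_le_modulus _); rewrite ReB.
    by apply: le_trans (Im_le_modulus _); rewrite ImB.
  have sub : polysquare (to_plane y) (3 * (s / 6)) `<=` D.
    apply: subset_trans sD; rewrite sE; apply: polysquare_sub.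
      by rewrite ler_pdivrMr// ler_pMr// ler1n.
    by have -> : s - s / 2 = s / 2 by field.
  have Oy : Omega y.
    rewrite -(to_planeK y); apply: sub => i; rewrite !subrr normr0 sE.
    by rewrite divr_gt0.
  split=> //; rewrite mulrC ler_pdivlMr// mulrC -lee_fin.
  have := submean_holomorphic Omega_open s60 (fsh j) sub; rewrite to_planeK -/k.
  move=> /le_trans; apply; apply: (le_trans (integral_modulus_le (fsh j))).
  rewrite EFinD fineK; last by rewrite ge0_fin_numE// Omega_finite.
  by rewrite leeD2l//; have := fsI 0%N j (leq0n j); rewrite invr1.
have [f [k [fh kj fk]]] := montel fsh bd.
have fz : f z = 1.
  apply/eqP; rewrite -subr_eq0 -modulus_eq0 eq_le modulus_ge0 andbT leNgt.
  apply/negP => g0; have [J JP] := fk _ Oz _ g0.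
  have := JP J (leqnn J); have [_ -> _] := fsP (k J).
  by rewrite modulusBC ltxx.
have fI J : (p_integral f <= ((m + J.+1%:R^-1) `^ p)%:E)%E.
  pose g (j : nat) t := (modulus (fs (k (j + J)%N) (of_plane t)) `^ p)%:E.
  have gm j : measurable_fun D (g j).
    by apply/measurable_EFinP; exact: measurable_modulus_powR.
  have -> : p_integral f = (\int[lebn n]_(t in D) limn_einf (g^~ t))%E.
    apply: eq_integral => t /set_mem Dt; apply/esym.
    have cv : (g^~ t) @ \oo --> (modulus (f (of_plane t)) `^ p)%:E.
      apply: powR_cvg => [j||e e0]; rewrite ?modulus_ge0//.
      have [N NP] := fk _ Dt _ e0; exists N => j Nj.
      apply: (le_lt_trans (ler_dist_modulus _ _)); apply: NP.
      exact: leq_trans Nj (leq_addr _ _).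
    rewrite is_cvg_limn_einfE; last by apply/cvg_ex; eexists; exact: cv.
    exact/cvg_lim.
  have g0 j t : D t -> (0 <= g j t)%E by move=> _; rewrite lee_fin powR_ge0.
  apply: (le_trans (fatou (lebn n) mD gm g0)).
  rewrite limn_einf_lim; apply: lime_le; first exact: is_cvg_einfs.
  apply: nearW => j; apply: (@le_trans _ _ (\int[lebn n]_(t in D) g j t)%E).
    by apply: ereal_inf_lbound; exists j => /=.
  by apply: fsI; apply: leq_trans (kj _); rewrite leq_addl.
have fA : A_p Omega p f.
  by split => //; apply: le_lt_trans (fI 0%N) _; rewrite ltry.
exists f; split => //; apply/eqP; rewrite eq_le; apply/andP; split; last first.
  by apply: ge_inf; [have [] := Sinf|exists f].
rewrite leNgt; apply/negP; rewrite -subr_gt0 => /inv_nat_lt[J JP].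
have := fI J; rewrite (p_normX fA) lee_fin leNgt => /negP; apply.
apply: gt0_ltr_powR; rewrite ?nnegrE ?powR_ge0 ?addr_ge0 ?invr_ge0//.
by rewrite -ltrBrDl.
Qed.

End minimizer.

(** * Weighted Bergman spaces *)

Section weighted_space.
Context {R : realType} {n : nat}.
Local Notation row := 'rV[C R]_n.
Local Notation mu := (measure_tuple (@lebesgue_plane R) n).
Variables (Omega : set row) (phi : row -> R).
Hypothesis Omega_open : open Omega.
Local Notation D := ((@of_plane R n) @^-1` Omega).
Local Notation W := (fun t => expR (- phi (of_plane t))).
Hypothesis mW : measurable_fun D W.
Implicit Types f g k : row -> C R.

Let mD : measurable D. Proof. exact: measurable_D. Qed.

Lemma integrable_of_ge0 (h : n.-tuple (plane R) -> R) : measurable_fun D h ->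
  (forall t, 0 <= h t) -> (\int[mu]_(t in D) (h t)%:E < +oo)%E ->
  mu.-integrable D (EFin \o h).
Proof.
move=> mh h0 hoo; apply/integrableP; split; first exact/measurable_EFinP.
rewrite (eq_integral (fun t => (h t)%:E)) // => t _ /=.
by rewrite ger0_norm.
Qed.

Lemma measurable_Re f : holomorphic Omega f ->
  measurable_fun D (fun t => Cre (f (of_plane t))).
Proof. by move=> fh; exact: (holomorphic_measurable Omega_open fh Re_lip). Qed.

Lemma measurable_Im f : holomorphic Omega f ->
  measurable_fun D (fun t => Cim (f (of_plane t))).
Proof. by move=> fh; exact: (holomorphic_measurable Omega_open fh Im_lip). Qed.

Lemma measurable_sqW f : holomorphic Omega f ->
  measurable_fun D (fun t => modulus (f (of_plane t)) ^+ 2 * W t).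
Proof.
move=> fh; apply: measurable_funM => //.
have -> : (fun t => modulus (f (of_plane t)) ^+ 2) =
    (fun t => Cre (f (of_plane t)) * Cre (f (of_plane t)) +
              Cim (f (of_plane t)) * Cim (f (of_plane t))).
  by apply/funext => t; rewrite modulus_sqr !expr2.
apply: measurable_funD; apply: measurable_funM;
  by [exact: measurable_Re|exact: measurable_Im].
Qed.

Lemma A2_integrable f : A2_weighted Omega phi f ->
  mu.-integrable D (EFin \o (fun t => modulus (f (of_plane t)) ^+ 2 * W t)).
Proof.
move=> [fh fi]; apply: integrable_of_ge0 => //; first exact: measurable_sqW.
by move=> t; rewrite mulr_ge0 ?sqr_ge0 ?expR_ge0.
Qed.

Lemma Re_conjM (a b : C R) : Cre (a * b^* ) = Cre a * Cre b + Cim a * Cim b.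
Proof. by case: a b => [? ?] [? ?] /=; rewrite mulrN opprK. Qed.

Lemma Im_conjM (a b : C R) : Cim (a * b^* ) = Cim a * Cre b - Cre a * Cim b.
Proof. by case: a b => [? ?] [? ?] /=; rewrite mulrN addrC. Qed.

Lemma Re_mul_real (a : C R) (r : R) : Cre (a * (r%:C)%C) = Cre a * r.
Proof. by case: a => [u v] /=; rewrite mulr0 subr0. Qed.

Lemma Im_mul_real (a : C R) (r : R) : Cim (a * (r%:C)%C) = Cim a * r.
Proof. by case: a => [u v] /=; rewrite mulr0 add0r. Qed.

Lemma conjM_le (a b : C R) : modulus (a * b^* ) <= modulus a ^+ 2 + modulus b ^+ 2.
Proof.
rewrite modulusM modulus_conj; have := modulus_ge0 a; have := modulus_ge0 b.
move: (modulus a) (modulus b) => u v v0 u0.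
have : 0 <= (u - v) ^+ 2 by exact: sqr_ge0.
have : 0 <= u * v by exact: mulr_ge0.
rewrite sqrrB; lra.
Qed.

Lemma Re_integrable f g : A2_weighted Omega phi f -> A2_weighted Omega phi g ->
  mu.-integrable D (EFin \o (fun t => Cre (f (of_plane t) * (g (of_plane t))^* ) * W t)).
Proof.
move=> fA gA; have [fh _] := fA; have [gh _] := gA.
apply: le_integrable (integrableD mD (A2_integrable fA) (A2_integrable gA)) => //.
  apply/measurable_EFinP; apply: measurable_funM => //.
  under eq_fun do rewrite Re_conjM.
  by apply: measurable_funD; apply: measurable_funM;
    first [exact: measurable_Re|exact: measurable_Im].
move=> t _; rewrite /= lee_fin normrM (ger0_norm (expR_ge0 _)) -mulrDl.
rewrite [leRHS]ger0_norm; last by rewrite mulr_ge0 ?expR_ge0// addr_ge0 ?sqr_ge0.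
rewrite ler_wpM2r ?expR_ge0//; apply: le_trans (conjM_le _ _).
exact: Re_le_modulus.
Qed.

Lemma Im_integrable f g : A2_weighted Omega phi f -> A2_weighted Omega phi g ->
  mu.-integrable D (EFin \o (fun t => Cim (f (of_plane t) * (g (of_plane t))^* ) * W t)).
Proof.
move=> fA gA; have [fh _] := fA; have [gh _] := gA.
apply: le_integrable (integrableD mD (A2_integrable fA) (A2_integrable gA)) => //.
  apply/measurable_EFinP; apply: measurable_funM => //.
  under eq_fun do rewrite Im_conjM.
  by apply: measurable_funB; apply: measurable_funM;
    first [exact: measurable_Re|exact: measurable_Im].
move=> t _; rewrite /= lee_fin normrM (ger0_norm (expR_ge0 _)) -mulrDl.
rewrite [leRHS]ger0_norm; last by rewrite mulr_ge0 ?expR_ge0// addr_ge0 ?sqr_ge0.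
rewrite ler_wpM2r ?expR_ge0//; apply: le_trans (conjM_le _ _).
exact: Im_le_modulus.
Qed.

Definition pairing_Re f g : R :=
  (\int[mu]_(t in D) (Cre (f (of_plane t) * (g (of_plane t))^* ) * W t))%R.

Definition pairing_Im f g : R :=
  (\int[mu]_(t in D) (Cim (f (of_plane t) * (g (of_plane t))^* ) * W t))%R.

Lemma integral_CnC_pairing f g :
  integral_CnC Omega (fun x => f x * (g x)^* * ((expR (- phi x))%:C)%C) =
  (pairing_Re f g +i* pairing_Im f g)%C.
Proof.
rewrite /integral_CnC /integral_Cn /pairing_Re /pairing_Im /Rintegral.
congr (fine _ +i* fine _)%C; apply: eq_integral => t _; congr EFin.
  exact: Re_mul_real.
exact: Im_mul_real.
Qed.

Lemma A2B f g : A2_weighted Omega phi f -> A2_weighted Omega phi g ->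
  A2_weighted Omega phi (fun x => f x - g x).
Proof.
move=> fA gA; have [fh _] := fA; have [gh _] := gA.
have dh : holomorphic Omega (fun x => f x - g x).
  by move=> x Ox; apply: differentiableB; [exact: fh|exact: gh].
split=> //.
have fgi := integrableD mD (A2_integrable fA) (A2_integrable gA).
have i2 := integrableZl mD 2 fgi.
have := integrable_lty mD i2; apply: le_lt_trans.
apply: ge0_le_integral => //.
- by move=> t _; rewrite lee_fin mulr_ge0 ?sqr_ge0 ?expR_ge0.
- by apply/measurable_EFinP; exact: (measurable_sqW dh).
- by have /integrableP[] := i2.
move=> t _; rewrite /= lee_fin -mulrDl mulrA ler_wpM2r ?expR_ge0//.
have := modulusB (f (of_plane t)) (g (of_plane t)).
have := modulus_ge0 (f (of_plane t) - g (of_plane t)).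
move: (modulus (_ - _)) (modulus (f _)) (modulus (g _)) => d u v d0 duv.
have : 0 <= (u - v) ^+ 2 by exact: sqr_ge0.
have : d ^+ 2 <= (u + v) ^+ 2 by rewrite lerXn2r ?nnegrE// (le_trans d0).
rewrite sqrrB sqrrD; lra.
Qed.

Lemma A2Z c f : A2_weighted Omega phi f -> A2_weighted Omega phi (fun x => c * f x).
Proof.
move=> fA; have [fh _] := fA.
have ch : holomorphic Omega (fun x => c * f x).
  move=> x Ox; apply: differentiableM; first exact: differentiable_cst.
  exact: fh.
split=> //.
have i2 := integrableZl mD (modulus c ^+ 2) (A2_integrable fA).
have := integrable_lty mD i2; apply: le_lt_trans.
apply: ge0_le_integral => //.
- by move=> t _; rewrite lee_fin mulr_ge0 ?sqr_ge0 ?expR_ge0.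
- by apply/measurable_EFinP; exact: (measurable_sqW ch).
- by have /integrableP[] := i2.
by move=> t _; rewrite /= lee_fin modulusM exprMn -mulrA lexx.
Qed.

(** A holomorphic function that vanishes almost everywhere vanishes, by the
    sub-mean value inequality; [h] is a power of its modulus, possibly times a
    positive weight. *)
Lemma ae_zero f (h : n.-tuple (plane R) -> R) : holomorphic Omega f ->
  measurable_fun D h -> (forall t, D t -> 0 <= h t) ->
  (forall t, D t -> h t = 0 -> f (of_plane t) = 0) ->
  (\int[mu]_(t in D) (h t)%:E = 0)%E -> forall x, Omega x -> f x = 0.
Proof.
move=> fh mh h0 hf ih x Ox.
have ae0 : ae_eq mu D (EFin \o h) (cst 0%E).
  apply/ae_eq_integral_abs => //; first exact/measurable_EFinP.
  rewrite -[RHS]ih; apply: eq_integral => t /set_mem Dt.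
  by rewrite /= ger0_norm// h0.
have if0 : (\int[mu]_(t in D) (modulus (f (of_plane t)))%:E = 0)%E.
  rewrite (@ge0_ae_eq_integral _ _ _ mu D _ (cst 0%E))//.
  - exact: integral0.
  - by apply/measurable_EFinP; exact: (holomorphic_measurable Omega_open fh ler_dist_modulus).
  - by move=> t _; rewrite lee_fin modulus_ge0.
  - apply: filterS ae0 => t H Dt; rewrite /= (hf _ Dt) ?modulus0//.
    by have [] := H Dt.
have Dx : D (to_plane x) by rewrite /= to_planeK.
have [r r0 rD] := open_polysquare Omega_open Dx.
have r30 : 0 < r / 3 by rewrite divr_gt0.
have rE : 3 * (r / 3) = r by rewrite mulrC divfK.
have := @submean_holomorphic R n Omega Omega_open f (to_plane x) _ r30 fh.
rewrite rE if0 to_planeK => /(_ rD); rewrite lee_fin.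
rewrite pmulr_rle0; last by rewrite exprn_gt0// divr_gt0// exprn_gt0.
move=> fx; apply/eqP; rewrite -modulus_eq0 eq_le fx.
exact: modulus_ge0.
Qed.

(** Two reproducing kernels at the same point differ by a function that is
    orthogonal to itself. *)
Lemma reproducing_unique w k1 k2 : reproducing_at Omega phi w k1 ->
  reproducing_at Omega phi w k2 -> forall x, Omega x -> k1 x = k2 x.
Proof.
move=> [A1 r1] [A2 r2] x Ox; apply/eqP; rewrite -subr_eq0; apply/eqP.
pose d x := k1 x - k2 x; have dA : A2_weighted Omega phi d := A2B A1 A2.
have E : pairing_Re d k1 = pairing_Re d k2.
  by have := r1 _ dA; rewrite (r2 _ dA) !integral_CnC_pairing => -[->].
have dd : pairing_Re d d = 0.
  rewrite -[RHS](subrr (pairing_Re d k1)) {2}E /pairing_Re -RintegralB//.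
  - apply: eq_Rintegral => t _; rewrite -mulrBl !Re_conjM /d; congr (_ * _).
    by rewrite !ReB !ImB; ring.
  - exact: Re_integrable.
  - exact: Re_integrable.
have [dh _] := dA.
apply: (@ae_zero d (fun t => modulus (d (of_plane t)) ^+ 2 * W t)) => //.
- exact: measurable_sqW.
- by move=> t _; rewrite mulr_ge0 ?sqr_ge0 ?expR_ge0.
- move=> t _ /eqP; rewrite mulf_eq0 (gt_eqF (expR_gt0 _)) orbF sqrf_eq0.
  by rewrite modulus_eq0 => /eqP.
have := A2_integrable dA => di.
rewrite -[LHS]fineK; last by exact: (integrable_fin_num mD di).
congr EFin; rewrite -[RHS]dd /pairing_Re /Rintegral; congr fine.
apply: eq_integral => t _; congr EFin; congr (_ * _).
by rewrite Re_conjM modulus_sqr !expr2.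
Qed.

End weighted_space.

(** * A tangent inequality for powers of the modulus *)

Section variation.
Context {R : realType}.

(** Concavity of [x `^ s] at 1, as a case of Young's inequality. *)
Lemma powR_bernoulli (x s : R) : 0 <= x -> 0 < s <= 1 -> x `^ s <= 1 + s * (x - 1).
Proof.
move=> x0 /andP[s0]; rewrite le_eqVlt => /predU1P[->|s1].
  by rewrite powRr1// mul1r addrC subrK.
have s'0 : 0 < 1 - s by rewrite subr_gt0.
have sV : 0 < s^-1 by rewrite invr_gt0.
have s'V : 0 < (1 - s)^-1 by rewrite invr_gt0.
have conj1 : s^-1^-1 + (1 - s)^-1^-1 = 1 by rewrite !invrK addrC subrK.
have := conjugate_powR (powR_ge0 x s) ler01 sV s'V conj1.
rewrite mulr1 -powRrM divff ?gt_eqF// powRr1// powR1 !invrK mul1r.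
by move=> /le_trans; apply; rewrite le_eqVlt; apply/orP; left; apply/eqP; ring.
Qed.

Lemma powR_sqM (A p : R) : 0 < A -> A ^+ 2 * A `^ (p - 2) = A `^ p.
Proof.
move=> A0; rewrite -(powR_mulrn 2 (ltW A0)) -powRD ?(gt_eqF A0) ?implybT//.
by congr (_ `^ _); ring.
Qed.

(** Concavity of [x `^ (p / 2)] bounds [|a + b| ^ p] by its first order
    expansion in [|a + b| ^ 2 = |a| ^ 2 + 2 Re (b conj a) + |b| ^ 2]; the error
    term is a square with exactly the weight [|a| ^ (p - 2)]. *)
Lemma modulus_powR_tangent (p : R) (a b : C R) : 1 <= p <= 2 -> a != 0 ->
  modulus (a + b) `^ p <= modulus a `^ p +
    p / 2 * (modulus a `^ (p - 2) * (2 * Cre (b * a^* ) + modulus b ^+ 2)).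
Proof.
move=> /andP[p1 p2] a0; have A0 : 0 < modulus a by rewrite modulus_gt0.
have p0 : 0 < p by exact: lt_le_trans p1.
set A := modulus a in A0 *; pose u := modulus (a + b) / A.
have u0 : 0 <= u by rewrite divr_ge0 ?modulus_ge0// ltW.
have uE : modulus (a + b) = A * u by rewrite /u mulrC divfK ?gt_eqF.
have sq : modulus (a + b) ^+ 2 = A ^+ 2 + (2 * Cre (b * a^* ) + modulus b ^+ 2).
  by rewrite /A !modulus_sqr Re_conjM ReD ImD; ring.
have up : u `^ p = (u ^+ 2) `^ (p / 2).
  rewrite -(powR_mulrn 2 u0) -powRrM; congr (_ `^ _); by rewrite mulrC divfK.
have ps : 0 < p / 2 <= 1 by rewrite divr_gt0//= ler_pdivrMr// mul1r.
rewrite uE powRM ?(ltW A0)// up.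
apply: (@le_trans _ _ (A `^ p * (1 + p / 2 * (u ^+ 2 - 1)))).
  by rewrite ler_wpM2l ?powR_ge0// powR_bernoulli// sqr_ge0.
rewrite mulrDr mulr1 lerD2l -(powR_sqM p A0) le_eqVlt; apply/orP; left; apply/eqP.
rewrite (_ : 2 * _ + _ = A ^+ 2 * (u ^+ 2 - 1)); first by ring.
by rewrite mulrBr mulr1 -exprMn -uE sq; ring.
Qed.

Lemma Re_subM_conj (f c m : C R) :
  Cre ((f - c * m) * m^* ) = Cre (f * m^* ) - Cre c * modulus m ^+ 2.
Proof.
rewrite !Re_conjM modulus_sqr.
by case: f c m => [f1 f2] [c1 c2] [m1 m2] /=; ring.
Qed.

Lemma Re_iM_subM_conj (f c m : C R) :
  Cre ('i%C * (f - c * m) * m^* ) = Cim c * modulus m ^+ 2 - Cim (f * m^* ).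
Proof.
rewrite Re_conjM Im_conjM modulus_sqr.
by case: f c m => [f1 f2] [c1 c2] [m1 m2] /=; ring.
Qed.

Lemma Re_conj_realM (f m : C R) (k : R) :
  Cre (f * ((k%:C)%C * m)^* ) = k * Cre (f * m^* ).
Proof. by rewrite !Re_conjM; case: f m => [f1 f2] [m1 m2] /=; ring. Qed.

Lemma Im_conj_realM (f m : C R) (k : R) :
  Cim (f * ((k%:C)%C * m)^* ) = k * Cim (f * m^* ).
Proof. by rewrite !Im_conjM; case: f m => [f1 f2] [m1 m2] /=; ring. Qed.

End variation.

(** * The minimizer as a reproducing kernel *)

Section bergman_kernels.
Context {R : realType} {n : nat}.
Local Notation row := 'rV[C R]_n.
Local Notation mu := (measure_tuple (@lebesgue_plane R) n).
Variables (Omega : set row) (p : R) (z : row) (m : row -> C R).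
Hypotheses (Omega_open : open Omega) (Omega_connected : connected Omega).
Hypotheses (p12 : 1 <= p <= 2) (Oz : Omega z).
Hypotheses (mA : A_p Omega p m) (mz : m z = 1)
  (m_min : p_norm Omega p m = m_p Omega p z).
Local Notation D := ((@of_plane R n) @^-1` Omega).
Let phi (x : row) := (2 - p) * ln (modulus (m x)).
Local Notation W := (fun t => expR (- phi (of_plane t))).

Let p1 : 1 <= p. Proof. by case/andP: p12. Qed.
Let p0 : 0 < p. Proof. exact: lt_le_trans p1. Qed.
Let pn0 : p != 0. Proof. by rewrite gt_eqF. Qed.
Let mD : measurable D. Proof. exact: measurable_D. Qed.
Let mh : holomorphic Omega m. Proof. by case: mA. Qed.

Let mW : measurable_fun D W.
Proof.
have mm := holomorphic_measurable Omega_open mh ler_dist_modulus.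
have ml : measurable_fun D (fun t => ln (modulus (m (of_plane t)))).
  exact: (measurableT_comp (@measurable_ln R) mm).
have mphi : measurable_fun D (fun t => - phi (of_plane t)).
  by apply: measurableT_comp => //; exact: measurable_funM.
exact: (measurableT_comp (@measurable_expR R) mphi).
Qed.

(** At a zero of [m] the left-hand side is 1, whatever [p] is; this value does not
    count, because the zeros form a null set and, in the weighted square norm of
    [m], because it is multiplied by 0. *)
Lemma weightE x : m x != 0 -> expR (- phi x) = modulus (m x) `^ (p - 2).
Proof.
move=> mx; rewrite /powR modulus_eq0 (negbTE mx) /phi -mulNr opprB.
by [].
Qed.

Lemma sq_weight x : modulus (m x) ^+ 2 * expR (- phi x) = modulus (m x) `^ p.
Proof.
have [mx|mx] := eqVneq (m x) 0; first by rewrite mx modulus0 expr0n mul0r powR0.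
by rewrite weightE// powR_sqM// modulus_gt0.
Qed.

Lemma minimizer_A2 : A2_weighted Omega phi m.
Proof.
split=> //; case: mA => _; rewrite /integral_Cn.
by under [X in _ -> (X < _)%E]eq_integral do rewrite sq_weight.
Qed.

Let mass : p_integral Omega p m = (m_p Omega p z `^ p)%:E.
Proof. by rewrite (p_normX p1 mA) m_min. Qed.

Let mass_weighted :
  (\int[mu]_(t in D) (modulus (m (of_plane t)) ^+ 2 * W t))%R = m_p Omega p z `^ p.
Proof.
rewrite -[RHS]/(fine (m_p Omega p z `^ p)%:E) -mass /Rintegral; congr fine.
by apply: eq_integral => t _; rewrite sq_weight.
Qed.

Lemma mass_gt0 : 0 < m_p Omega p z `^ p.
Proof.
rewrite lt_def powR_ge0 andbT; apply/eqP => I0.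
have m0 : m z = 0.
  apply: (@ae_zero R n Omega Omega_open m (fun t => modulus (m (of_plane t)) `^ p) mh) => //.
  - exact: measurable_modulus_powR.
  - by move=> t _; exact: powR_ge0.
  - by move=> t _ /powR_eq0_eq0 /eqP; rewrite modulus_eq0 => /eqP.
  - by have := mass; rewrite I0.
by have /eqP := mz; rewrite m0 eq_sym oner_eq0.
Qed.

(** First variation. For real [s] the function [m + s *: g] competes with [m],
    and integrating the tangent inequality, which holds off the zeros of [m],
    gives [0 <= s * J + s ^+ 2 * N / 2] with [N] the weighted norm of [g]. As [s]
    has either sign, [J = 0]. *)
Lemma minimizer_orthogonal g : A2_weighted Omega phi g -> g z = 0 ->
  pairing_Re Omega phi g m = 0.
Proof.
move=> gA gz; have [gh _] := gA.
set J := pairing_Re _ _ _ _.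
have iM := A2_integrable Omega_open mW minimizer_A2.
have iG := A2_integrable Omega_open mW gA.
have iJ := Re_integrable Omega_open mW gA minimizer_A2.
pose N : R := (\int[mu]_(t in D) (modulus (g (of_plane t)) ^+ 2 * W t))%R.
have N0 : 0 <= N.
  by apply: Rintegral_ge0 => t _; rewrite mulr_ge0 ?sqr_ge0 ?expR_ge0.
have key (s : R) : 0 <= s * J + s ^+ 2 * N / 2.
  pose h x := m x + (s%:C)%C * g x.
  have hh : holomorphic Omega h.
    move=> x Ox; apply: differentiableD; first exact: mh.
    by apply: differentiableM; [exact: differentiable_cst|exact: gh].
  pose Q1 t := p * s * (Cre (g (of_plane t) * (m (of_plane t))^* ) * W t).
  pose Q2 t := p / 2 * s ^+ 2 * (modulus (g (of_plane t)) ^+ 2 * W t).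
  pose Q t := modulus (m (of_plane t)) ^+ 2 * W t + (Q1 t + Q2 t).
  have iQ1 : mu.-integrable D (EFin \o Q1) by exact: (integrableZl mD (p * s) iJ).
  have iQ2 : mu.-integrable D (EFin \o Q2).
    exact: (integrableZl mD (p / 2 * s ^+ 2) iG).
  have iQ12 : mu.-integrable D (EFin \o (fun t => Q1 t + Q2 t)).
    exact: (integrableD mD iQ1 iQ2).
  have iQ : mu.-integrable D (EFin \o Q) by exact: (integrableD mD iM iQ12).
  have QE : (\int[mu]_(t in D) Q t)%R = m_p Omega p z `^ p + (p * s * J + p / 2 * s ^+ 2 * N).
    by rewrite /Q RintegralD// RintegralD// mass_weighted /Q1 /Q2 !RintegralZl.
  have tangent t : m (of_plane t) != 0 -> modulus (h (of_plane t)) `^ p <= Q t.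
    move=> mt; apply: (le_trans (modulus_powR_tangent _ p12 mt)).
    rewrite /Q sq_weight lerD2l /Q1 /Q2 -weightE// le_eqVlt; apply/orP; left; apply/eqP.
    rewrite modulusM modulus_real exprMn real_normK ?num_real//.
    have -> : Cre ((s%:C)%C * g (of_plane t) * (m (of_plane t))^* ) =
        s * Cre (g (of_plane t) * (m (of_plane t))^* ).
      by rewrite -mulrA [X in Cre X]mulrC Re_mul_real mulrC.
    by field.
  have Q0 t : 0 <= Q t.
    have [mt|mt] := eqVneq (m (of_plane t)) 0; last exact: le_trans (powR_ge0 _ _) (tangent _ mt).
    rewrite /Q /Q1 mt modulus0 conjC0 mulr0 /= mul0r mulr0 expr0n mul0r !add0r /Q2.
    apply: mulr_ge0; apply: mulr_ge0; rewrite ?sqr_ge0 ?expR_ge0//.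
    by apply: divr_ge0 => //; exact: ltW.
  have hQ : (p_integral Omega p h <= \int[mu]_(t in D) (Q t)%:E)%E.
    apply: ae_ge0_le_integral => //.
    - by move=> t _; rewrite lee_fin powR_ge0.
    - by apply/measurable_EFinP; exact: measurable_modulus_powR.
    - by move=> t _; rewrite lee_fin.
    - by have /integrableP[] := iQ.
    have mz0 : m z != 0 by rewrite mz oner_eq0.
    apply: negligibleS (zeros_negligible Omega_open Omega_connected mh Oz mz0).
    move=> t /= /not_implyP[Dt nle]; split => //; apply/eqP/negPn/negP => mt.
    by apply: nle; rewrite lee_fin; exact: tangent.
  have hA : A_p Omega p h.
    by split=> //; apply: (le_lt_trans hQ); exact: integrable_lty.
  have hz : h z = 1 by rewrite /h gz mulr0 addr0.
  have m_le : m_p Omega p z <= p_norm Omega p h.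
    apply: ge_inf; last by exists h.
    by exists 0 => _ [f _ <-]; exact: powR_ge0.
  have : m_p Omega p z `^ p <= (\int[mu]_(t in D) Q t)%R.
    rewrite -lee_fin; apply: (@le_trans _ _ (p_integral Omega p h)).
      rewrite (p_normX p1 hA) lee_fin; apply: ge0_ler_powR => //; rewrite ?nnegrE ?powR_ge0 ?(ltW p0)//.
      by rewrite -m_min powR_ge0.
    apply: (le_trans hQ); rewrite /Rintegral fineK//.
    exact: (integrable_fin_num mD iQ).
  rewrite QE lerDl.
  have -> : p * s * J + p / 2 * s ^+ 2 * N = p * (s * J + s ^+ 2 * N / 2) by field.
  by rewrite pmulr_rge0.
apply/eqP/negPn/negP => J0.
have N10 : 0 < N + 1 by rewrite ltr_wpDl.
(* the minimum of the quadratic is at [- J / N]; adding 1 avoids the case [N = 0] *)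
have := key (- J / (N + 1)).
have -> : - J / (N + 1) * J + (- J / (N + 1)) ^+ 2 * N / 2 =
    - (J ^+ 2 / (N + 1) ^+ 2 * (N / 2 + 1)) by field; rewrite gt_eqF.
rewrite oppr_ge0 leNgt => /negP; apply.
have J2 : 0 < J ^+ 2 by rewrite lt_def sqrf_eq0 J0 sqr_ge0.
apply: mulr_gt0; first by apply: divr_gt0 => //; exact: exprn_gt0.
by rewrite ltr_wpDl// divr_ge0.
Qed.

(** The function [f - f z *: m] vanishes at [z], so it and its multiple by ['i]
    are admissible directions; they give the real and the imaginary part. *)
Lemma minimizer_pairing f : A2_weighted Omega phi f ->
  pairing_Re Omega phi f m = Cre (f z) * m_p Omega p z `^ p /\
  pairing_Im Omega phi f m = Cim (f z) * m_p Omega p z `^ p.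
Proof.
move=> fA; pose g x := f x - f z * m x.
have cA := A2Z Omega_open mW (f z) minimizer_A2.
have gA : A2_weighted Omega phi g := A2B Omega_open mW fA cA.
have gz : g z = 0 by rewrite /g mz mulr1 subrr.
have iM := A2_integrable Omega_open mW minimizer_A2.
split.
  have := minimizer_orthogonal gA gz.
  have -> : pairing_Re Omega phi g m = pairing_Re Omega phi f m - Cre (f z) * m_p Omega p z `^ p.
    rewrite -mass_weighted -RintegralZl// /pairing_Re -RintegralB//.
    - apply: eq_Rintegral => t _; rewrite mulrA -mulrBl; congr (_ * _).
      exact: Re_subM_conj.
    - exact: Re_integrable minimizer_A2.
    - exact: (integrableZl mD _ iM).
  by move=> /eqP; rewrite subr_eq0 => /eqP.
have igA := A2Z Omega_open mW 'i%C gA.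
have igz : 'i%C * g z = 0 by rewrite gz mulr0.
have := minimizer_orthogonal igA igz.
have -> : pairing_Re Omega phi (fun x => 'i%C * g x) m =
    Cim (f z) * m_p Omega p z `^ p - pairing_Im Omega phi f m.
  rewrite -mass_weighted -RintegralZl// /pairing_Re /pairing_Im -RintegralB//.
  - apply: eq_Rintegral => t _; rewrite mulrA -mulrBl; congr (_ * _).
    exact: Re_iM_subM_conj.
  - exact: (integrableZl mD _ iM).
  - exact: Im_integrable minimizer_A2.
by move=> /eqP; rewrite subr_eq0 => /eqP.
Qed.

Lemma minimizer_reproducing : reproducing_at Omega phi z
  (fun x => m x * ((m_p Omega p z `^ (- p))%:C)%C).
Proof.
set K := m_p Omega p z `^ (- p).
have KE : K * m_p Omega p z `^ p = 1 by rewrite /K powRN mulVf// gt_eqF// mass_gt0.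
have -> : (fun x => m x * (K%:C)%C) = (fun x => (K%:C)%C * m x).
  by apply/funext => x; rewrite mulrC.
have KA := A2Z Omega_open mW (K%:C)%C minimizer_A2.
split=> // f fA; rewrite integral_CnC_pairing.
have [fRe fIm] := minimizer_pairing fA.
have -> : pairing_Re Omega phi f (fun x => (K%:C)%C * m x) = Cre (f z).
  rewrite -[RHS]mulr1 -KE mulrCA -fRe /pairing_Re -RintegralZl//; last exact: Re_integrable minimizer_A2.
  apply: eq_Rintegral => t _; rewrite mulrA; congr (_ * _).
  exact: Re_conj_realM.
have -> : pairing_Im Omega phi f (fun x => (K%:C)%C * m x) = Cim (f z).
  rewrite -[RHS]mulr1 -KE mulrCA -fIm /pairing_Im -RintegralZl//; last exact: Im_integrable minimizer_A2.
  apply: eq_Rintegral => t _; rewrite mulrA; congr (_ * _).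
  exact: Im_conj_realM.
by case: (f z).
Qed.

Lemma minimizer_kernel x : Omega x ->
  weighted_kernel Omega phi x z = m x * ((m_p Omega p z `^ (- p))%:C)%C.
Proof.
move=> Ox; rewrite /weighted_kernel; case: xgetP => [k _ kr|none].
  exact: (reproducing_unique Omega_open mW kr minimizer_reproducing).
by have := none _ minimizer_reproducing.
Qed.

End bergman_kernels.

Theorem theorem1p2 (R : realType) (n : nat) (Omega : set 'rV[C R]_n)
    (Omega_open : open Omega) (Omega_connected : connected Omega)
    (Omega_bounded : bounded_set Omega) (p : R) (hp : 1 <= p <= 2) :
  forall z : 'rV[C R]_n, Omega z ->
  forall x : 'rV[C R]_n, Omega x ->
    p_kernel Omega p x z = kernel_2p Omega p z x z.
Proof.
move=> z Oz x Ox; have /andP[p1 _] := hp.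
have [m mP] := minimizer_exists Omega_open Omega_bounded p1 Oz.
have [mA mz mm] : [set f | [/\ A_p Omega p f, f z = 1 &
    p_norm Omega p f = m_p Omega p z]] (p_minimizer Omega p z).
  by rewrite /p_minimizer; case: xgetP => [//|/(_ m)]; case.
exact/esym/(minimizer_kernel Omega_open Omega_connected hp Oz mA mz mm Ox).
Qed.
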